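(* Let $F$ be a free group. Then $F$ is $\mathcal D_{\mathbb{F}_2[F]}$-subgroup rigid; that is, for every finitely generated subgroup $H$ of $F$ there exists a subgroup $\widetilde H$ of $F$ containing $H$ such that $$\mathrm{tor}_{\mathbb{F}_2[F]}\bigl(I_{\mathbb{F}_2[F]}/{}^{F}I_{\mathbb{F}_2[H]}\bigr)={}^{F}I_{\mathbb{F}_2[\widetilde H]}/{}^{F}I_{\mathbb{F}_2[H]}.$$
   Context: For a field $K$ and a free group $F$, $\mathcal D_{K[F]}$ is the universal division $K[F]$-ring of fractions: an embedding of $K[F]$ into a division ring $\mathcal D_{K[F]}$, generated as a division ring by $K[F]$, such that for every ring homomorphism $K[F]\to\mathcal E$ to a division ring and every finitely presented left $K[F]$-module $M$, $\dim_{\mathcal D_{K[F]}}\mathcal D_{K[F]}\otimes_{K[F]}M\le\dim_{\mathcal E}\mathcal E\otimes_{K[F]}M$. It exists and is unique up to $K[F]$-isomorphism. For a left $K[F]$-module $M$, $\mathrm{tor}_{K[F]}(M)$ is the kernel of the canonical map $M\to\mathcal D_{K[F]}\otimes_{K[F]}M$, $m\mapsto 1\otimes m$. $I_{K[F]}$ is the augmentation ideal of $K[F]$, and for a subgroup $H\le F$, ${}^{F}I_{K[H]}$ is the left ideal of $K[F]$ generated by the augmentation ideal $I_{K[H]}$ of $K[H]$. $\mathbb{F}_2$ is the field with two elements. *)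

(* Defs.v *)
From HB Require Import structures.
From mathcomp Require Import all_boot all_algebra.
From mathcomp Require Import finmap boolp.
From mathcomp Require Import monalg.

Set Implicit Arguments.
Unset Strict Implicit.
Unset Printing Implicit Defensive.

Set Warnings "-redundant-canonical-projection,-projection-no-head-constant".

Import GRing.Theory.

Local Open Scope ring_scope.
Local Open Scope quotient_scope.

Section Groups.
Variable F : groupType.

(* Only the values of f on B matter. *)
Definition free_basis (B : {pred F}) : Prop :=
  forall (G : groupType) (f : F -> G),
  exists phi : {multiplicative F -> G},
    {in B, phi =1 f} /\
    forall psi : {multiplicative F -> G}, {in B, psi =1 f} -> psi =1 phi.

Definition free_group : Prop := exists B : {pred F}, free_basis B.

Definition finitely_generated (H : groupClosed F) : Prop :=
  exists s : seq F, {subset s <= H} /\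
    forall L : groupClosed F, {subset s <= L} -> {subset H <= L}.

End Groups.

Section Modules.
Variables (R : nzRingType) (M : lmodType R).

Definition span (S : M -> Prop) : {pred M} :=
  fun x => `[< forall N : {pred M},
                 submod_closed N -> (forall y, S y -> y \in N) -> x \in N >].

Lemma spanP (S : M -> Prop) x :
  x \in span S <->
  forall N : {pred M},
    submod_closed N -> (forall y, S y -> y \in N) -> x \in N.
Proof. by split=> [/asboolP|h]; [|apply/asboolP]. Qed.

Lemma mem_span (S : M -> Prop) x : S x -> x \in span S.
Proof. by move=> Sx; apply/spanP => N _; apply. Qed.

Lemma span_submod_closed S : submod_closed (span S).
Proof.
split=> [|a x y /spanP Sx /spanP Sy]; apply/spanP => N clN SN.
  exact: clN.1.
by apply: clN.2; [apply: Sx|apply: Sy].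
Qed.

HB.instance Definition _ S :=
  GRing.isSubmodClosed.Build R M (span S) (span_submod_closed S).

Definition finitely_generated_submod (N : {pred M}) : Prop :=
  exists s : seq M, N =i span (fun x => x \in s).

Definition submod (N : submodClosed M) : Type := {x : M | x \in N}.

Section Submod.
Variable N : submodClosed M.
HB.instance Definition _ := SubChoice.on (submod N).
HB.instance Definition _ := GRing.SubChoice_isSubLmodule.Build R M
  (fun x => x \in N) (submod N) (submodClosedP N).
End Submod.

Section Quotient.
Variable N : submodClosed M.

Definition zmod_of_submod : zmodClosed M :=
  HB.pack (GRing.SubmodClosed.sort N)
    (GRing.isZmodClosed.Build M (GRing.SubmodClosed.sort N)
       (GRing.submod_closedB (submodClosedP N))).

Definition quot_module : Type := Quotient.quot zmod_of_submod.
HB.instance Definition _ := GRing.Zmodule.on quot_module.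
HB.instance Definition _ := EqQuotient.on quot_module.

Definition proj (x : M) : quot_module := \pi_(Quotient.quot zmod_of_submod) x.

Lemma projP x y : proj x = proj y <-> x - y \in N.
Proof.
by rewrite -[_ \in N]/(_ \in zmod_of_submod) Quotient.idealrBE; split=> /eqP.
Qed.

Lemma proj_eq0 x : (proj x == 0) = (x \in N).
Proof.
have <- : proj 0 = 0 by rewrite /proj raddf0.
by apply/eqP/idP => [/projP|xN]; [|apply/projP]; rewrite subr0.
Qed.

Definition quot_repr (q : quot_module) : M :=
  repr (q : Quotient.quot zmod_of_submod).

Lemma quot_reprK : cancel quot_repr proj.
Proof. by move=> q; rewrite /proj reprK. Qed.

Lemma proj_surj q : exists x, proj x = q.
Proof. by exists (quot_repr q); rewrite quot_reprK. Qed.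

Lemma projD : {morph proj : x y / x + y}.
Proof. by move=> x y; rewrite /proj raddfD. Qed.

Definition quot_scale (a : R) (q : quot_module) : quot_module :=
  proj (a *: quot_repr q).

Lemma proj_scale a x : proj (a *: x) = quot_scale a (proj x).
Proof.
apply/projP; rewrite -scalerBr rpredZ //.
by apply/projP; rewrite quot_reprK.
Qed.

Lemma quot_scaleA a b q :
  quot_scale a (quot_scale b q) = quot_scale (a * b) q.
Proof. by case: (proj_surj q) => x <-; rewrite -!proj_scale scalerA. Qed.

Lemma quot_scale1 : left_id 1 quot_scale.
Proof. by move=> q; case: (proj_surj q) => x <-; rewrite -proj_scale scale1r. Qed.

Lemma quot_scaleDr : right_distributive quot_scale +%R.
Proof.
move=> a q r; case: (proj_surj q) => x <-; case: (proj_surj r) => y <-.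
by rewrite -projD -!proj_scale scalerDr projD.
Qed.

Lemma quot_scaleDl q : {morph quot_scale^~ q : a b / a + b}.
Proof.
by move=> a b; case: (proj_surj q) => x <-; rewrite -!proj_scale scalerDl projD.
Qed.

HB.instance Definition _ := GRing.Zmodule_isLmodule.Build R quot_module
  quot_scaleA quot_scale1 quot_scaleDr quot_scaleDl.

Lemma proj_is_linear : linear proj.
Proof. by move=> a x y; rewrite projD proj_scale. Qed.

HB.instance Definition _ :=
  GRing.isLinear.Build R M quot_module *:%R proj proj_is_linear.

End Quotient.

(* The image of L in M / N, that is L / N when N is contained in L. *)
Definition sub_quot (N L : submodClosed M) : {pred quot_module N} :=
  fun q => `[< exists2 x, x \in L & proj N x = q >].

End Modules.

Arguments sub_quot {R M} N L _.

Lemma sub_quotP (R : nzRingType) (M : lmodType R) (N L : submodClosed M)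
    (q : quot_module N) :
  q \in sub_quot N L <-> exists2 x, x \in L & proj N x = q.
Proof. by split=> /asboolP. Qed.

(* The intersection of L with I, as a submodule of the module I. *)
Section Restriction.
Variables (R : nzRingType) (M : lmodType R) (I L : submodClosed M).

Definition submod_in : {pred submod I} := fun x => val x \in L.

Lemma mem_submod_in (x : submod I) : (x \in submod_in) = (val x \in L).
Proof. by []. Qed.

Lemma submod_in_closed : submod_closed submod_in.
Proof.
split=> [|a x y Lx Ly]; first exact: (rpred0 L).
exact: (rpredD (rpredZ a Lx) Ly).
Qed.

HB.instance Definition _ :=
  GRing.isSubmodClosed.Build R (submod I) submod_in submod_in_closed.

End Restriction.

Arguments submod_in {R M} I L _.

Definition finitely_presented (R : nzRingType) (M : lmodType R) : Prop :=
  exists (n : nat) (phi : {linear 'rV[R]_n -> M}),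
    (forall m, exists x, phi x = m) /\
    finitely_generated_submod (fun x => phi x == 0).

(* D (x)_R M, where D is a right R-module through f, presented as the free left
   D-module on the set M modulo the relations <m + n> = <m> + <n> and
   <r m> = f(r) <m>, so that a (x) m is the class of a <m>; [tensor_universal]
   below is the usual universal property with respect to balanced maps. *)
Section Tensor.
Variables (R D : nzRingType) (f : {rmorphism R -> D}) (M : lmodType R).

Variant tensor_rel : {malg D[M]} -> Prop :=
| TensorRelD m n : tensor_rel (<< (m + n)%R >> - << m >> - << n >>)
| TensorRelZ r m : tensor_rel (<< (r *: m)%R >> - << f r *g m >>).

Definition tensor : lmodType D := quot_module (span tensor_rel).

Definition pure_tensor (a : D) (m : M) : tensor :=
  proj (span tensor_rel) << a *g m >>.

Definition tor : {pred M} := fun m => pure_tensor 1 m == 0.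

Lemma mem_tor m : (m \in tor) = (pure_tensor 1 m == 0).
Proof. by []. Qed.

Definition balanced (A : zmodType) (b : D -> M -> A) : Prop :=
  [/\ forall a a' m, b (a + a') m = b a m + b a' m,
      forall a m m', b a (m + m') = b a m + b a m' &
      forall a r m, b (a * f r) m = b a (r *: m)].

Lemma scale_malgU (a c : D) (m : M) : a *: << c *g m >> = << a * c *g m >>.
Proof. by apply/malgP => k; rewrite mcoeffZ !mcoeffU mulrnAr. Qed.

Lemma pure_tensorZ a c m : a *: pure_tensor c m = pure_tensor (a * c) m.
Proof. by rewrite -[LHS]linearZ /= scale_malgU. Qed.

Lemma pure_tensor_balanced : balanced pure_tensor.
Proof.
split=> [a a' m|a m m'|a r m].
- by rewrite /pure_tensor monalgUD linearD.
- rewrite /pure_tensor -linearD; apply/projP.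
  rewrite opprD addrA -[a]mulr1 -!scale_malgU -!scalerBr.
  by apply/rpredZ/mem_span/TensorRelD.
- rewrite /pure_tensor; apply/esym/projP.
  rewrite -[a in X in X - _]mulr1 -!scale_malgU -scalerBr.
  by apply/rpredZ/mem_span/TensorRelZ.
Qed.

Lemma tensor_ind (P : tensor -> Prop) :
  P 0 -> (forall x y, P x -> P y -> P (x + y)) ->
  (forall a m, P (pure_tensor a m)) -> forall x, P x.
Proof.
move=> P0 PD Pp x; case: (proj_surj x) => g <-.
rewrite [g]monalgE linear_sum /=.
by apply: (big_ind P) => // m _; apply: Pp.
Qed.

Section Universal.
Variables (A : zmodType) (b : D -> M -> A) (bal : balanced b).

Let bD a a' m : b (a + a') m = b a m + b a' m. Proof. by case: bal. Qed.
Let b0 m : b 0 m = 0.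
Proof. by apply: (addrI (b 0 m)); rewrite -bD !addr0. Qed.

Definition malg_lift (g : {malg D[M]}) : A := \sum_(m <- msupp g) b g@_m m.

Lemma malg_liftw (d : {fset M}) g : (msupp g `<=` d)%fset ->
  malg_lift g = \sum_(m <- d) b g@_m m.
Proof.
move=> le; rewrite /malg_lift; apply: (big_fset_incl _ le) => m _ /mcoeff_outdom ->.
exact: b0.
Qed.

Lemma malg_liftD : {morph malg_lift : x y / x + y}.
Proof.
move=> x y; rewrite (malg_liftw (msuppD_le x y)).
rewrite (malg_liftw (fsubsetUl (msupp x) (msupp y))).
rewrite (malg_liftw (fsubsetUr (msupp x) (msupp y))) -big_split /=.
by apply: eq_bigr => m _; rewrite mcoeffD bD.
Qed.

Lemma malg_liftU a m : malg_lift << a *g m >> = b a m.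
Proof. by rewrite (malg_liftw msuppU_le) big_seq_fset1 mcoeffUU. Qed.

Lemma malg_lift0 : malg_lift 0 = 0.
Proof. by rewrite /malg_lift msupp0 big_seq_fset0. Qed.

Lemma malg_liftN : {morph malg_lift : x / - x}.
Proof.
move=> x; apply: (addrI (malg_lift x)).
by rewrite -malg_liftD !subrr malg_lift0.
Qed.

Lemma malg_lift_span x : x \in span tensor_rel -> malg_lift x = 0.
Proof.
pose N : {pred {malg D[M]}} := fun x => `[< forall a, malg_lift (a *: x) = 0 >].
move=> /spanP /(_ N); suff h : submod_closed N /\ forall y, tensor_rel y -> y \in N.
  by case: h => h1 h2 /(_ h1 h2) /asboolP /(_ 1); rewrite scale1r.
have [_ bDr bZ] := bal.
split; first split.
- by apply/asboolP => a; rewrite scaler0 malg_lift0.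
- move=> c y z /asboolP hy /asboolP hz; apply/asboolP => a.
  by rewrite scalerDr scalerA malg_liftD hy hz addr0.
- move=> _ [m n|r m]; apply/asboolP => a;
    rewrite !scalerBr !scale_malgU !malg_liftD !malg_liftN !malg_liftU.
    by rewrite mulr1 bDr [b a m + _]addrC addrK subrr.
  by rewrite mulr1 bZ subrr.
Qed.

Lemma tensor_universal :
  exists2 g : {additive tensor -> A},
    forall a m, g (pure_tensor a m) = b a m &
    forall h : {additive tensor -> A},
      (forall a m, h (pure_tensor a m) = b a m) -> h =1 g.
Proof.
pose g (x : tensor) : A := malg_lift (quot_repr x).
have gE x : g (proj (span tensor_rel) x) = malg_lift x.
  apply/eqP; rewrite -subr_eq0 -malg_liftN -malg_liftD; apply/eqP.
  by apply/malg_lift_span/projP; rewrite quot_reprK.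
have gB : zmod_morphism g.
  move=> x y; case: (proj_surj x) => u <-; case: (proj_surj y) => v <-.
  by rewrite -linearB !gE malg_liftD malg_liftN.
pose G : {additive tensor -> A} :=
  HB.pack g (GRing.isZmodMorphism.Build tensor A g gB).
exists G => [a m|h hE x]; first by rewrite /= gE malg_liftU.
elim/tensor_ind: x => [|x y hx hy|a m]; first by rewrite !raddf0.
  by rewrite !raddfD hx hy.
by rewrite hE /= gE malg_liftU.
Qed.

End Universal.
End Tensor.

Arguments pure_tensor {R D} f {M} a m.
Arguments tor {R D} f M _.

Definition division_ring (D : unitRingType) : Prop :=
  forall x : D, x != 0 -> x \is a GRing.unit.

Definition has_dim (D : nzRingType) (V : lmodType D) (n : nat) : Prop :=
  exists e : 'I_n -> V,
    forall v, exists! c : 'rV[D]_n, v = \sum_i c 0 i *: e i.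

Definition universal_division_ring_of_fractions
    (R : nzRingType) (D : unitRingType) (iota : {rmorphism R -> D}) : Prop :=
  [/\ division_ring D,
      injective iota,
      (forall S : {pred D}, divring_closed S ->
         (forall r, iota r \in S) -> forall x, x \in S) &
      forall (E : unitRingType) (f : {rmorphism R -> E}), division_ring E ->
      forall M : lmodType R, finitely_presented M ->
      forall m n : nat, has_dim (tensor iota M) m -> has_dim (tensor f M) n ->
        (m <= n)%N].

(* [monalg] only provides the multiplication for monoids without nontrivial
   units, hence not for groups. *)
Definition group_algebra (K : nzRingType) (G : groupType) : Type := {malg K[G]}.

Section GroupAlgebra.
Variables (K : nzRingType) (G : groupType).

HB.instance Definition _ := GRing.Zmodule.on (group_algebra K G).

Implicit Types g : group_algebra K G.

Definition gaone : group_algebra K G := << 1 *g 1%g >>.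

Definition gamul g1 g2 : group_algebra K G :=
  \sum_(k1 <- msupp g1) \sum_(k2 <- msupp g2)
    << g1@_k1 * g2@_k2 *g (k1 * k2)%g >>.

Lemma gamulw (d1 d2 : {fset G}) g1 g2 :
  (msupp g1 `<=` d1)%fset -> (msupp g2 `<=` d2)%fset ->
  gamul g1 g2 =
  \sum_(k1 <- d1) \sum_(k2 <- d2) << g1@_k1 * g2@_k2 *g (k1 * k2)%g >>.
Proof.
move=> le1 le2; rewrite /gamul (big_fset_incl _ le1) /=.
  apply: eq_bigr => k1 _; apply: big_fset_incl => // k _ /mcoeff_outdom ->.
  by rewrite mulr0 monalgU0.
move=> k _ /mcoeff_outdom ->.
by rewrite big1 => // k' _; rewrite mul0r monalgU0.
Qed.

Lemma gamulDl : left_distributive gamul +%R.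
Proof.
move=> g1 g2 g; have r := fsubset_refl (msupp g).
rewrite (gamulw (msuppD_le g1 g2) r) (gamulw (fsubsetUl _ (msupp g2)) r).
rewrite (gamulw (fsubsetUr (msupp g1) _) r) -big_split /=.
apply: eq_bigr => k1 _; rewrite -big_split /=; apply: eq_bigr => k2 _.
by rewrite mcoeffD mulrDl monalgUD.
Qed.

Lemma gamulDr : right_distributive gamul +%R.
Proof.
move=> g g1 g2; have r := fsubset_refl (msupp g).
rewrite (gamulw r (msuppD_le g1 g2)) (gamulw r (fsubsetUl _ (msupp g2))).
rewrite (gamulw r (fsubsetUr (msupp g1) _)) -big_split /=.
apply: eq_bigr => k1 _; rewrite -big_split /=; apply: eq_bigr => k2 _.
by rewrite mcoeffD mulrDr monalgUD.
Qed.

Lemma gamul0l : left_zero 0 gamul.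
Proof. by move=> g; rewrite /gamul msupp0 big_seq_fset0. Qed.

Lemma gamul0r : right_zero 0 gamul.
Proof.
by move=> g; rewrite /gamul msupp0 big1 // => k _; rewrite big_seq_fset0.
Qed.

Lemma gamulUU c1 c2 (k1 k2 : G) :
  gamul << c1 *g k1 >> << c2 *g k2 >> = << c1 * c2 *g (k1 * k2)%g >>.
Proof. by rewrite (gamulw msuppU_le msuppU_le) !big_seq_fset1 !mcoeffUU. Qed.

Lemma ga_ind (P : group_algebra K G -> Prop) :
  P 0 -> (forall x y, P x -> P y -> P (x + y)) ->
  (forall c (k : G), P << c *g k >>) -> forall x, P x.
Proof.
move=> P0 PD PU x; rewrite [x]monalgE.
by apply: (big_ind P) => // k _; apply: PU.
Qed.

Lemma gamulA : associative gamul.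
Proof.
move=> x y z; elim/ga_ind: x => [|x x' hx hx'|a k]; first by rewrite !gamul0l.
  by rewrite !gamulDl hx hx'.
elim/ga_ind: y => [|y y' hy hy'|b l]; first by rewrite !(gamul0l, gamul0r).
  by rewrite !(gamulDl, gamulDr) hy hy'.
elim/ga_ind: z => [|z z' hz hz'|c m]; first by rewrite !gamul0r.
  by rewrite !gamulDr hz hz'.
by rewrite !gamulUU mulrA mulgA.
Qed.

Lemma gamul1l : left_id gaone gamul.
Proof.
elim/ga_ind => [|x y hx hy|a k]; first exact: gamul0r.
  by rewrite gamulDr hx hy.
by rewrite gamulUU mul1r mul1g.
Qed.

Lemma gamul1r : right_id gaone gamul.
Proof.
elim/ga_ind => [|x y hx hy|a k]; first exact: gamul0l.
  by rewrite gamulDl hx hy.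
by rewrite gamulUU mulr1 mulg1.
Qed.

Lemma gaone_neq0 : gaone != 0.
Proof. by rewrite monalgU_eq0 oner_eq0. Qed.

HB.instance Definition _ := GRing.Zmodule_isNzRing.Build (group_algebra K G)
  gamulA gamul1l gamul1r gamulDl gamulDr gaone_neq0.

Lemma gamulE g1 g2 : g1 * g2 = gamul g1 g2.
Proof. by []. Qed.

Definition augmentation g : K := \sum_(k <- msupp g) g@_k.

Lemma augmentationw (d : {fset G}) g : (msupp g `<=` d)%fset ->
  augmentation g = \sum_(k <- d) g@_k.
Proof. by move=> le; apply: (big_fset_incl _ le) => k _ /mcoeff_outdom. Qed.

Lemma augmentationD : {morph augmentation : x y / x + y}.
Proof.
move=> x y; rewrite (augmentationw (msuppD_le x y)).
rewrite (augmentationw (fsubsetUl (msupp x) (msupp y))).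
rewrite (augmentationw (fsubsetUr (msupp x) (msupp y))) -big_split /=.
by apply: eq_bigr => k _; rewrite mcoeffD.
Qed.

Lemma augmentationU c (k : G) : augmentation << c *g k >> = c.
Proof. by rewrite (augmentationw msuppU_le) big_seq_fset1 mcoeffUU. Qed.

Lemma augmentation0 : augmentation 0 = 0.
Proof. by rewrite /augmentation msupp0 big_seq_fset0. Qed.

Lemma augmentation_is_zmod_morphism : zmod_morphism augmentation.
Proof.
move=> x y; apply: (addIr (augmentation y)).
by rewrite -augmentationD !subrK.
Qed.

Lemma augmentation_is_monoid_morphism : monoid_morphism augmentation.
Proof.
split=> [|x y]; first exact: augmentationU.
elim/ga_ind: x => [|x x' hx hx'|a k].
- by rewrite mul0r !augmentation0 mul0r.
- by rewrite mulrDl !augmentationD mulrDl hx hx'.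
elim/ga_ind: y => [|y y' hy hy'|b l].
- by rewrite mulr0 !augmentation0 mulr0.
- by rewrite mulrDr !augmentationD mulrDr hy hy'.
by rewrite [_ * _]gamulUU !augmentationU.
Qed.

HB.instance Definition _ := GRing.isZmodMorphism.Build (group_algebra K G) K
  augmentation augmentation_is_zmod_morphism.
HB.instance Definition _ := GRing.isMonoidMorphism.Build (group_algebra K G) K
  augmentation augmentation_is_monoid_morphism.

(* Left ideals of K[G] are submodules of the regular left module. *)
Definition aug_ideal : {pred (group_algebra K G)^o} :=
  fun g => augmentation g == 0.

Lemma aug_ideal_closed : submod_closed aug_ideal.
Proof.
split=> [|a x y /eqP x0 /eqP y0]; apply/eqP; first exact: augmentation0.
transitivity (augmentation a * augmentation x + augmentation y).
  by rewrite -rmorphM -augmentationD.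
by rewrite x0 y0 mulr0 addr0.
Qed.

HB.instance Definition _ := GRing.isSubmodClosed.Build (group_algebra K G)
  (group_algebra K G)^o aug_ideal aug_ideal_closed.

(* K[H] is identified with the elements of K[G] supported in H. *)
Definition subgroup_aug_ideal (H : groupClosed G) (g : (group_algebra K G)^o) :
  Prop := {subset msupp g <= H} /\ g \in aug_ideal.

Definition induced_aug_ideal (H : groupClosed G) :
    submodClosed (group_algebra K G)^o :=
  span (subgroup_aug_ideal H).

Lemma induced_aug_ideal_sub (H : groupClosed G) :
  {subset induced_aug_ideal H <= aug_ideal}.
Proof.
by move=> x /spanP; apply; [exact: aug_ideal_closed|move=> y []].
Qed.

Lemma induced_aug_idealS (H L : groupClosed G) :
  {subset H <= L} -> {subset induced_aug_ideal H <= induced_aug_ideal L}.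
Proof.
move=> HL x /spanP; apply; first exact: span_submod_closed.
by move=> y [yH yI]; apply: mem_span; split=> // k /yH /HL.
Qed.

End GroupAlgebra.

Arguments aug_ideal K G : clear implicits.
Arguments induced_aug_ideal K {G} H.

Section Rigidity.
Variables (K : fieldType) (F : groupType) (D : unitRingType).
Variable iota : {rmorphism group_algebra K F -> D}.

Definition subgroup_rigid : Prop :=
  forall H : groupClosed F, finitely_generated H ->
  exists2 Ht : groupClosed F, {subset H <= Ht} &
    let JH : submodClosed (submod (aug_ideal K F)) :=
      submod_in (aug_ideal K F) (induced_aug_ideal K H) in
    let JHt : submodClosed (submod (aug_ideal K F)) :=
      submod_in (aug_ideal K F) (induced_aug_ideal K Ht) in
    tor iota (quot_module JH) =i sub_quot JH JHt.

End Rigidity.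

(* Main.v *)
Require Import Defs.
From HB Require Import structures.
From mathcomp Require Import all_boot all_algebra.
From mathcomp Require Import finmap boolp.
From mathcomp Require Import monalg.

(* Let D be the universal division ring, B a basis of F and I the augmentation
   ideal. For a finite set S of elements of F closed under suffixes of words over B,
   the cocycles d : F -> D, d(gh) = d g + g d h, vanishing on H correspond to the
   solutions in D^S of a linear pencil with coefficients in F_2, evaluated at the
   basis elements. By universality this point is maximal: a pencil which is singular
   there is singular at every point over every division ring containing D. An element x of I
   is torsion modulo H exactly when \sum_g x_g d(g) = 0 for all these cocycles.

   Deform the embedding b |-> b of B to b |-> 1 + (b - 1) z over D[[z]], and let Ht be
   the set of g killed by every cocycle of the deformation which vanishes on H.
   - If g is in Ht, then every solution of the pencil at the deformed point vanishes
     at g; by maximality this is also true over D, so that g - 1 is a combination of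
     the equations of the pencil, i.e. 1 (x) (g - 1) = 0.
   - Conversely, maximality with respect to a twisted Laurent series ring shows that
     a relation over F_2 satisfied by all solutions over D is satisfied on a
     D-bimodule U of vectors which is stable under the coefficients of the pencil.
     Polynomials in the coefficients of the deformed cocycles belong to U up to
     constants, hence a torsion element x kills all of them. Such polynomials
     separate the left cosets of Ht, so the coefficients of x add up to 0 on each
     coset, and x belongs to the left ideal generated by the augmentation ideal of
     Ht. *)

Set Implicit Arguments.
Unset Strict Implicit.
Unset Printing Implicit Defensive.

Import GRing.Theory.
Local Open Scope ring_scope.

(** The relation \sum_g x_g d(g) = 0 is linear in d, whereas separating the cosets of Ht takes
    products of values of cocycles, and these are in general no cocycles. The point 1 + (b - 1) z
    gets around this: it is trivial at z = 0 and gives back b at z = 1. Because of z = 0,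
    translation by b changes a coefficient d_j only by a constant and a multiple of d_(j-1), so
    products of coefficients are controlled by finite differences. Because of z = 1, their recursion
    is a pencil J0 + z B whose value J0 + B is the original one, and injectivity at z = 1 implies
    injectivity on power series. The differences create inhomogeneous terms, which are absorbed by
    working modulo U; hence the stability of U under left multiplication by D and, up to the pencil,
    under each of its coefficients. This amounts to choosing the direction u of the perturbation
    beta + u z anew at each order in z, which the twist z a = a^M z over D((a)) makes possible. F_2
    enters because its image is central in every ring, while maximality ranges over all division
    rings containing D. *)

Definition trivial_kernel (R : nzRingType) m n (A : 'M[R]_(m, n)) :=
  forall v : 'cV[R]_n, A *m v = 0 -> v = 0.

(** * Linear algebra over a division ring *)

Section DivisionLinearAlgebra.
Variables (D : unitRingType) (hD : division_ring D).

(** If [G] is inverse to this matrix and [A *m G] vanishes in the columns [k] with [sel k = None],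
    these columns of [G] form a basis of the right kernel of [A]. The pivot rows are rows of [A]
    itself, so they keep a meaning when [A] is the value of a pencil. *)
Definition pivot_mx m n (A : 'M[D]_(m, n)) (sel : 'I_n -> option 'I_m) : 'M[D]_n :=
  \matrix_(k < n) (if sel k is Some i then row i A else delta_mx 0 k).

Lemma scalar_entry (a : 'M[D]_1) : a = (a 0 0)%:M.
Proof. by apply/matrixP => i j; rewrite !ord1 !mxE eqxx. Qed.

(* The pivot matrix is changed one row at a time, starting from the identity. *)
Lemma gauss m n (A : 'M[D]_(m, n)) :
  exists sel (G : 'M[D]_n),
    [/\ pivot_mx A sel *m G = 1%:M, G *m pivot_mx A sel = 1%:M &
        forall i k, sel k = None -> (A *m G) i k = 0].
Proof.
suff /(_ m) [sel [G [h1 h2 h3]]] : forall q : nat,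
    exists sel (G : 'M[D]_n),
    [/\ pivot_mx A sel *m G = 1%:M, G *m pivot_mx A sel = 1%:M &
        forall (i : 'I_m) k, (i < q)%N -> sel k = None -> (A *m G) i k = 0].
  by exists sel, G; split=> // i k; apply: h3.
elim=> [|q [sel [G [h1 h2 h3]]]].
  exists (fun=> None), 1%:M; split=> //; rewrite ?mulmx1 ?mul1mx;
    by apply/row_matrixP=> k; rewrite rowK row1.
have [mq|qm] := leqP m q.
  exists sel, G; split=> // i k _; apply: h3.
  exact: leq_trans (ltn_ord i) mq.
(* [w] holds the coordinates of row [i0] in the basis of pivot rows. If they vanish at every
   unselected [k], nothing changes; otherwise the row becomes a pivot at some [k0]. *)
pose i0 := Ordinal qm; pose w := row i0 A *m G.
have [hw|] := pselect (forall k, sel k = None -> w 0 k = 0).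
  exists sel, G; split=> // i k; rewrite ltnS leq_eqVlt => /predU1P[iq|]; last exact: h3.
  have -> : i = i0 by apply: val_inj.
  by move=> /hw; rewrite /w -row_mul mxE.
move=> /existsNP[k0 /not_implyP[sk0 /eqP wk0]].
have uc : w 0 k0 \is a GRing.unit by exact: hD.
pose e : 'rV[D]_n := delta_mx 0 k0; pose d : 'cV[D]_n := delta_mx k0 0.
pose w' := (w 0 k0)^-1 *: (e - w) + e.
have ed : e *m d = 1%:M.
  by rewrite mul_delta_mx; apply/matrixP => i j; rewrite !mxE !ord1.
have wd : w *m d = (w 0 k0)%:M.
  by rewrite [LHS]scalar_entry -colE mxE.
have w'd : w' *m d = ((w 0 k0)^-1)%:M.
  rewrite mulmxDl -scalemxAl mulmxBl ed wd scalerBr !scale_scalar_mx mulr1 mulVr //.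
  by rewrite subrK.
have mulE (u v : 'rV[D]_n) a : u *m d = a%:M ->
    (1%:M + d *m (u - e)) *m (1%:M + d *m (v - e)) = 1%:M + d *m (u - e + a *: (v - e)).
  move=> ud; rewrite mulmxDl mul1mx mulmxDr mulmx1 -(mulmxA d) (mulmxA (u - e)).
  rewrite mulmxBl ud ed mulmxBl mul1mx mul_scalar_mx -addrA; congr (_ + _).
  by rewrite -!mulmxDr addrCA [v - e + _]addrC subrK.
(* Left multiplication by [E] replaces row [k0] of the pivot matrix by row [i0] of [A]; [w'] is
   chosen so that [E'] is the inverse of [E]. *)
pose E := 1%:M + d *m (w - e); pose E' := 1%:M + d *m (w' - e).
have EE' : E *m E' = 1%:M.
  rewrite (mulE _ _ _ wd) /w' addrK scalerA mulrV // scale1r.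
  by rewrite -[e - w]opprB subrr mulmx0 addr0.
have E'E : E' *m E = 1%:M.
  rewrite (mulE _ _ _ w'd) /w' addrK -scalerDr.
  by rewrite -[e - w]opprB addNr scaler0 mulmx0 addr0.
pose sel' k := if k == k0 then Some i0 else sel k.
have rowd k : row k d = (k == k0)%:R%:M.
  by apply/matrixP => i j; rewrite !mxE !ord1 /= andbT mulr1n.
have piv' : pivot_mx A sel' = E *m pivot_mx A sel.
  apply/row_matrixP => k; rewrite row_mul rowK /sel' /E linearD /= row1 row_mul rowd.
  rewrite mul_scalar_mx mulmxDl -rowE rowK; case: eqP => [->|/eqP kk0].
    rewrite sk0 scale1r mulmxBl -rowE rowK sk0 /w -mulmxA h2 mulmx1.
    by rewrite addrC subrK.
  by rewrite scale0r mul0mx addr0.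
exists sel', (G *m E'); split.
- by rewrite piv' mulmxA -(mulmxA E) h1 mulmx1.
- by rewrite piv' mulmxA -(mulmxA G) E'E mulmx1.
move=> i k; rewrite ltnS leq_eqVlt => iq; rewrite /sel'.
case: (eqVneq k k0) => // kk0 sk.
have -> : (A *m (G *m E')) i k = (row i A *m G) 0 k + (row i A *m G) 0 k0 * (w' - e) 0 k.
  rewrite -row_mul mulmxA mulmxDr mulmx1 mulmxA -colE !mxE big_ord1 !mxE.
  by [].
case/predU1P: iq => [iq|iq].
  have -> : i = i0 by apply: val_inj.
  have -> : (w' - e) 0 k = (w 0 k0)^-1 * (- w 0 k).
    by rewrite /w' addrK; move: (w 0 k0) (w) => c u; rewrite !mxE (negbTE kk0) andbF sub0r.
  by rewrite -/w mulrA mulrV // mul1r subrr.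
have r0 j : sel j = None -> (row i A *m G) 0 j = 0.
  by move=> sj; rewrite -row_mul [LHS]mxE h3.
by rewrite !r0 // mul0r addr0.
Qed.

(** Either some [k] is unselected, and column [k] of [G] is in the kernel, or [sel] repeats a value
    because [m < n], and an invertible matrix would have two equal rows. *)
Lemma kernel_nontrivial m n (A : 'M[D]_(m, n)) : (m < n)%N ->
  exists2 v : 'cV[D]_n, v != 0 & A *m v = 0.
Proof.
move=> mn; have [sel [G [h1 h2 h3]]] := gauss A.
have [[k sk]|alls] := pselect (exists k, sel k = None).
  exists (G *m delta_mx k 0).
    apply/eqP=> /(congr1 (mulmx (pivot_mx A sel))).
    rewrite mulmxA h1 mul1mx mulmx0 => /colP/(_ k); rewrite !mxE eqxx => /eqP.
    by rewrite oner_eq0.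
  by apply/colP=> i; rewrite mulmxA -colE mxE h3 // mxE.
have /injectivePn[k [k' kk' fk]] : ~~ injectiveb sel.
  apply/negP=> /injectiveP inj; suff: (n <= m)%N by rewrite leqNgt mn.
  rewrite -[leqLHS]card_ord -[leqRHS]card_ord.
  have selE k : {i | sel k = Some i}.
    by case E : (sel k) => [i|]; [exists i|case: alls; exists k].
  apply: (@leq_card _ _ (fun k => sval (selE k))) => k k'.
  by case: (selE k) (selE k') => i ki [j kj] /= ij; apply: inj; rewrite ki kj ij.
have : row k (1%:M : 'M[D]_n) = row k' 1%:M.
  rewrite -h1 !row_mul !rowK fk; case E : (sel k') => [//|].
  by case: alls; exists k'.
move/rowP/(_ k)/eqP; rewrite !mxE eqxx [k' == k]eq_sym (negbTE kk').
by rewrite oner_eq0.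
Qed.

Lemma kernel_left_inverse m n (A : 'M[D]_(m, n)) : trivial_kernel A ->
  exists G : 'M[D]_(n, m), G *m A = 1%:M.
Proof.
move=> tA; have [sel [G [h1 h2 h3]]] := gauss A.
have selP k : {i | sel k = Some i}.
  case E : (sel k) => [i|]; first by exists i.
  have : G *m delta_mx k 0 = (0 : 'cV[D]_n).
    by apply: tA; apply/colP=> i; rewrite mulmxA -colE mxE h3 // mxE.
  move/(congr1 (mulmx (pivot_mx A sel))).
  rewrite mulmxA h1 mul1mx mulmx0 => /colP/(_ k); rewrite !mxE eqxx => /eqP.
  by rewrite oner_eq0.
exists (G *m \matrix_k delta_mx 0 (sval (selP k))).
rewrite -mulmxA -[RHS]h2; congr (_ *m _); apply/row_matrixP=> k.
rewrite row_mul !rowK -rowE; case: (selP k) => i /= ->.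
by [].
Qed.

(** The coordinates of [y] in the pivot rows are the entries of [y *m G]; at an unselected [k] they
    vanish, since column [k] of [G] is in the kernel of [A]. *)
Lemma row_of_kernel m n (A : 'M[D]_(m, n)) (y : 'rV[D]_n) :
  (forall v : 'cV[D]_n, A *m v = 0 -> y *m v = 0) -> exists w : 'rV[D]_m, y = w *m A.
Proof.
move=> hy; have [sel [G [h1 h2 h3]]] := gauss A.
exists (y *m G *m \matrix_k (if sel k is Some i then delta_mx 0 i else 0)).
rewrite -[y in LHS]mulmx1 -h2 !mulmxA -!(mulmxA (y *m G)).
rewrite !(mulmx_sum_row (y *m G)); apply: eq_bigr => k _.
rewrite row_mul !rowK; case E : (sel k) => [i|]; first by rewrite -rowE.
suff -> : (y *m G) 0 k = 0 by rewrite !scale0r.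
have /hy/colP/(_ 0) : A *m (G *m delta_mx k 0) = (0 : 'cV[D]_m).
  by apply/colP=> i; rewrite mulmxA -colE mxE h3 // mxE.
by rewrite mulmxA -colE mxE => ->; rewrite mxE.
Qed.

(** * Power series solutions of a pencil that is injective at z = 1 *)

Section Shift.
Variables (m n : nat) (J0 B : 'M[D]_(m, n)) (U : 'cV[D]_n -> Prop).
Local Notation J := (J0 + B).
Hypothesis UD : forall u v, U u -> U v -> U (u + v).
Hypothesis UM : forall u (c : 'M[D]_1), U u -> U (u *m c).
Hypothesis Uker : forall v, J *m v = 0 -> U v.
Hypothesis UB : forall u, U u -> exists2 u', U u' & B *m u = J *m u'.

Let U0 : U 0. Proof. by apply: Uker; rewrite mulmx0. Qed.

Let W (x : 'cV[D]_m) := exists2 u, U u & x = J *m u.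
Let WD x y : W x -> W y -> W (x + y).
Proof. by move=> [u Uu ->] [v Uv ->]; exists (u + v); [exact: UD|rewrite mulmxDr]. Qed.
Let WM x (c : 'M[D]_1) : W x -> W (x *m c).
Proof. by move=> [u Uu ->]; exists (u *m c); [exact: UM|rewrite mulmxA]. Qed.
Let WN x : W x -> W (- x).
Proof. by move=> /(@WM _ (- 1)); rewrite mulmxN mulmx1. Qed.
Let WB u : U u -> W (B *m u). Proof. exact: UB. Qed.
Let WJ u : W (J *m u) -> U u.
Proof.
move=> [v Uv e]; rewrite -(subrK v u); apply: UD => //; apply: Uker.
by rewrite mulmxBr e subrr.
Qed.

(** Coefficient by coefficient, this says that J0 + B z kills the series \sum_k (q k) z^k modulo
    [W], with z central. At z = 1 the pencil is [J], which is injective modulo [U] by [WJ]. *)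
Definition shift_seq (q : nat -> 'cV[D]_n) :=
  W (J0 *m q 0%N) /\ forall k, W (J0 *m q k.+1 + B *m q k).

Let sp (q : nat -> 'cV[D]_n) K (x : 'cV[D]_n) :=
  exists c : nat -> 'M[D]_1, x = \sum_(i < K) q i *m c i.

(* If q K is, modulo U, the first term which is a combination of the previous
   ones, then applying B to such a relation and using that B q_i and J (q_0 + ... + q_i)
   agree modulo W yields a shorter relation, unless K = 0. *)
Lemma shift_seq0 q : shift_seq q -> U (q 0%N).
Proof.
move=> [q0 qS]; pose P K := `[< exists2 x, sp q K x & U (q K - x) >].
have exP : exists K, P K.
  have [v /eqP v0 vQ] := @kernel_nontrivial n n.+1 (\matrix_(i, j) q j i 0) (ltnSn n).
  have vq : \sum_(i < n.+1) q i *m (v i 0)%:M = 0.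
    rewrite -[RHS]vQ; apply/colP=> i; rewrite summxE !mxE; apply: eq_bigr => j _.
    by rewrite !mxE big_ord1 !mxE eqxx mulr1n.
  have [k vk kmax] : exists2 k : 'I_n.+1, v k 0 != 0 & forall i : 'I_n.+1, (k < i)%N -> v i 0 = 0.
    have [k vk] : exists k, v k 0 != 0.
      apply: contra_notP v0 => /forallNP h; apply/colP=> i; rewrite mxE.
      by apply/eqP; apply: contraT => /h.
    case: (@arg_maxnP _ k (fun i => v i 0 != 0) val vk) => i vi imax.
    exists i => // j ij; apply/eqP; apply: contraTT ij => /imax.
    by rewrite -leqNgt.
  pose e i : 'M[D]_1 := (v (inord i) 0)%:M.
  exists k; apply/asboolP; exists (\sum_(i < k) q i *m - (e i *m ((v k 0)^-1)%:M)).
    by exists (fun i => - (e i *m ((v k 0)^-1)%:M)).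
  suff -> : q k - \sum_(i < k) q i *m - (e i *m ((v k 0)^-1)%:M) =
      (\sum_(i < n.+1) q i *m (v i 0)%:M) *m ((v k 0)^-1)%:M by rewrite vq mul0mx.
  transitivity ((\sum_(i < k.+1) q i *m e i) *m ((v k 0)^-1)%:M).
    rewrite big_ord_recr /= mulmxDl addrC -mulmxA /e inord_val -scalar_mxM mulrV ?mulmx1; last exact: hD.
    congr (_ + _); rewrite mulmx_suml -sumrN; apply: eq_bigr => i _.
    by rewrite mulmxN opprK mulmxA.
  congr (_ *m _); rewrite (big_ord_widen_cond n.+1 xpredT (fun i => q i *m e i)) ?ltn_ord //.
  rewrite big_mkcond; apply: eq_bigr => i _ /=; rewrite ltnS /e inord_val.
  by case: leqP => // /kmax ->; rewrite -scalemx1 scale0r mulmx0.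
pose s i := \sum_(l < i.+1) q l.
have sJ i : W (J *m s i - B *m q i).
  elim: i => [|i IH]; first by rewrite /s big_ord1 mulmxDl addrK.
  rewrite /s big_ord_recr /= -/(s i) mulmxDr (mulmxDl _ _ (q i.+1)) addrA addrK.
  by rewrite -[J *m s i](subrK (B *m q i)) -addrA; apply: WD => //; rewrite addrC.
case: (ex_minnP exP) => [[|K] /asboolP[x [c ->] Ux] Kmin].
  by move: Ux; rewrite big_ord0 subr0.
suff /Kmin : P K by rewrite ltnn.
have spD k x1 x2 : sp q k x1 -> sp q k x2 -> sp q k (x1 + x2).
  move=> [c1 ->] [c2 ->]; exists (fun i => c1 i + c2 i).
  by rewrite -big_split /=; apply: eq_bigr => i _; rewrite mulmxDr.
have spM k x1 e : sp q k x1 -> sp q k (x1 *m e).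
  move=> [c1 ->]; exists (fun i => c1 i *m e).
  by rewrite mulmx_suml; apply: eq_bigr => i _; rewrite mulmxA.
have sps k i : (i < k)%N -> sp q k (s i).
  move=> ik; exists (fun l => (l < i.+1)%N%:R%:M).
  rewrite /s (big_ord_widen k q ik) big_mkcond; apply: eq_bigr => l _ /=.
  by case: ifP => _; rewrite ?mulmx1 // -scalemx1 scale0r mulmx0.
have Wsum (k : nat) (f : nat -> 'cV[D]_m) (e : nat -> 'M[D]_1) : (forall i, W (f i)) ->
    W (\sum_(i < k) f i *m e i).
  move=> Wf; apply: (big_ind W) => [|x1 x2|i _]; [|exact: WD|exact/WM/Wf].
  by exists 0 => //; rewrite mulmx0.
(* [w] is the relation for [q K.+1] with its indices lowered by one: applying [J0] to that relation
   and replacing each [J0 *m q j.+1] by [- (B *m q j)] modulo [W] puts [B *m w] in [W]. *)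
pose w := q K - \sum_(j < K) q j *m c j.+1.
have Bw : W (B *m w).
  have -> : B *m w = (J0 *m q K.+1 + B *m q K)
      - \sum_(j < K) (J0 *m q j.+1 + B *m q j) *m c j.+1
      - (J0 *m (q K.+1 - \sum_(i < K.+1) q i *m c i) + J0 *m q 0%N *m c 0%N).
    have -> : \sum_(i < K.+1) q i *m c i = q 0%N *m c 0%N + \sum_(j < K) q j.+1 *m c j.+1.
      by rewrite big_ord_recl.
    under eq_bigr do rewrite mulmxDl -!mulmxA.
    rewrite big_split /= -!mulmx_sumr /w !mulmxBr mulmxDr -mulmxA.
    move: (J0 *m q K.+1) (B *m q K) (J0 *m \sum_(j < K) _) (B *m \sum_(j < K) _) (J0 *m (q 0%N *m _)).
    move=> a b z t r; rewrite [r + z]addrC [- (z + r)]opprD addrA subrK [a + b]addrC.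
    by rewrite [z + t]addrC opprD addrACA addrK.
  apply: WD; first by apply: WD; [exact: qS|apply/WN; exact:
      (Wsum K (fun j => J0 *m q j.+1 + B *m q j) (fun j => c j.+1))].
  apply/WN/WD; last exact/WM.
  set u := (X in J0 *m X); have -> : J0 *m u = J *m u - B *m u by rewrite mulmxDl addrK.
  by apply: WD; [exists u|apply/WN/WB].
apply/asboolP; exists (q K - s K + \sum_(j < K) s j *m c j.+1).
  apply: (spD _ _ _).
    exists (fun=> - 1); rewrite /s big_ord_recr /= opprD addrCA subrr addr0 -sumrN.
    by apply: eq_bigr => i _; rewrite mulmxN mulmx1.
  apply: (big_ind (sp q K)) => [|x1 x2|i _]; [|exact: spD|exact/spM/sps].
  by exists (fun=> 0); rewrite big1 // => i _; rewrite mulmx0.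
have -> : q K - (q K - s K + \sum_(j < K) s j *m c j.+1) = s K - \sum_(j < K) s j *m c j.+1.
  by rewrite opprD addrA opprB addrCA subrr addr0.
apply: WJ; suff -> : J *m (s K - \sum_(j < K) s j *m c j.+1) =
    (J *m s K - B *m q K) - \sum_(j < K) (J *m s j - B *m q j) *m c j.+1 + B *m w.
  by apply: WD => //; apply: WD => //; exact/WN/(Wsum K (fun j => J *m s j - B *m q j) (fun j => c j.+1)).
under [X in _ = _ - X + _]eq_bigr do rewrite mulmxBl -!mulmxA.
rewrite sumrB -!mulmx_sumr.
by rewrite !mulmxBr opprB addrAC !subrKA.
Qed.

(** Once the first term is in [U], its image under [B] is in [W], so the sequence without its first
    term satisfies the same conditions. *)
Lemma shift_seqP q k : shift_seq q -> U (q k).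
Proof.
elim: k q => [|k IH] q hq; first exact: shift_seq0.
apply: (IH (fun i => q i.+1)); case: (hq) => q0 qS; split=> [|i]; last exact: qS.
rewrite -[J0 *m _](addrK (B *m q 0%N)); apply: WD; first exact: qS.
by apply/WN/WB/shift_seq0.
Qed.
End Shift.

End DivisionLinearAlgebra.

(** * Skew power series and Laurent series over a division ring *)

Lemma big_triangle (V : nmodType) n (F : nat -> nat -> V) :
  \sum_(i < n.+1) \sum_(j < i.+1) F j (i - j)%N =
  \sum_(j < n.+1) \sum_(k < (n - j).+1) F j k.
Proof.
elim: n => [|n IH]; first by rewrite !big_ord1.
rewrite big_ord_recr IH [RHS]big_ord_recr /= subnn big_ord1.
rewrite [X in _ + X]big_ord_recr /= subnn addrA.
congr (_ + _); rewrite -big_split; apply: eq_bigr => j _ /=.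
by rewrite subSn ?leq_ord // [RHS]big_ord_recr.
Qed.

Section Iterates.
Variables (C : nzRingType) (sg : {rmorphism C -> C}).

Definition siter i : C -> C := iter i sg.

Fact siter_zmod i : zmod_morphism (siter i).
Proof. by elim: i => [|i IH] x y //=; rewrite -/(siter i) IH rmorphB. Qed.
Fact siter_monoid i : monoid_morphism (siter i).
Proof.
split; first by elim: i => //= i ->; rewrite rmorph1.
by elim: i => [|i IH] x y //=; rewrite -/(siter i) IH rmorphM.
Qed.
HB.instance Definition _ i := GRing.isZmodMorphism.Build C C (siter i) (siter_zmod i).
HB.instance Definition _ i := GRing.isMonoidMorphism.Build C C (siter i) (siter_monoid i).

Lemma siterD i j x : siter (i + j) x = siter i (siter j x).
Proof. exact: iterD. Qed.
Lemma siterS i x : siter i.+1 x = sg (siter i x). Proof. by []. Qed.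
Lemma siterSr i x : siter i.+1 x = siter i (sg x). Proof. exact: iterSr. Qed.
Lemma siter_inj i : injective sg -> injective (siter i).
Proof. by move=> sI; elim: i => //= i IH; apply: inj_comp. Qed.

End Iterates.

(* Formal series \sum_n f_n z^n over C, with z c = sg(c) z. *)
Definition spow (C : nzRingType) (sg : {rmorphism C -> C}) : Type := nat -> C.

Section SkewPowerSeries.
Variables (C : nzRingType) (sg : {rmorphism C -> C}).
Local Notation P := (spow sg).
Implicit Types f g h : P.

HB.instance Definition _ := Choice.copy P (nat -> C).

Definition spadd f g : P := fun n => f n + g n.
Definition spopp f : P := fun n => - f n.
Definition spone : P := fun n => (n == 0%N)%:R.
Definition spmul f g : P := fun n => \sum_(i < n.+1) f i * siter sg i (g (n - i)%N).

Fact spaddA : associative spadd. Proof. by move=> f g h; apply/funext=> n; apply: addrA. Qed.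
Fact spaddC : commutative spadd. Proof. by move=> f g; apply/funext=> n; apply: addrC. Qed.
Fact spadd0 : left_id (fun=> 0 : C) spadd.
Proof. by move=> f; apply/funext=> n; apply: add0r. Qed.
Fact spaddN : left_inverse (fun=> 0 : C) spopp spadd.
Proof. by move=> f; apply/funext=> n; apply: addNr. Qed.
HB.instance Definition _ := GRing.isZmodule.Build P spaddA spaddC spadd0 spaddN.

Fact spmulA : associative spmul.
Proof.
move=> f g h; apply/funext=> n; rewrite /spmul.
transitivity (\sum_(j < n.+1) \sum_(k < (n - j).+1)
    f j * (siter sg j (g k) * siter sg (j + k) (h (n - (j + k))%N))).
  apply: eq_bigr => j _; rewrite rmorph_sum mulr_sumr; apply: eq_bigr => k _.
  by rewrite rmorphM /= -siterD subnDA.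
rewrite -(big_triangle n (fun j k =>
    f j * (siter sg j (g k) * siter sg (j + k) (h (n - (j + k))%N)))).
apply: eq_bigr => i _; rewrite mulr_suml; apply: eq_bigr => j _.
by rewrite subnKC ?mulrA // -ltnS.
Qed.
Fact spmul1l : left_id spone spmul.
Proof.
move=> f; apply/funext=> n; rewrite /spmul big_ord_recl /= mul1r subn0 big1 ?addr0 //.
by move=> i _; rewrite [spone _](_ : _ = 0) ?mul0r.
Qed.
Fact spmul1r : right_id spone spmul.
Proof.
move=> f; apply/funext=> n; rewrite /spmul big_ord_recr /= subnn rmorph1 mulr1 big1 ?add0r //.
move=> i _; rewrite /spone -(subnSK (ltn_ord i)) /=.
by rewrite rmorph0 mulr0.
Qed.
Fact spmulDl : left_distributive spmul +%R.
Proof.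
move=> f g h; apply/funext=> n; rewrite -[RHS]/(_ + _) /spmul -big_split; apply: eq_bigr => i _ /=.
by rewrite -mulrDl.
Qed.
Fact spmulDr : right_distributive spmul +%R.
Proof.
move=> f g h; apply/funext=> n; rewrite -[RHS]/(_ + _) /spmul -big_split; apply: eq_bigr => i _ /=.
by rewrite -mulrDr -rmorphD.
Qed.
Fact spone_neq0 : spone != 0.
Proof. by apply/eqP=> /(congr1 (@^~ 0%N)) /eqP; rewrite /spone /= oner_eq0. Qed.

HB.instance Definition _ := GRing.Zmodule_isNzRing.Build P
  spmulA spmul1l spmul1r spmulDl spmulDr spone_neq0.

Lemma spE f g : (forall n, f n = g n) -> f = g. Proof. exact: funext. Qed.
Lemma spD f g n : (f + g) n = f n + g n. Proof. by []. Qed.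
Lemma spN f n : (- f) n = - f n. Proof. by []. Qed.
Lemma sp0 n : (0 : P) n = 0. Proof. by []. Qed.
Lemma sp1 n : (1 : P) n = (n == 0%N)%:R. Proof. by []. Qed.
Lemma spM f g n : (f * g) n = \sum_(i < n.+1) f i * siter sg i (g (n - i)%N).
Proof. by []. Qed.
Lemma spM0 f g : (f * g) 0%N = f 0%N * g 0%N.
Proof. by rewrite spM big_ord1. Qed.
Lemma sp_sum I r (Q : pred I) (F : I -> P) n :
  (\sum_(i <- r | Q i) F i) n = \sum_(i <- r | Q i) F i n.
Proof. by elim/big_rec2: _ => // i y x _ <-. Qed.

Definition spC (c : C) : P := fun n => if n is 0 then c else 0.
Fact spC_zmod : zmod_morphism spC.
Proof. by move=> x y; apply/spE => -[|n] //; rewrite spD spN /= subr0. Qed.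
Fact spC_monoid : monoid_morphism spC.
Proof.
split; first by apply/spE => -[].
move=> x y; apply/spE => -[|n]; first by rewrite spM0.
by rewrite spM big1 // => -[[|i] hi] _ /=; rewrite ?mul0r ?rmorph0 ?mulr0.
Qed.
HB.instance Definition _ := GRing.isZmodMorphism.Build C P spC spC_zmod.
HB.instance Definition _ := GRing.isMonoidMorphism.Build C P spC spC_monoid.

Lemma spCM c f n : (spC c * f) n = c * f n.
Proof.
rewrite spM big_ord_recl /= subn0 big1 ?addr0 // => i _.
by rewrite mul0r.
Qed.

Definition spX : P := fun n => (n == 1%N)%:R.
Lemma spXM f n : (spX * f) n = if n is m.+1 then sg (f m) else 0.
Proof.
case: n => [|n]; first by rewrite spM0 mul0r.
rewrite spM 2!big_ord_recl /= mul0r add0r mul1r big1 ?addr0 ?subn1 // => i _.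
by rewrite [X in X * _](_ : _ = 0) ?mul0r.
Qed.
Lemma spMX f n : (f * spX) n = if n is m.+1 then f m else 0.
Proof.
case: n => [|n]; first by rewrite spM0; apply: mulr0.
rewrite spM 2!big_ord_recr /= subnn subSnn [spX 0%N]/(0 : C) [spX 1%N]/(1 : C).
rewrite !rmorph0 mulr0 addr0 rmorph1 mulr1.
rewrite big1 ?add0r // => i _; rewrite /spX.
rewrite subSn 1?ltnW //= eqSS subn_eq0 leqNgt ltn_ord.
by rewrite rmorph0 mulr0.
Qed.

Definition sps f : P := fun n => sg (f n).
Fact sps_zmod : zmod_morphism sps.
Proof. by move=> f g; apply/spE => n; apply: rmorphB. Qed.
Fact sps_monoid : monoid_morphism sps.
Proof.
split; first by apply/spE => n; apply: rmorph_nat.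
move=> f g; apply/spE => n; rewrite /sps !spM rmorph_sum; apply: eq_bigr => i _ /=.
by rewrite rmorphM -siterS siterSr.
Qed.
HB.instance Definition _ := GRing.isZmodMorphism.Build P P sps sps_zmod.
HB.instance Definition _ := GRing.isMonoidMorphism.Build P P sps sps_monoid.

Lemma spX_sps f : spX * f = sps f * spX.
Proof. by apply/spE => n; rewrite spXM spMX. Qed.
Lemma sps_X : sps spX = spX.
Proof. by apply/spE => n; apply: rmorph_nat. Qed.
Lemma sps_iter k f n : siter sps k f n = siter sg k (f n).
Proof. by elim: k n => //= k IH n; rewrite -IH. Qed.

Lemma siter_spC k c : siter sps k (spC c) = spC (siter sg k c).
Proof. by apply/spE=> -[|n]; rewrite sps_iter //= rmorph0. Qed.

Lemma spXnM k f n : (spX ^+ k * f) n = if (n < k)%N then 0 else siter sg k (f (n - k)%N).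
Proof.
elim: k n => [|k IH] n; first by rewrite mul1r subn0.
rewrite exprS -mulrA spXM; case: n => // n; rewrite ltnS IH subSS.
by case: ifP; rewrite ?rmorph0.
Qed.
Lemma spMXn k f n : (f * spX ^+ k) n = if (n < k)%N then 0 else f (n - k)%N.
Proof.
elim: k n => [|k IH] n; first by rewrite mulr1 subn0.
by rewrite exprSr mulrA spMX; case: n => // n; rewrite IH ltnS subSS.
Qed.
Lemma spXn_comm k f : spX ^+ k * f = siter sps k f * spX ^+ k.
Proof.
elim: k f => [|k IH] f; first by rewrite mul1r mulr1.
by rewrite exprS -mulrA IH mulrA spX_sps -mulrA -exprS siterS.
Qed.
Lemma siter_spX k j : siter sps k (spX ^+ j) = spX ^+ j.
Proof.
rewrite rmorphXn /=; congr (_ ^+ _); elim: k => //= k ->.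
exact: sps_X.
Qed.

Lemma spX_reg k f : injective sg -> spX ^+ k * f = 0 -> f = 0.
Proof.
move=> sI h; apply/spE=> n; apply: (@siter_inj _ _ k sI).
move/(congr1 (fun g : P => g (n + k)%N)): h; rewrite spXnM ltnNge leq_addl addnK /= => ->.
by rewrite rmorph0.
Qed.

Lemma sp_right_inverse f : (exists c, f 0%N * c = 1) ->
  exists g, f * g = 1.
Proof.
move=> [c fc].
(* Course-of-values recursion: [u n] lists the first [n] coefficients of the inverse. *)
pose step (s : seq C) := rcons s (if size s is 0 then c else
  - c * \sum_(i < size s) f i.+1 * siter sg i.+1 (nth 0 s (size s - i.+1)%N)).
pose u n := iter n step [::].
have su n : size (u n) = n by elim: n => //= n IH; rewrite size_rcons -/(u n) IH.
pose g n := nth 0 (u n.+1) n.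
have uE n m : (m < n)%N -> nth 0 (u n) m = g m.
  elim: n => // n IH; rewrite ltnS leq_eqVlt => /predU1P[->//|mn].
  by rewrite /= /step nth_rcons su mn IH.
exists g; apply/spE=> n; rewrite spM big_ord_recl /= subn0.
have gE : g n = if n is 0 then c else
   - c * \sum_(i < n) f i.+1 * siter sg i.+1 (g (n - i.+1)%N).
  rewrite {1}/g /= /step nth_rcons su ltnn eqxx; case: n => // n.
  congr (_ * _); apply: eq_bigr => i _; rewrite uE // ltnS.
  by rewrite subSS leq_subr.
rewrite gE; case: n {gE} => [|n]; first by rewrite big_ord0 addr0.
by rewrite mulrA mulrN fc mulN1r /bump /= addNr.
Qed.

End SkewPowerSeries.

Lemma division_rmorph_inj (C : unitRingType) (B : nzRingType) (f : {rmorphism C -> B}) :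
  division_ring C -> injective f.
Proof.
move=> hC; apply: raddf_inj => x fx; apply/eqP; apply: contraT => /hC ux.
by have /eqP := rmorph1 f; rewrite -(mulrV ux) rmorphM fx mul0r eq_sym oner_eq0.
Qed.

Section LaurentDef.
Local Open Scope quotient_scope.
Variables (C : unitRingType) (hC : division_ring C) (sg : {rmorphism C -> C}).
Local Notation P := (spow sg).
Local Notation z := (spX sg).
Local Notation s := (siter (@sps C sg)).
Implicit Types x y : P.

Let zreg k x y : z ^+ k * x = z ^+ k * y -> x = y.
Proof.
move=> /eqP; rewrite -subr_eq0 -mulrBr => /eqP/spX_reg/subr0_eq; apply.
exact: division_rmorph_inj.
Qed.

Let zC k l x : z ^+ k * (z ^+ l * x) = z ^+ l * (z ^+ k * x).
Proof. by rewrite !mulrA -!exprD addnC. Qed.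

(* A pair (k, x) stands for the fraction z^-k x. *)
Definition laurent_eq (a b : nat * P) := z ^+ b.1 * a.2 == z ^+ a.1 * b.2.

Fact laurent_refl : reflexive laurent_eq. Proof. by move=> a; apply: eqxx. Qed.
Fact laurent_sym : symmetric laurent_eq. Proof. by move=> a b; apply: eq_sym. Qed.
Fact laurent_trans : transitive laurent_eq.
Proof.
move=> [l y] [k x] [m w] /eqP/= xy /eqP/= yw; apply/eqP/(@zreg l) => /=.
by rewrite mulrA -exprD addnC exprD -mulrA xy mulrA -exprD addnC exprD -mulrA yw !mulrA -!exprD addnC.
Qed.

Canonical laurent_equiv := EquivRel laurent_eq laurent_refl laurent_sym laurent_trans.

(** Since [sg] may fail to be onto, z^-1 c cannot always be rewritten as c' z^-1; hence left
    fractions instead of coefficient sequences indexed by the integers. *)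
Definition laurent := {eq_quot laurent_equiv}.
HB.instance Definition _ := Choice.on laurent.
HB.instance Definition _ := EqQuotient.on laurent.

Definition lfrac k x : laurent := \pi_laurent (k, x).

Lemma lfracE k x l y : lfrac k x = lfrac l y <-> z ^+ l * x = z ^+ k * y.
Proof. by split=> [/eqmodP/eqP|h]; [|apply/eqmodP/eqP]. Qed.

Lemma lfrac_shift l k x : lfrac (l + k) (z ^+ l * x) = lfrac k x.
Proof. by apply/lfracE; rewrite mulrA -exprD addnC. Qed.

Lemma lfracP e : exists k x, e = lfrac k x.
Proof. by exists (repr e).1, (repr e).2; rewrite /lfrac -surjective_pairing reprK. Qed.

Lemma lfracP2 e1 e2 : exists k x1 x2, e1 = lfrac k x1 /\ e2 = lfrac k x2.
Proof.
have [k [x ->]] := lfracP e1; have [l [y ->]] := lfracP e2.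
exists (l + k)%N, (z ^+ l * x), (z ^+ k * y); rewrite lfrac_shift.
by rewrite [(l + k)%N]addnC lfrac_shift.
Qed.

Definition ladd (e1 e2 : laurent) : laurent :=
  lfrac ((repr e1).1 + (repr e2).1) (z ^+ (repr e2).1 * (repr e1).2 + z ^+ (repr e1).1 * (repr e2).2).
Definition lopp (e : laurent) : laurent := lfrac (repr e).1 (- (repr e).2).
(** From z^l x = s^l(x) z^l follows x z^-l = z^-l s^l(x), which brings the two denominators together
    on the left. *)
Definition lmul (e1 e2 : laurent) : laurent :=
  lfrac ((repr e1).1 + (repr e2).1) (s (repr e2).1 (repr e1).2 * (repr e2).2).

Lemma repr_lfrac k x : z ^+ k * (repr (lfrac k x)).2 = z ^+ (repr (lfrac k x)).1 * x.
Proof.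
by apply/lfracE; rewrite /lfrac -surjective_pairing reprK.
Qed.

Lemma laddE k x y : ladd (lfrac k x) (lfrac k y) = lfrac k (x + y).
Proof.
rewrite /ladd; have := repr_lfrac k x; case: (repr (lfrac k x)) => m x' /= hx.
have := repr_lfrac k y; case: (repr (lfrac k y)) => l y' /= hy; apply/lfracE.
by rewrite !mulrDr zC hx zC [z ^+ k * _]zC hy !mulrA -!exprD.
Qed.

Lemma loppE k x : lopp (lfrac k x) = lfrac k (- x).
Proof.
rewrite /lopp; have := repr_lfrac k x; case: (repr _) => l y /= h.
by apply/lfracE; rewrite !mulrN h.
Qed.

Lemma lmulE k x l y : lmul (lfrac k x) (lfrac l y) = lfrac (k + l) (s l x * y).
Proof.
rewrite /lmul; have := repr_lfrac k x; case: (repr (lfrac k x)) => k' x' /= hx.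
have := repr_lfrac l y; case: (repr (lfrac l y)) => l' y' /= hy; apply/lfracE.
have hsx : z ^+ k * s l' x' = z ^+ k' * s l' x.
  by rewrite -[z ^+ k](siter_spX _ l') -rmorphM hx rmorphM /= siter_spX.
rewrite addnC exprD -mulrA [z ^+ k * _]mulrA hsx -mulrA zC exprD -mulrA; congr (_ * _).
rewrite mulrA spXn_comm -siterD -mulrA hy mulrA addnC siterD -spXn_comm.
by rewrite mulrA.
Qed.

Fact laddA : associative ladd.
Proof.
move=> a b c; have [k [x [y [-> ->]]]] := lfracP2 a b.
have [l [w ->]] := lfracP c.
by rewrite -(lfrac_shift l k x) -(lfrac_shift l k y) -(lfrac_shift k l w) [(k + l)%N]addnC !laddE addrA.
Qed.
Fact laddC : commutative ladd.
Proof. by move=> a b; have [k [x [y [-> ->]]]] := lfracP2 a b; rewrite !laddE addrC. Qed.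
Fact ladd0 : left_id (lfrac 0 0) ladd.
Proof.
move=> a; have [k [x ->]] := lfracP a.
by rewrite -(lfrac_shift k 0) addn0 mulr0 laddE add0r.
Qed.
Fact laddN : left_inverse (lfrac 0 0) lopp ladd.
Proof.
move=> a; have [k [x ->]] := lfracP a; rewrite loppE laddE addNr.
by apply/lfracE; rewrite !mulr0.
Qed.
HB.instance Definition _ := GRing.isZmodule.Build laurent laddA laddC ladd0 laddN.

Fact lmulA : associative lmul.
Proof.
move=> a b c; have [k [x ->]] := lfracP a; have [l [y ->]] := lfracP b.
have [m [w ->]] := lfracP c.
by rewrite !lmulE rmorphM /= -siterD [(m + l)%N]addnC addnA mulrA.
Qed.
Fact lmul1l : left_id (lfrac 0 1) lmul.
Proof. by move=> a; have [k [x ->]] := lfracP a; rewrite lmulE rmorph1 mul1r. Qed.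
Fact lmul1r : right_id (lfrac 0 1) lmul.
Proof. by move=> a; have [k [x ->]] := lfracP a; rewrite lmulE addn0 mulr1. Qed.
Fact lmulDl : left_distributive lmul +%R.
Proof.
move=> a b c; have [k [x [y [-> ->]]]] := lfracP2 a b; have [l [w ->]] := lfracP c.
by rewrite [_ + _]laddE !lmulE [RHS]laddE rmorphD mulrDl.
Qed.
Fact lmulDr : right_distributive lmul +%R.
Proof.
move=> c a b; have [k [x [y [-> ->]]]] := lfracP2 a b; have [l [w ->]] := lfracP c.
by rewrite [_ + _]laddE !lmulE [RHS]laddE mulrDr.
Qed.
Fact lone_neq0 : lfrac 0 1 != 0.
Proof. by apply/eqP=> /lfracE; rewrite !mul1r => /eqP; rewrite oner_eq0. Qed.
HB.instance Definition _ := GRing.Zmodule_isNzRing.Build laurent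
  lmulA lmul1l lmul1r lmulDl lmulDr lone_neq0.

Definition lunit : pred laurent := fun e => `[< exists e', e' * e = 1 /\ e * e' = 1 >].
Definition linv (e : laurent) : laurent :=
  if pselect (exists e', e' * e = 1 /\ e * e' = 1) is left h then projT1 (cid h) else e.
Fact lmulV : {in lunit, left_inverse 1 linv *%R}.
Proof. by move=> e /asboolP; rewrite /linv; case: pselect => // h _; case: (cid h) => e' []. Qed.
Fact lmulrV : {in lunit, right_inverse 1 linv *%R}.
Proof. by move=> e /asboolP; rewrite /linv; case: pselect => // h _; case: (cid h) => e' []. Qed.
Fact lunitP e e' : e' * e = 1 /\ e * e' = 1 -> lunit e.
Proof. by move=> h; apply/asboolP; exists e'. Qed.
Fact linv_out : {in [predC lunit], linv =1 id}.
Proof. by move=> e /asboolP; rewrite /linv; case: pselect. Qed.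
HB.instance Definition _ := GRing.NzRing_hasMulInverse.Build laurent lmulV lmulrV lunitP linv_out.

Definition lemb (x : P) : laurent := lfrac 0 x.
Fact lemb_zmod : zmod_morphism lemb.
Proof. by move=> x y; rewrite -[RHS]/(ladd _ (lopp _)) loppE laddE. Qed.
Fact lemb_monoid : monoid_morphism lemb.
Proof. by split=> // x y; rewrite -[RHS]/(lmul _ _) lmulE. Qed.
HB.instance Definition _ := GRing.isZmodMorphism.Build P laurent lemb lemb_zmod.
HB.instance Definition _ := GRing.isMonoidMorphism.Build P laurent lemb lemb_monoid.

Lemma lemb_inj : injective lemb.
Proof. by move=> x y /lfracE; rewrite !mul1r. Qed.

Lemma lembX_frac k x : lemb (z ^+ k) * lfrac k x = lemb x.
Proof. by rewrite -[LHS]/(lmul _ _) lmulE siter_spX add0n -[k in lfrac k]addn0 lfrac_shift. Qed.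

Lemma lfracXl k : lfrac k 1 * lemb (z ^+ k) = 1.
Proof. by rewrite -[LHS]/(lmul _ _) lmulE mul1r -[z ^+ k]mulr1 addn0 -[k in lfrac k]addn0 lfrac_shift. Qed.

Lemma lembX_unit k : lemb (z ^+ k) \is a GRing.unit.
Proof. by apply/unitrP; exists (lfrac k 1); rewrite lfracXl lembX_frac rmorph1. Qed.

Lemma laurent_mulX_emb e : exists k x, lemb (z ^+ k) * e = lemb x.
Proof. by have [k [x ->]] := lfracP e; exists k, x; apply: lembX_frac. Qed.

(** The power of z is split off on the right, where no preimage under [sg] has to be taken. *)
Lemma spow_factor x : x != 0 -> exists k y, y 0%N != 0 /\ x = y * z ^+ k.
Proof.
move=> x0; have exk : exists k, x k != 0.
  apply: contraNP (x0) => /forallNP h; apply/eqP/spE=> n; apply/eqP; apply: contraT.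
  by move=> /h.
case: (ex_minnP exk) => k xk kmin; exists k, (fun n => x (n + k)%N).
split=> //; apply/spE=> n; rewrite spMXn; case: leqP => [kn|nk]; first by rewrite subnK.
by apply/eqP; apply: contraTT nk => /kmin; rewrite leqNgt.
Qed.

Lemma spow_unit x : x 0%N != 0 -> exists y, x * y = 1 /\ y * x = 1.
Proof.
move=> x0; have [y xy] : exists y, x * y = 1.
  by apply: sp_right_inverse; exists (x 0%N)^-1; rewrite mulrV //; apply: hC.
have [w yw] : exists w, y * w = 1.
  apply: sp_right_inverse; exists (x 0%N).
  move/(congr1 (fun f : P => f 0%N)): xy; rewrite spM0 [(1 : P) 0%N]/(1 : C) => xy.
  by rewrite -[y 0%N](mulKr (hC x0)) xy mulr1 mulVr // hC.
have xw : x = w by rewrite -[x]mulr1 -yw mulrA xy mul1r.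
by exists y; split=> //; rewrite xw.
Qed.

Lemma laurent_division : division_ring laurent.
Proof.
move=> e; have [k [x ->]] := lfracP e => e0.
have [j [y [y0 xE]]] : exists j y, y 0%N != 0 /\ x = y * z ^+ j.
  apply: spow_factor; apply: contraNneq e0 => ->.
  by apply/eqP/lfracE; rewrite !mulr0.
have [w [yw wy]] := spow_unit y0.
have uy : lemb y \is a GRing.unit.
  by apply/unitrP; exists (lemb w); rewrite -!rmorphM /= yw wy rmorph1.
have -> : lfrac k x = (lemb (z ^+ k))^-1 * (lemb y * lemb (z ^+ j)).
  by rewrite -rmorphM -xE /= -(lembX_frac k x) mulKr // lembX_unit.
by rewrite unitrMl ?unitrV ?unitrMl // ?lembX_unit.
Qed.

Definition lconst (c : C) : laurent := lemb (spC sg c).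
HB.instance Definition _ := GRing.RMorphism.copy lconst (lemb \o spC sg).

End LaurentDef.

Section PowerSubstitution.
Variables (D : unitRingType) (hD : division_ring D) (m : nat).
Local Notation M := m.+1.
Let M0 : (0 < M)%N := ltn0Sn m.
Local Notation idm := (idfun : {rmorphism D -> D}).
Local Notation P := (spow idm).
Local Notation z := (spX idm).

(* Substitution a |-> a^M in power series in one central variable a. *)
Definition subst (f : P) : P := fun n => if (M %| n)%N then f (n %/ M)%N else 0.

Lemma siter_id i (x : D) : siter idm i x = x. Proof. by elim: i => //= i ->. Qed.

Fact subst_zmod : zmod_morphism subst.
Proof. by move=> f g; apply/spE=> n; rewrite spD spN /subst; case: ifP; rewrite ?subr0. Qed.
Fact subst_monoid : monoid_morphism subst.
Proof.
split.
  apply/spE=> n; rewrite /subst !sp1; case: ifP => [/dvdnP[k ->]|].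
    by rewrite mulnK // muln_eq0 -[M == 0%N]negbK -lt0n M0 orbF.
  by case: n => //; rewrite dvdn0.
move=> f g; apply/spE=> n; rewrite spM.
under eq_bigr do rewrite siter_id.
rewrite {1}/subst; case: ifP => [/dvdnP[k ->]|/negP Mn]; last first.
  rewrite big1 // => i _; rewrite /subst; case: ifP => Mi; last by rewrite mul0r.
  case: ifP => Mni; last by rewrite mulr0.
  by case: Mn; rewrite -(subnK (leq_ord i)) dvdn_add.
rewrite mulnK // spM.
pose h (j : 'I_k.+1) : 'I_(k * M).+1 := inord (j * M).
pose h' (i : 'I_(k * M).+1) : 'I_k.+1 := inord (i %/ M).
have hE j : h j = (j * M)%N :> nat by rewrite inordK // ltnS leq_mul2r leq_ord orbT.
have h'E i : h' i = (i %/ M)%N :> nat.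
  by rewrite inordK // ltnS -[leqRHS](mulnK _ M0) leq_div2r // leq_ord.
rewrite [RHS](bigID (fun i : 'I_(k * M).+1 => (M %| i)%N)) /= [X in _ = _ + X]big1 ?addr0; last first.
  by move=> i /negbTE Mi; rewrite /subst Mi mul0r.
rewrite (reindex_onto h h') /=; last first.
  by move=> i Mi; apply: val_inj; rewrite /= hE h'E divnK.
rewrite [RHS](eq_bigl xpredT) /=; last first.
  move=> j; rewrite hE dvdn_mull //=; apply/eqP/val_inj.
  by rewrite /= h'E hE mulnK.
apply: eq_bigr => j _; rewrite siter_id /subst hE dvdn_mull // mulnK //.
by rewrite -mulnBl dvdn_mull // mulnK.
Qed.
HB.instance Definition _ := GRing.isZmodMorphism.Build P P subst subst_zmod.
HB.instance Definition _ := GRing.isMonoidMorphism.Build P P subst subst_monoid.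

(** An exponent is l + M q with l < M in only one way, so multiplying a polynomial of degree less
    than M by a series in a^M keeps all products of coefficients apart. *)
Lemma coef_mul_subst (g f : P) l q : (l < M)%N -> (forall i, (M <= i)%N -> g i = 0) ->
  (g * subst f) (l + M * q)%N = g l * f q.
Proof.
move=> lM gM; have lt : (l < (l + M * q).+1)%N by rewrite ltnS leq_addr.
rewrite spM (bigD1 (Ordinal lt)) //= siter_id addKn /subst dvdn_mulr // mulKn //.
rewrite big1 ?addr0 // => i; rewrite -val_eqE /= => il; rewrite siter_id.
have [/gM->|iM] := leqP M i; first by rewrite mul0r.
case: ifP => [Mi|_]; last by rewrite mulr0.
suff key a : (a < M)%N -> (a <= l + M * q)%N -> (M %| l + M * q - a)%N -> a = l.
  by rewrite (key i) ?eqxx ?leq_ord in il.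
move=> aM al; rewrite -eqn_mod_dvd // addnC mulnC modnMDl !modn_small //.
by move/eqP.
Qed.

Lemma subst_X k : subst (z ^+ k) = z ^+ (M * k).
Proof.
rewrite exprM rmorphXn /=; congr (_ ^+ _); apply/spE=> n.
rewrite -[z ^+ M]mulr1 spXnM siter_id /subst.
case: ifP => [/dvdnP[j ->]|Mn].
  rewrite mulnK // -[X in (_ < X)%N]mul1n ltn_mul2r M0 /=.
  case: j => [|[|j]] //; first by rewrite mul1n subnn.
  by rewrite ltnS /= sp1 subn_eq0 leqNgt -[X in (X < _)%N]mul1n ltn_mul2r M0.
case: ltnP => // Mn'; rewrite sp1 subn_eq0; case: leqP => // nM.
by move: Mn; rewrite (_ : n = M) ?dvdnn //; apply/eqP; rewrite eqn_leq nM.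
Qed.

Local Notation L := (laurent hD idm).

Definition lsubst (e : L) : L := lfrac hD (M * (repr e).1) (subst (repr e).2).

Lemma lsubstE k x : lsubst (lfrac hD k x) = lfrac hD (M * k) (subst x).
Proof.
rewrite /lsubst; have := repr_lfrac hD k x; case: (repr _) => l y /= h.
by apply/lfracE; rewrite -!subst_X -!rmorphM h.
Qed.

Fact lsubst_zmod : zmod_morphism lsubst.
Proof.
move=> a b; have [k [x [y [-> ->]]]] := lfracP2 a b.
rewrite -[- lfrac hD k y]/(lopp _) loppE -[lfrac _ _ _ + _]/(ladd _ _) laddE.
rewrite !lsubstE -[RHS]/(ladd _ (lopp _)) loppE laddE.
by rewrite rmorphD rmorphN.
Qed.
Fact lsubst_monoid : monoid_morphism lsubst.
Proof.
split; first by rewrite -[1]/(lfrac hD 0 1) lsubstE rmorph1 muln0.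
move=> a b; have [k [x ->]] := lfracP a; have [l [y ->]] := lfracP b.
rewrite -[_ * _]/(lmul _ _) lmulE !lsubstE -[RHS]/(lmul _ _) lmulE -mulnDr rmorphM.
have id_sps j (f : P) : siter (@sps D idm) j f = f.
  by elim: j => //= j ->; apply/spE.
by rewrite !id_sps.
Qed.
HB.instance Definition _ := GRing.isZmodMorphism.Build L L lsubst lsubst_zmod.
HB.instance Definition _ := GRing.isMonoidMorphism.Build L L lsubst lsubst_monoid.

End PowerSubstitution.

(** * Matrix pencils and maximal points *)

Section Coefficients.
Variables (C : nzRingType) (sg : {rmorphism C -> C}).
Local Notation P := (spow sg).

Definition cf m n q (A : 'M[P]_(m, n)) : 'M[C]_(m, n) := \matrix_(i, j) A i j q.

Lemma cfP m n (A B : 'M[P]_(m, n)) : (forall q, cf q A = cf q B) -> A = B.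
Proof.
by move=> AB; apply/matrixP=> i j; apply/spE=> q; have /matrixP/(_ i j) := AB q; rewrite !mxE.
Qed.

Lemma cfD m n q (A B : 'M[P]_(m, n)) : cf q (A + B) = cf q A + cf q B.
Proof. by apply/matrixP=> i j; rewrite !mxE. Qed.

Lemma cf0 m n q : cf q (0 : 'M[P]_(m, n)) = 0.
Proof. by apply/matrixP=> i j; rewrite !mxE. Qed.

Lemma cfN m n q (A : 'M[P]_(m, n)) : cf q (- A) = - cf q A.
Proof. by apply/matrixP=> i j; rewrite !mxE. Qed.

Lemma cf_sum m n q I r (Q : pred I) (F : I -> 'M[P]_(m, n)) :
  cf q (\sum_(i <- r | Q i) F i) = \sum_(i <- r | Q i) cf q (F i).
Proof. by elim/big_rec2: _ => [|i y x _ <-]; rewrite ?cf0 ?cfD. Qed.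

Lemma cf_mulC m n p q (B : 'M[C]_(m, n)) (A : 'M[P]_(n, p)) :
  cf q (map_mx (spC sg) B *m A) = B *m cf q A.
Proof.
apply/matrixP=> i j; rewrite !mxE sp_sum; apply: eq_bigr => k _.
by rewrite !mxE spCM.
Qed.

Lemma cf_X0 m n (A : 'M[P]_(m, n)) : cf 0 (spX sg *: A) = 0.
Proof. by apply/matrixP=> i j; rewrite !mxE spXM. Qed.

Lemma cf_XS m n q (A : 'M[P]_(m, n)) : cf q.+1 (spX sg *: A) = map_mx sg (cf q A).
Proof. by apply/matrixP=> i j; rewrite !mxE spXM. Qed.

Lemma cf0_mapC m n (B : 'M[C]_(m, n)) : cf 0 (map_mx (spC sg) B) = B.
Proof. by apply/matrixP=> i j; rewrite !mxE. Qed.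

End Coefficients.

Section Pencils.
Variables (K : fieldType) (n : nat).

(* The matrix pencil pc + \sum_i X_i pl_i in n indeterminates. *)
Record pencil k N := Pencil { pc : 'M[K]_(k, N); pl : 'I_n -> 'M[K]_(k, N) }.

Definition plin (A : nzRingType) (kap : {rmorphism K -> A}) (U : 'I_n -> A) k N
    (Q : pencil k N) : 'M[A]_(k, N) :=
  \sum_i U i *: map_mx kap (pl Q i).
Definition pev (A : nzRingType) (kap : {rmorphism K -> A}) (X : 'I_n -> A) k N
    (Q : pencil k N) : 'M[A]_(k, N) :=
  map_mx kap (pc Q) + plin kap X Q.

Definition prow k N (Q : pencil k N) i : pencil 1 N :=
  Pencil (row i (pc Q)) (fun l => row i (pl Q l)).
Definition pconst k N (A : 'M[K]_(k, N)) : pencil k N := Pencil A (fun=> 0).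
Definition pstack k N (r : 'I_k -> pencil 1 N) : pencil k N :=
  Pencil (\matrix_i pc (r i)) (fun l => \matrix_i pl (r i) l).
Definition pcol k1 k2 N (Q1 : pencil k1 N) (Q2 : pencil k2 N) : pencil (k1 + k2) N :=
  Pencil (col_mx (pc Q1) (pc Q2)) (fun l => col_mx (pl Q1 l) (pl Q2 l)).

Lemma map_plin (A B : nzRingType) (kap : {rmorphism K -> A}) (h : {rmorphism A -> B})
    (U : 'I_n -> A) k N (Q : pencil k N) :
  map_mx h (plin kap U Q) = plin (h \o kap) (h \o U) Q.
Proof.
rewrite /plin raddf_sum; apply: eq_bigr => i _.
by rewrite /= map_mxZ map_mx_comp.
Qed.

Lemma map_pev (A B : nzRingType) (kap : {rmorphism K -> A}) (h : {rmorphism A -> B})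
    (X : 'I_n -> A) k N (Q : pencil k N) :
  map_mx h (pev kap X Q) = pev (h \o kap) (h \o X) Q.
Proof. by rewrite /pev map_mxD map_plin -map_mx_comp. Qed.

Section Eval.
Variables (A : nzRingType) (kap : {rmorphism K -> A}).

Lemma row_plin (U : 'I_n -> A) k N (Q : pencil k N) i :
  row i (plin kap U Q) = plin kap U (prow Q i).
Proof.
by rewrite /plin linear_sum; apply: eq_bigr => l _ /=; rewrite linearZ /= map_row.
Qed.

Lemma row_pev (X : 'I_n -> A) k N (Q : pencil k N) i :
  row i (pev kap X Q) = pev kap X (prow Q i).
Proof. by rewrite /pev linearD /= row_plin map_row. Qed.

Lemma prow_stack k N (r : 'I_k -> pencil 1 N) i :
  prow (pstack r) i = Pencil (pc (r i)) (pl (r i)).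
Proof. by rewrite /prow /= rowK; congr Pencil; apply/funext=> l; rewrite rowK. Qed.

Lemma row_pev_stack (X : 'I_n -> A) k N (r : 'I_k -> pencil 1 N) i :
  row i (pev kap X (pstack r)) = pev kap X (r i).
Proof. by rewrite row_pev prow_stack. Qed.

Lemma pev_const (X : 'I_n -> A) k N (B : 'M[K]_(k, N)) : pev kap X (pconst B) = map_mx kap B.
Proof. by rewrite /pev /plin big1 ?addr0 // => i _; rewrite map_mx0 scaler0. Qed.

Lemma pev_col (X : 'I_n -> A) k1 k2 N (Q1 : pencil k1 N) (Q2 : pencil k2 N) :
  pev kap X (pcol Q1 Q2) = col_mx (pev kap X Q1) (pev kap X Q2).
Proof.
rewrite /pev map_col_mx -add_col_mx; congr (_ + _); rewrite /plin.
elim/big_rec3: _ => [|i x y t _ ->]; first by rewrite col_mx0.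
by rewrite map_col_mx scale_col_mx add_col_mx.
Qed.

Lemma plin_const (X : 'I_n -> A) k N (B : 'M[K]_(k, N)) : plin kap X (pconst B) = 0.
Proof. by rewrite /plin big1 // => i _; rewrite map_mx0 scaler0. Qed.

End Eval.

Definition pivot_row k N (Q : pencil k N) (sel : 'I_N -> option 'I_k) (i : 'I_N) : pencil 1 N :=
  if sel i is Some l then prow Q l else pconst (delta_mx 0 i).

Lemma pev_pivot (A : unitRingType) (kap : {rmorphism K -> A}) (X : 'I_n -> A) k N
    (Q : pencil k N) sel :
  pev kap X (pstack (pivot_row Q sel)) = pivot_mx (pev kap X Q) sel.
Proof.
apply/row_matrixP=> i; rewrite row_pev_stack rowK /pivot_row.
by case: (sel i) => [l|]; rewrite ?row_pev // pev_const map_delta_mx.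
Qed.

End Pencils.

Arguments pconst {K} n {k N} A.

(* Universality of D, in the form in which it is used: a pencil which is
   singular at beta remains singular at every point of every division ring
   containing D. *)
Definition maximal_point (K : fieldType) (D : unitRingType) (kap : {rmorphism K -> D})
    n (beta : 'I_n -> D) :=
  forall (E : unitRingType) (j : {rmorphism D -> E}) (X : 'I_n -> E),
    division_ring E -> (forall i, X i != 0) ->
    forall k N (Q : pencil K n k N),
      trivial_kernel (pev (j \o kap) X Q) -> trivial_kernel (pev kap beta Q).

Lemma map_mx_injective (A B : Type) (f : A -> B) m n :
  injective f -> injective (map_mx f : 'M_(m, n) -> 'M_(m, n)).
Proof.
by move=> fI A1 A2 /matrixP A12; apply/matrixP=> i j; apply: fI; have := A12 i j; rewrite !mxE.
Qed.

(** * Perturbation of a point in the direction z *)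

Section Perturbation.
Variables (K : fieldType) (D C : unitRingType) (hC : division_ring C).
Variables (kap : {rmorphism K -> D}) (j0 : {rmorphism D -> C}) (sg : {rmorphism C -> C}).
Hypothesis sgj0 : forall d, sg (j0 d) = j0 d.
Variables (n : nat) (beta : 'I_n -> D).

Local Notation O := (spow sg).
Local Notation z := (spX sg).
Local Notation E := (laurent hC sg).

Definition jpow : D -> O := spC sg \o j0.
HB.instance Definition _ := GRing.RMorphism.on jpow.
Definition jlau : D -> E := lemb hC (sg := sg) \o jpow.
HB.instance Definition _ := GRing.RMorphism.on jlau.

Definition perturb (U : 'I_n -> C) (i : 'I_n) : O := jpow (beta i) + spC sg (U i) * z.

Lemma spX_jpow d : z * jpow d = jpow d * z.
Proof.
rewrite spX_sps; congr (_ * _); apply/spE=> -[|q]; rewrite /sps /jpow /=.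
  exact: sgj0.
exact: rmorph0.
Qed.

Lemma pev_perturb U k N p (Q : pencil K n k N) (x : 'M[O]_(N, p)) :
  pev (jpow \o kap) (perturb U) Q *m x =
  map_mx jpow (pev kap beta Q) *m x + map_mx (spC sg) (plin (j0 \o kap) U Q) *m (z *: x).
Proof.
rewrite map_pev [pev (_ \o _) (perturb U) Q]/pev.
have -> : plin (jpow \o kap) (perturb U) Q = plin (jpow \o kap) (jpow \o beta) Q +
    \sum_i (spC sg (U i) * z) *: map_mx (jpow \o kap) (pl Q i).
  by rewrite -big_split; apply: eq_bigr => i _; rewrite scalerDl.
rewrite addrA mulmxDl; congr (_ + _); rewrite /plin raddf_sum !mulmx_suml.
apply: eq_bigr => i _; rewrite -scalerA -scalemxAl /= map_mxZ -scalemxAl; congr (_ *: _).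
apply/matrixP=> r c; rewrite !mxE; apply: eq_bigr => l _; rewrite !mxE.
by rewrite !mulrA; congr (_ * _); apply: spX_jpow.
Qed.

Lemma cf_perturb0 U k N p (Q : pencil K n k N) (x : 'M[O]_(N, p)) :
  cf 0 (pev (jpow \o kap) (perturb U) Q *m x) = map_mx j0 (pev kap beta Q) *m cf 0 x.
Proof.
rewrite pev_perturb cfD !cf_mulC cf_X0 mulmx0 addr0 -cf_mulC.
by rewrite -map_mx_comp.
Qed.

(** As z x = sg(x) z while z commutes with the image of [D], order q + 1 involves the coefficient of
    order q twisted by [sg]. *)
Lemma cf_perturbS U k N p q (Q : pencil K n k N) (x : 'M[O]_(N, p)) :
  cf q.+1 (pev (jpow \o kap) (perturb U) Q *m x) =
  map_mx j0 (pev kap beta Q) *m cf q.+1 x + plin (j0 \o kap) U Q *m map_mx sg (cf q x).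
Proof.
rewrite pev_perturb cfD cf_mulC cf_XS -cf_mulC; congr (cf _ (_ *m _) + _).
by rewrite -map_mx_comp.
Qed.

Lemma pev_perturb_kernel U N (Q : pencil K n N N) (G : 'M[D]_N) (x : 'cV[O]_N) :
  G *m pev kap beta Q = 1%:M ->
  pev (jpow \o kap) (perturb U) Q *m x = 0 -> x = 0.
Proof.
move=> GQ Qx.
have inj (y : 'cV[C]_N) : map_mx j0 (pev kap beta Q) *m y = 0 -> y = 0.
  move=> Qy; rewrite -[y]mul1mx -(map_mx1 j0) -GQ map_mxM -mulmxA Qy.
  exact: mulmx0.
apply: cfP; elim=> [|q IH].
  by rewrite cf0; apply: inj; rewrite -(cf_perturb0 U) Qx cf0.
rewrite [RHS]cf0; apply: inj.
move/(congr1 (cf q.+1)): Qx; rewrite cf_perturbS IH !cf0.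
by rewrite map_mx0 mulmx0 addr0.
Qed.

Lemma common_denominator N (v : 'cV[E]_N) :
  exists k (x : 'cV[O]_N), lemb hC (z ^+ k) *: v = map_mx (lemb hC (sg := sg)) x.
Proof.
have /choice [f hf] : forall i, exists kx : nat * O, lemb hC (z ^+ kx.1) * v i 0 = lemb hC kx.2.
  by move=> i; have [k [x h]] := laurent_mulX_emb (v i 0); exists (k, x).
pose k := (\max_i (f i).1)%N.
exists k, (\col_i (z ^+ (k - (f i).1) * (f i).2)); apply/colP=> i; rewrite !mxE.
by rewrite rmorphM /= -hf mulrA -rmorphM -exprD subnK // (bigmax_sup i).
Qed.

Lemma siter_jpow l d : siter (@sps C sg) l (jpow d) = jpow d.
Proof. by rewrite siter_spC; congr spC; elim: l => //= l ->. Qed.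

Lemma siter_perturb U l i :
  siter (@sps C sg) l (perturb U i) = perturb (siter sg l \o U) i.
Proof.
rewrite /perturb rmorphD rmorphM /= siter_jpow siter_spC.
by rewrite -[z]expr1 siter_spX.
Qed.

(** Denominators are cleared on the left. Moving z^l across the pencil replaces [U] by
    [siter sg l \o U], and the power series case is applied to this new direction. *)
Lemma perturb_trivial_kernel U N (Q : pencil K n N N) (G : 'M[D]_N) :
  G *m pev kap beta Q = 1%:M ->
  trivial_kernel (pev (jlau \o kap) (lemb hC (sg := sg) \o perturb U) Q).
Proof.
move=> GQ v Qv; have [l [x vx]] := common_denominator v.
suff x0 : x = 0.
  move/(congr1 (fun w => (lemb hC (z ^+ l))^-1 *: w)): vx.
  by rewrite x0 map_mx0 scaler0 scalerA mulVr ?lembX_unit // scale1r.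
apply: (@pev_perturb_kernel (siter sg l \o U) _ Q G) => //.
have -> : pev (jpow \o kap) (perturb (siter sg l \o U)) Q =
    map_mx (siter (@sps C sg) l) (pev (jpow \o kap) (perturb U) Q).
  rewrite map_pev /pev /plin; congr (_ + _).
    by apply/matrixP=> r c; rewrite !mxE /= siter_jpow.
  apply: eq_bigr => i _; congr (_ *: _); first by rewrite /= siter_perturb.
  by apply/matrixP=> r c; rewrite !mxE /= siter_jpow.
apply: (map_mx_injective (@lemb_inj _ hC sg)).
rewrite map_mxM /= -vx map_mx0.
rewrite -[RHS](scaler0 _ (lemb hC (z ^+ l))) -Qv.
have -> : pev (jlau \o kap) (lemb hC (sg := sg) \o perturb U) Q =
   map_mx (lemb hC (sg := sg)) (pev (jpow \o kap) (perturb U) Q) by rewrite map_pev.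
apply/colP=> r; rewrite !mxE mulr_sumr; apply: eq_bigr => c _; rewrite !mxE.
by rewrite !mulrA -!rmorphM spXn_comm.
Qed.

End Perturbation.

(** * Prolongation of kernel vectors along words of directions *)

Section PivotSolutions.
Variables (K : fieldType) (D : unitRingType) (hD : division_ring D) (kap : {rmorphism K -> D}).
Variables (n : nat) (beta : 'I_n -> D).
Hypothesis beta0 : forall i, beta i != 0.
Hypothesis hmax : maximal_point kap beta.
Variables (m N : nat) (J : pencil K n m N).
Local Notation A := (pev kap beta J).
Variables (sel : 'I_N -> option 'I_m) (G : 'M[D]_N).
Hypothesis pivG : pivot_mx A sel *m G = 1%:M.
Hypothesis Gpiv : G *m pivot_mx A sel = 1%:M.
Local Notation Jh := (pstack (pivot_row J sel)).

Let JhG : pev kap beta Jh *m G = 1%:M. Proof. by rewrite pev_pivot. Qed.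
Let GJh : G *m pev kap beta Jh = 1%:M. Proof. by rewrite pev_pivot. Qed.

(** For a solution of the pivot pencil at beta + u z with constant right-hand side, this map yields,
    up to the twist, the next coefficient from the previous one. *)
Definition pivot_step (u : 'I_n -> D) (v : 'cV[D]_N) : 'cV[D]_N :=
  - (G *m (plin kap u Jh *m v)).
Definition pivot_word w t : 'cV[D]_N := foldr pivot_step (G *m delta_mx t 0) w.

Section Word.
Variables (t : 'I_N) (u : 'I_n -> D) (w : seq ('I_n -> D)).
Local Notation idm := (idfun : {rmorphism D -> D}).
Local Notation PS := (spow idm).
Local Notation M := (size w).+1.
Local Notation C := (laurent hD idm).
Local Notation hC := (@laurent_division D hD idm).
Local Notation sg := (lsubst (D := D) (hD := hD) (size w) : {rmorphism C -> C}).
Local Notation j0 := (lemb hD (sg := idm) \o spC idm : {rmorphism D -> C}).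
Local Notation O := (spow sg).

(* For the word w = u_1 ... u_k, the point beta is moved to
   beta + (\sum_l u_l a^l) z in the Laurent series in z over D((a)), where
   z a = a^M z. A solution x of the first pivot rows then has expansions whose
   coefficients in z and a run through the vectors [pivot_word]: the twist
   a |-> a^M keeps the powers of a coming from different letters apart. *)
Let letter l := nth (fun=> 0) (u :: w) l.
Let Up i : PS := fun q => letter q i.
Let U i : C := lemb hD (Up i).
Let V q : 'cV[PS]_N := iter q
  (fun V => - (map_mx (spC idm) G *m (plin (spC idm \o kap) Up Jh *m map_mx (subst (size w)) V)))
  (map_mx (spC idm) (G *m delta_mx t 0)).
Let x : 'cV[O]_N := \matrix_(i, j) ((fun q => lemb hD (V q i j)) : O).

Let cfx q : cf q x = map_mx (lemb hD (sg := idm)) (V q).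
Proof. by apply/matrixP=> i j; rewrite !mxE. Qed.

Let lsubst_emb (f : PS) : lsubst (size w) (lemb hD f) = lemb hD (subst (size w) f).
Proof. by rewrite /lemb lsubstE muln0. Qed.

Let sgj0 d : sg (j0 d) = j0 d.
Proof.
rewrite /= lsubst_emb; congr lemb; apply/spE=> q; rewrite /subst.
case: ifP => [/dvdnP[k ->]|]; last by case: q => // /negP; rewrite dvdn0.
by rewrite mulnK //; case: k.
Qed.

Let sgx q : map_mx sg (cf q x) = map_mx (lemb hD (sg := idm)) (map_mx (subst (size w)) (V q)).
Proof. by rewrite cfx; apply/matrixP=> i j; rewrite !mxE -lsubst_emb. Qed.

Let cf0_eval k (Q : pencil K n k N) :
  cf 0 (pev (jpow j0 sg \o kap) (perturb j0 sg beta U) Q *m x) =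
  map_mx j0 (pev kap beta Q *m (G *m delta_mx t 0)).
Proof. by rewrite cf_perturb0 // cfx -map_mx_comp -map_mxM. Qed.

Let cfS_eval q k (Q : pencil K n k N) :
  cf q.+1 (pev (jpow j0 sg \o kap) (perturb j0 sg beta U) Q *m x) =
  map_mx (lemb hD (sg := idm)) (map_mx (spC idm) (pev kap beta Q) *m V q.+1 +
    plin (spC idm \o kap) Up Q *m map_mx (subst (size w)) (V q)).
Proof.
rewrite cf_perturbS // sgx cfx [RHS]map_mxD !map_mxM; congr (_ + _); congr (_ *m _).
  by rewrite -map_mx_comp.
by rewrite map_plin.
Qed.

Let Jhx : pev (jpow j0 sg \o kap) (perturb j0 sg beta U) Jh *m x = map_mx (jpow j0 sg) (delta_mx t 0).
Proof.
apply: cfP => -[|q].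
  rewrite cf0_eval mulmxA JhG mul1mx.
  by apply/matrixP=> i j; rewrite !mxE.
rewrite cfS_eval /= mulmxN mulmxA -map_mxM JhG map_mx1 mul1mx addNr map_mx0.
by apply/matrixP=> i j; rewrite !mxE.
Qed.

(* Otherwise row t of the pivot pencil could be replaced by rho, giving a pencil
   which is nonsingular at the perturbed point but singular at beta. *)
Lemma perturbed_row (rho : pencil K n 1 N) :
  pev kap beta rho *m (G *m delta_mx t 0 : 'cV_N) = 0 ->
  pev (jpow j0 sg \o kap) (perturb j0 sg beta U) rho *m x = 0.
Proof.
move=> rho0; set r := (X in X = 0); apply/eqP; apply: contraT => r0.
pose emb := lemb hC (sg := sg).
pose X : 'I_n -> laurent hC sg := emb \o perturb j0 sg beta U.
pose Q := pstack (fun i => if i == t then rho else pivot_row J sel i).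
have X0 i : X i != 0.
  apply/eqP=> Xi0; have : perturb j0 sg beta U i = 0 by apply: (@lemb_inj _ hC sg); rewrite rmorph0.
  move/(congr1 (fun f : O => f 0%N)); rewrite /perturb spD.
  have -> : (spC sg (U i) * spX sg) 0%N = 0 by rewrite spM0 mulr0.
  rewrite addr0 sp0 -(rmorph0 j0) => /(division_rmorph_inj hD) /eqP.
  by rewrite (negbTE (beta0 i)).
have kerJ : trivial_kernel (pev (jlau hC j0 sg \o kap) X Jh).
  exact: (perturb_trivial_kernel sgj0 (U := U) GJh).
have QE i (v : 'cV_N) : pev (jlau hC j0 sg \o kap) X Q *m v = 0 ->
    (pev (jlau hC j0 sg \o kap) X (if i == t then rho else pivot_row J sel i)) *m v = 0.
  move=> Qv; have := row_mul i (pev (jlau hC j0 sg \o kap) X Q) v.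
  by rewrite Qv row0 row_pev_stack => <-.
have embJ : pev (jlau hC j0 sg \o kap) X Jh *m map_mx emb x = delta_mx t 0.
  rewrite -[RHS](map_delta_mx emb) -(map_delta_mx (jpow j0 sg)) -Jhx map_mxM.
  by rewrite map_pev.
have embr : pev (jlau hC j0 sg \o kap) X rho *m map_mx emb x = map_mx emb r.
  by rewrite map_mxM map_pev.
have kerQ : trivial_kernel (pev (jlau hC j0 sg \o kap) X Q).
  move=> v Qv; pose c := row t (pev (jlau hC j0 sg \o kap) X Jh *m v).
  (* Every row of the pivot pencil except row [t] kills [v], so [v] and [x] times [c] have the same
     image. The row [rho] then gives r c = 0 with r nonzero. *)
  have vE : v = map_mx emb x *m c.
    apply/eqP; rewrite -subr_eq0; apply/eqP/kerJ.
    rewrite mulmxBr mulmxA embJ; apply/eqP; rewrite subr_eq0; apply/eqP/row_matrixP=> i.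
    rewrite [RHS]row_mul; have [->|it] := eqVneq i t.
      have -> : row t (delta_mx t 0 : 'cV_N) = (1%:M : 'M[laurent hC sg]_1).
        by apply/matrixP=> a b; rewrite !mxE !ord1 !eqxx.
      by rewrite mul1mx.
    have -> : row i (delta_mx t 0 : 'cV_N) = (0 : 'M[laurent hC sg]_1).
      by apply/matrixP=> a b; rewrite !mxE (negbTE it).
    rewrite mul0mx row_mul row_pev_stack.
    by have := QE i v Qv; rewrite (negbTE it).
  have := QE t v Qv; rewrite eqxx vE mulmxA embr => /eqP rc.
  suff -> : c = 0 by rewrite mulmx0.
  have er0 : emb (r 0 0) != 0.
    apply: contraNneq r0; rewrite -(rmorph0 emb) => /lemb_inj r00.
    by apply/eqP/matrixP=> a b; rewrite !ord1 r00 mxE.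
  apply/matrixP=> a b; rewrite !ord1 [RHS]mxE.
  have rcE (r' : 'M[O]_1) : (map_mx emb r' *m c) 0 0 = emb (r' 0 0) * c 0 0.
    by rewrite mxE big_ord1 mxE.
  move/eqP/matrixP/(_ 0 0): rc; rewrite rcE [RHS]mxE => rc.
  by rewrite -[LHS](mulKr (laurent_division er0)) rc mulr0.
have Qker := hmax (laurent_division (hC := hC) (sg := sg)) X0 kerQ.
have Q0 : pev kap beta Q *m (G *m delta_mx t 0 : 'cV_N) = 0.
  apply/row_matrixP=> i; rewrite row_mul row_pev_stack row0; case: eqP => [_//|/eqP it].
  rewrite -row_pev_stack -row_mul mulmxA JhG mul1mx.
  by apply/matrixP=> a b; rewrite !mxE (negbTE it).
have := congr1 (mulmx (pev kap beta Jh)) (Qker _ Q0).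
rewrite mulmxA JhG mul1mx mulmx0 => /matrixP/(_ t 0)/eqP.
by rewrite !mxE !eqxx oner_eq0.
Qed.

Let cf_plin q k (Q : pencil K n k N) :
  cf q (plin (spC idm \o kap) Up Q) = plin kap (letter q) Q.
Proof.
rewrite cf_sum; apply: eq_bigr => i _; apply/matrixP=> r c; rewrite !mxE.
rewrite spM big_ord_recr /= subnn siter_id big1 ?add0r // => l _.
by rewrite siter_id -(subnSK (ltn_ord l)) mulr0.
Qed.

Let cf_letter l q k (Q : pencil K n k N) (W : 'cV[PS]_N) : (l < M)%N ->
  cf (l + M * q) (plin (spC idm \o kap) Up Q *m map_mx (subst (size w)) W) =
  plin kap (letter l) Q *m cf q W.
Proof.
move=> lM; rewrite -cf_plin; apply/matrixP=> r c; rewrite !mxE sp_sum.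
apply: eq_bigr => i _; rewrite !mxE coef_mul_subst // => j Mj.
have /matrixP/(_ r i) := cf_plin j Q; rewrite [LHS]mxE => ->.
by rewrite summxE big1 // => a _; rewrite !mxE /letter nth_default ?mul0r.
Qed.

(** Each new letter adds a lowest digit in base [M] to the exponent of a, namely the position of
    that letter in [u :: w]. *)
Let V_word w' p : u :: w = p ++ w' -> exists q N', pivot_word w' t = cf N' (V q).
Proof.
elim: w' p => [|a w' IH] p e; first by exists 0%N, 0%N; rewrite cf0_mapC.
have [|q [N' h]] := IH (rcons p a); first by rewrite cat_rcons.
exists q.+1, (size p + M * N')%N; rewrite /= cfN cf_mulC cf_letter.
  by rewrite /letter e nth_cat ltnn subnn /= /pivot_step -h.
by move/(congr1 size): e; rewrite /= size_cat /= addnS => -[->]; rewrite ltnS leq_addr.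
Qed.

(** By [perturbed_row], [rho] kills the whole perturbed solution; the identity is the coefficient at
    the power of z and the power of a that single out this word. So the words satisfy also the
    equations of rows that are not pivots. *)
Lemma pivot_word_lift (rho : pencil K n 1 N) :
  pev kap beta rho *m (G *m delta_mx t 0 : 'cV_N) = 0 ->
  pev kap beta rho *m pivot_word (u :: w) t + plin kap u rho *m pivot_word w t = 0.
Proof.
move=> rho0; have [q [N' h]] := V_word (p := [:: u]) (erefl _).
have e := congr1 (cf q.+1) (perturbed_row rho0); rewrite cfS_eval cf0 in e.
have {}e := map_mx_injective (@lemb_inj _ hD idm) (etrans e (esym (map_mx0 (lemb hD (sg := idm)) _ _))).
move/(congr1 (cf (0 + M * N'))): e.
rewrite cfD cf0 cf_letter // cf_mulC /= cfN cf_mulC cf_letter // -h.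
by [].
Qed.

End Word.

(* The D-bimodule spanned by the pivot words issued from the kernel of A; it is
   stable, up to images under A, by all the coefficients of the pencil. *)
Inductive pivot_closure : 'cV[D]_N -> Prop :=
| PivotWord w t a c : sel t = None -> pivot_closure (a *: pivot_word w t *m c)
| PivotZero : pivot_closure 0
| PivotAdd u v : pivot_closure u -> pivot_closure v -> pivot_closure (u + v).

End PivotSolutions.

Section Saturation.
Variables (K : fieldType) (D : unitRingType) (hD : division_ring D) (kap : {rmorphism K -> D}).
Hypothesis kapC : forall c x, kap c * x = x * kap c.
Variables (n : nat) (beta : 'I_n -> D).
Hypothesis beta0 : forall i, beta i != 0.
Hypothesis hmax : maximal_point kap beta.
Variables (m N : nat) (J : pencil K n m N).
Local Notation A := (pev kap beta J).

Lemma map_scalar_mul k l p (B : 'M[K]_(k, l)) (a : D) (v : 'M[D]_(l, p)) :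
  map_mx kap B *m (a *: v) = (a *: map_mx kap B) *m v.
Proof.
apply/matrixP=> i j; rewrite !mxE; apply: eq_bigr => r _.
by rewrite !mxE mulrA kapC.
Qed.

(** Prefixing a word by the letter that is [a] at [i] and 0 elsewhere gives a linear part equal to
    [a] times the coefficient [pl J i], and the lifting identity then supplies the preimage under
    [A]. A relation [y] over [K] is a pencil with zero linear part, so lifting carries it from the
    kernel to all words. *)
Lemma saturation : exists U : 'cV[D]_N -> Prop,
  [/\ [/\ forall u v, U u -> U v -> U (u + v),
          forall u (c : 'M[D]_1), U u -> U (u *m c) &
          forall (a : D) u, U u -> U (a *: u)],
      forall v, A *m v = 0 -> U v,
      forall i u, U u -> exists2 u', U u' & map_mx kap (pl J i) *m u = A *m u' &
      forall y : 'rV[K]_N, (forall v, A *m v = 0 -> map_mx kap y *m v = (0 : 'cV_1)) ->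
        forall u, U u -> map_mx kap y *m u = (0 : 'cV_1)].
Proof.
have [sel [G [h1 h2 h3]]] := gauss hD A.
pose U := pivot_closure kap J sel G.
have AG t : sel t = None -> A *m (G *m delta_mx t 0 : 'cV_N) = 0.
  by move=> st; apply/colP=> i; rewrite mulmxA -colE mxE h3 // mxE.
have lift i w u t : sel t = None ->
    row i (A *m pivot_word kap J sel G (u :: w) t + plin kap u J *m pivot_word kap J sel G w t) = 0.
  move=> st; rewrite linearD /= !row_mul row_pev row_plin.
  apply: (pivot_word_lift hD beta0 hmax h1 h2).
  by rewrite -row_pev -row_mul AG // row0.
have UD u v : U u -> U v -> U (u + v) by exact: PivotAdd.
have UM u c : U u -> U (u *m c).
  elim=> [w t a c' st||u1 v1 _ IH1 _ IH2]; last by rewrite mulmxDl; apply: UD.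
    by rewrite -mulmxA; apply: PivotWord.
  by rewrite mul0mx; apply: PivotZero.
have UZ a u : U u -> U (a *: u).
  elim=> [w t a' c' st||u1 v1 _ IH1 _ IH2]; last by rewrite scalerDr; apply: UD.
    by rewrite scalemxAl scalerA; apply: PivotWord.
  by rewrite scaler0; apply: PivotZero.
exists U; split=> //.
- move=> v Av; rewrite -[v]mul1mx -h2 -mulmxA; set w := _ *m v.
  have -> : w = \sum_k delta_mx k 0 *m (w k 0)%:M.
    apply/colP=> i; rewrite summxE (bigD1 i) //= big1 ?addr0 => [|k ki].
      by rewrite !mxE big_ord1 !mxE !eqxx mul1r mulr1n.
    by rewrite !mxE big_ord1 !mxE eq_sym (negbTE ki) mul0r.
  rewrite mulmx_sumr; apply: (big_ind U) => [||k _]; [exact: PivotZero|exact: UD|].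
  case E : (sel k) => [i|].
    suff -> : w k 0 = 0 by rewrite -scalemx1 scale0r !mulmx0; apply: PivotZero.
    have /rowP/(_ 0) : row k w = 0 by rewrite row_mul rowK E -row_mul Av row0.
    by rewrite !mxE.
  rewrite mulmxA -[G *m _]scale1r; exact: (@PivotWord _ _ _ _ _ _ _ _ _ [::] k 1 _ E).
- move=> i u; elim=> [w t a c st||u1 v1 _ [u1' Uu1 e1] _ [v1' Uv1 e2]].
  2: by exists 0; [exact: PivotZero|rewrite !mulmx0].
  2: by exists (u1' + v1'); [exact: UD|rewrite !mulmxDr e1 e2].
  pose l : 'I_n -> D := fun i' => if i' == i then a else 0.
  exists (- (1 *: pivot_word kap J sel G (l :: w) t *m c)).
    by rewrite -mulNmx -scaleN1r scalerA; apply: PivotWord.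
  rewrite mulmxA map_scalar_mul scale1r mulmxN mulmxA -mulNmx; congr (_ *m _).
  have plE : plin kap l J = a *: map_mx kap (pl J i).
    rewrite /plin (bigD1 i) //= /l eqxx big1 ?addr0 // => k /negbTE ->.
    by rewrite scale0r.
  apply/eqP; rewrite -plE -subr_eq0 opprK addrC; apply/eqP/row_matrixP=> k.
  by rewrite lift // row0.
- move=> y hy u; elim=> [w t a c st||u1 v1 _ IH1 _ IH2].
  2: by rewrite mulmx0.
  2: by rewrite mulmxDr IH1 IH2 addr0.
  rewrite mulmxA map_scalar_mul -scalemxAl.
  suff -> : map_mx kap y *m pivot_word kap J sel G w t = 0 by rewrite scaler0 mul0mx.
  case: w => [|l w]; first exact/hy/AG.
  have := pivot_word_lift hD beta0 hmax h1 h2 (t := t) l w (rho := pconst n y).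
  rewrite pev_const plin_const mul0mx addr0; apply.
  exact/hy/AG.
Qed.

End Saturation.

(** * From the universal property to kernels of matrices *)

Section FinitelyGenerated.
Variables (D : unitRingType) (hD : division_ring D) (V : lmodType D).

(** The universal inequality speaks of dimensions through [has_dim], so one has to be exhibited: a
    spanning family of least size is a basis. *)
Lemma finite_spanning_has_dim N (u : 'I_N -> V) :
  (forall v, exists c : 'I_N -> D, v = \sum_i c i *: u i) -> exists p, has_dim V p.
Proof.
move=> uspan.
pose P p := `[< exists e : 'I_p -> V, forall v, exists c : 'I_p -> D, v = \sum_i c i *: e i >].
have exP : exists p, P p by exists N; apply/asboolP; exists u.
case: (ex_minnP exP) => -[|p] /asboolP[e espan] pmin.
  exists 0%N, e => v; have [c vE] := espan v; exists 0; split.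
    by rewrite vE !big_ord0.
  by move=> c' _; apply/rowP=> -[].
exists p.+1, e => v; have [c vE] := espan v; exists (\row_i c i); split.
  by rewrite vE; apply: eq_bigr => i _; rewrite mxE.
move=> c' vE'; apply/eqP; apply: contraT => /eqP cc'.
have [k dk] : exists k, c' 0 k - c k != 0.
  apply: contra_notP cc' => /forallNP h; apply/rowP=> k; rewrite mxE; apply/esym/eqP.
  by rewrite -subr_eq0; apply: contraT => /h.
have rel : \sum_i (c' 0 i - c i) *: e i = 0.
  by under eq_bigr do rewrite scalerBl; rewrite sumrB -vE' -vE subrr.
pose d i := c' 0 i - c i.
have ek : e k = - \sum_i ((d k)^-1 * d (lift k i)) *: e (lift k i).
  move: rel; rewrite (bigD1_ord k) //= => /eqP; rewrite addr_eq0 => /eqP rel.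
  rewrite -[LHS]scale1r -(mulVr (hD dk)) -scalerA rel scalerN scaler_sumr.
  by congr (- _); apply: eq_bigr => i _; rewrite scalerA.
suff /pmin : P p by rewrite ltnn.
apply/asboolP; exists (fun i => e (lift k i)) => w; have [b ->] := espan w.
exists (fun i => b (lift k i) - b k * ((d k)^-1 * d (lift k i))).
rewrite (bigD1_ord k) //= ek scalerN scaler_sumr addrC -sumrB.
by apply: eq_bigr => i _; rewrite scalerBl scalerA.
Qed.
End FinitelyGenerated.

Section QuotientMaps.
Variables (R : nzRingType) (M : lmodType R) (N : submodClosed M) (A : zmodType).

Lemma quot_lift (h : {additive M -> A}) : {in N, forall x, h x = 0} ->
  exists psi : quot_module N -> A, forall x, psi (proj N x) = h x.
Proof.
move=> hN; exists (fun q => h (quot_repr q)) => x.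
apply/eqP; rewrite -subr_eq0 -raddfB; apply/eqP/hN/projP.
by rewrite quot_reprK.
Qed.

End QuotientMaps.

Section Universality.
Variables (R : nzRingType) (D : unitRingType) (iota : {rmorphism R -> D}).
Hypothesis hD : universal_division_ring_of_fractions iota.
Variables (k N : nat) (Q : 'M[R]_(k, N)).

Let rel (y : 'rV[R]_N) := exists i, y = row i Q.
Let M := quot_module (Defs.span rel).
Let gen l : M := proj (Defs.span rel) (delta_mx 0 l).

Let M_presented : finitely_presented M.
Proof.
exists N, (proj (Defs.span rel)); split; first exact: proj_surj.
exists [seq row i Q | i <- enum 'I_k] => y; apply/idP/idP.
  rewrite unfold_in proj_eq0 => /spanP; apply; first exact: span_submod_closed.
  move=> _ [i ->]; apply: mem_span; apply/mapP; exists i => //.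
  by rewrite mem_enum.
move=> /spanP hy; rewrite unfold_in proj_eq0; apply: hy; first exact: span_submod_closed.
by move=> _ /mapP[i _ ->]; apply: mem_span; exists i.
Qed.

Section Base.
Variables (E : unitRingType) (f : {rmorphism R -> E}).
Let u l : tensor f M := pure_tensor f 1 (gen l).

Let pure_proj a (y : 'rV[R]_N) :
  pure_tensor f a (proj (Defs.span rel) y) = \sum_l (a * f (y 0 l)) *: u l.
Proof.
have [_ bD bZ] := pure_tensor_balanced f M.
have b0 : pure_tensor f a (0 : M) = 0.
  by apply: (addrI (pure_tensor f a (0 : M))); rewrite -bD !addr0.
rewrite [in LHS](row_sum_delta y) linear_sum /=.
rewrite (big_morph (pure_tensor f a) (bD a) b0); apply: eq_bigr => l _.
rewrite [u l]/(pure_tensor f 1 (gen l)) pure_tensorZ mulr1 bZ.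
congr (pure_tensor f a _); exact: proj_scale.
Qed.

Lemma tensor_coker_span v : exists c : 'I_N -> E, v = \sum_i c i *: u i.
Proof.
elim/tensor_ind: v => [|x y [c ->] [d ->]|a m].
- by exists (fun=> 0); rewrite big1 // => i _; rewrite scale0r.
- exists (fun i => c i + d i); rewrite -big_split; apply: eq_bigr => i _ /=.
  by rewrite scalerDl.
case: (proj_surj m) => y <-; rewrite pure_proj.
by exists (fun l => a * f (y 0 l)).
Qed.

Lemma tensor_coker0 (G : 'M[E]_(N, k)) : G *m map_mx f Q = 1%:M ->
  forall v : tensor f M, v = 0.
Proof.
move=> GQ v; have [c ->] := tensor_coker_span v; apply: big1 => l _.
suff -> : u l = 0 by rewrite scaler0.
have rel0 i : \sum_l' map_mx f Q i l' *: u l' = 0.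
  have -> : \sum_l' map_mx f Q i l' *: u l' = pure_tensor f 1 (proj (Defs.span rel) (row i Q)).
    by rewrite pure_proj; apply: eq_bigr => l' _; rewrite !mxE mul1r.
  have -> : proj (Defs.span rel) (row i Q) = 0.
    by apply/eqP; rewrite proj_eq0; apply: mem_span; exists i.
  have [_ bD _] := pure_tensor_balanced f M.
  by apply: (addrI (pure_tensor f 1 (0 : M))); rewrite -bD !addr0.
transitivity (\sum_l' (1%:M : 'M[E]_N) l l' *: u l').
  rewrite (bigD1 l) //= big1 ?addr0 => [|l' /negbTE l'l]; first by rewrite mxE eqxx scale1r.
  by rewrite mxE eq_sym l'l scale0r.
rewrite -GQ; under eq_bigr do rewrite mxE scaler_suml.
rewrite exchange_big big1 // => i _ /=; under eq_bigr do rewrite -scalerA.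
by rewrite -scaler_sumr rel0 scaler0.
Qed.

(** A kernel vector induces the balanced map sending (a, y) to a f(y) v on the cokernel. It vanishes
    with the tensor product, and its values at the generators are the entries of [v]. *)
Lemma tensor_coker_kernel (v : 'cV[E]_N) : map_mx f Q *m v = 0 ->
  (forall x : tensor f M, x = 0) -> v = 0.
Proof.
move=> Qv T0; pose h (y : 'rV[R]_N) : E := (map_mx f y *m v) 0 0.
have hB : zmod_morphism h by move=> x y; rewrite /h map_mxB mulmxBl !mxE.
pose H : {additive 'rV[R]_N -> E} := HB.pack h (GRing.isZmodMorphism.Build _ _ h hB).
have hZ r y : h (r *: y) = f r * h y by rewrite /h map_mxZ -scalemxAl mxE.
have Hspan : {in Defs.span rel, forall y, H y = 0}.
  pose K0 : {pred 'rV[R]_N} := fun y => h y == 0.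
  move=> y /spanP /(_ K0) yK; apply/eqP/yK.
    split=> [|a x w /eqP x0 /eqP w0]; apply/eqP; first exact: (raddf0 H).
    by rewrite [LHS](raddfD H) /= hZ x0 w0 mulr0 addr0.
  move=> _ [i ->]; apply/eqP; rewrite /h map_row -row_mul Qv.
  by rewrite !mxE.
have [psi psiE] := quot_lift Hspan.
have psiD x y : psi (x + y) = psi x + psi y.
  by case: (proj_surj x) (proj_surj y) => a <- [b <-]; rewrite -projD !psiE raddfD.
have psiZ r x : psi (r *: x) = f r * psi x.
  by case: (proj_surj x) => a <-; rewrite -[_ *: _]proj_scale !psiE; apply: hZ.
have bal : balanced f (fun a x => a * psi x : E).
  split=> [a a' x|a x y|a r x]; first by rewrite mulrDl.
    by rewrite psiD mulrDr.
  by rewrite psiZ mulrA.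
have [g gE _] := tensor_universal bal.
apply/colP=> l; have := gE 1 (gen l); rewrite (T0 (pure_tensor _ _ _)) raddf0 mul1r.
by rewrite /gen psiE /= /h map_delta_mx -rowE !mxE => <-.
Qed.
End Base.

(** Over a division ring the kernel is trivial exactly when the module with relation matrix [Q]
    becomes 0 after tensoring. The universal inequality passes dimension 0 from [E] to [D]. *)
Lemma universal_trivial_kernel (E : unitRingType) (f : {rmorphism R -> E}) :
  division_ring E -> trivial_kernel (map_mx f Q) -> trivial_kernel (map_mx iota Q).
Proof.
move=> hE kerQ v Qv; have [G GQ] := kernel_left_inverse hE kerQ.
have [hdiv _ _ huniv] := hD.
have T0 := tensor_coker0 GQ.
have dimE : has_dim (tensor f M) 0.
  exists (fun=> 0) => w; exists 0; split; first by rewrite big_ord0; apply: T0.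
  by move=> c _; apply/rowP=> -[].
have [p dimD] := finite_spanning_has_dim hdiv (@tensor_coker_span D iota).
have := huniv _ _ hE _ M_presented _ _ dimD dimE.
rewrite leqn0 => /eqP p0; rewrite p0 in dimD.
apply: (tensor_coker_kernel Qv) => x; case: dimD => e /(_ x)[c [-> _]].
by rewrite big_ord0.
Qed.
End Universality.

(** * Free groups, cocycles and group algebras *)

(* The affine group of A: (u, u', x) stands for y |-> x + u y, with u' = u^-1. *)
Section AffineGroup.
Variable A : nzRingType.

Definition is_affine (p : A * A * A) := (p.1.1 * p.1.2 == 1) && (p.1.2 * p.1.1 == 1).
Definition affine : Type := {p : A * A * A | is_affine p}.
HB.instance Definition _ := SubChoice.on affine.

Implicit Types g h : affine.

Fact affine_one_subproof : is_affine (1, 1, 0).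
Proof. by rewrite /is_affine /= mulr1 eqxx. Qed.
Fact affine_mul_subproof g h : is_affine
  ((val g).1.1 * (val h).1.1, (val h).1.2 * (val g).1.2, (val g).2 + (val g).1.1 * (val h).2).
Proof.
case: g h => [[[u u'] x] /= /andP[/= /eqP ug /eqP gu]] [[[v v'] y] /= /andP[/= /eqP vh /eqP hv]].
by rewrite /is_affine /= !mulrA -(mulrA u) vh mulr1 ug -(mulrA v') gu mulr1 hv !eqxx.
Qed.
Fact affine_inv_subproof g : is_affine ((val g).1.2, (val g).1.1, - ((val g).1.2 * (val g).2)).
Proof. by case: g => [[[u u'] x] /= /andP[/= ug gu]]; apply/andP. Qed.

Definition affine_one : affine := Sub _ affine_one_subproof.
Definition affine_mul g h : affine := Sub _ (affine_mul_subproof g h).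
Definition affine_inv g : affine := Sub _ (affine_inv_subproof g).

Fact affine_mulA : associative affine_mul.
Proof. by move=> g h k; apply: val_inj; rewrite /= mulrDr !mulrA addrA. Qed.
Fact affine_mul1 : left_id affine_one affine_mul.
Proof.
by move=> g; apply: val_inj; rewrite /= !mul1r mulr1 add0r; case: g => [[[]]].
Qed.
Fact affine_mulr1 : right_id affine_one affine_mul.
Proof.
by move=> g; apply: val_inj; rewrite /= mulr0 mulr1 mul1r addr0; case: g => [[[]]].
Qed.
Fact affine_mulV : left_inverse affine_one affine_inv affine_mul.
Proof.
move=> g; apply: val_inj; case: g => [[[u u'] x] /= /andP[/= /eqP ug /eqP gu]].
by rewrite gu addNr.
Qed.
Fact affine_mulVr : right_inverse affine_one affine_inv affine_mul.
Proof.
move=> g; apply: val_inj; case: g => [[[u u'] x] /= /andP[/= /eqP ug /eqP gu]].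
by rewrite ug mulrN mulrA ug mul1r subrr.
Qed.
HB.instance Definition _ := isGroup.Build affine
  affine_mulA affine_mul1 affine_mulr1 affine_mulV affine_mulVr.

Definition affine_lin g : A := (val g).1.1.
Definition affine_tr g : A := (val g).2.

End AffineGroup.

Section FreeGroup.
Variables (F : groupType) (B : {pred F}).
Hypothesis hB : free_basis B.

Definition group_hom (A : nzRingType) (phi : F -> A) :=
  phi 1%g = 1 /\ {morph phi : g h / (g * h)%g >-> g * h}.
Definition cocycle (A : nzRingType) (phi : F -> A) (d : F -> A) :=
  forall g h, d (g * h)%g = d g + phi g * d h.

Lemma group_homV (A : nzRingType) (phi : F -> A) g : group_hom phi ->
  phi g * phi g^-1%g = 1 /\ phi g^-1%g * phi g = 1.
Proof. by case=> phi1 phiM; rewrite -!phiM mulgV mulVg. Qed.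

Lemma cocycle1 (A : nzRingType) (phi d : F -> A) : group_hom phi -> cocycle phi d -> d 1%g = 0.
Proof.
move=> [phi1 _] dM; apply: (addrI (d 1%g)).
by have := dM 1%g 1%g; rewrite mulg1 phi1 mul1r addr0.
Qed.

Lemma cocycleV (A : nzRingType) (phi d : F -> A) g : group_hom phi -> cocycle phi d ->
  d g^-1%g = - (phi g^-1%g * d g).
Proof.
move=> hphi dM; apply/eqP; rewrite -addr_eq0 -dM mulVg.
by rewrite (cocycle1 hphi dM).
Qed.

Lemma free_hom (A : nzRingType) (v : F -> A) :
  {in B, forall b, exists w, v b * w = 1 /\ w * v b = 1} ->
  exists2 phi : F -> A, group_hom phi & {in B, phi =1 v}.
Proof.
move=> vB.
have /choice [f hf] : forall b, exists a : affine A, b \in B -> affine_lin a = v b.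
  move=> b; case: (boolP (b \in B)) => [/vB[w [vw wv]]|_]; last by exists 1%g.
  have h : is_affine (v b, w, 0) by rewrite /is_affine /= vw wv !eqxx.
  by exists (Sub _ h).
have [phi [phiB _]] := hB f.
exists (fun g => affine_lin (phi g)); last by move=> b Bb; rewrite /= phiB // hf.
split=> [|g h]; last by rewrite gmulfM.
have : phi 1%g = 1%g by apply: (mulgI (phi 1%g)); rewrite -gmulfM !mulg1.
by move=> ->.
Qed.

(** A cocycle for [phi] is the translation part of a homomorphism into the affine group with linear
    part [phi], and such a homomorphism can be prescribed on [B]. *)
Lemma free_cocycle (A : nzRingType) (phi c : F -> A) : group_hom phi ->
  exists2 d : F -> A, cocycle phi d & {in B, d =1 c}.
Proof.
move=> hphi; have hV g := group_homV g hphi.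
have aff g x : is_affine (phi g, phi g^-1%g, x).
  by case: (hV g) => h1 h2; rewrite /is_affine /= h1 h2 !eqxx.
have [psi [psiB _]] := hB (fun g => Sub _ (aff g (c g)) : affine A).
pose lin0 (a : affine A) : affine A := insubd (affine_one A) ((val a).1, 0).
have lin0E a : val (lin0 a) = ((val a).1, 0).
  by rewrite insubdK //; case: a => [[[u u'] x] h].
have lin0M : {morph lin0 : a b / (a * b)%g}.
  by move=> a b; apply: val_inj; rewrite lin0E /= !lin0E /= mulr0 addr0.
pose phi' g : affine A := Sub _ (aff g 0).
have phi'M : {morph phi' : a b / (a * b)%g}.
  case: hphi => _ phiM a b; apply: val_inj; rewrite /= mulr0 addr0 invgM.
  by rewrite !phiM.
have psiM : {morph (lin0 \o psi) : a b / (a * b)%g} by move=> a b; rewrite /= gmulfM lin0M.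
pose p1 : {multiplicative F -> affine A} := HB.pack phi' (monoid.isMultiplicative.Build _ _ phi' phi'M).
pose p2 : {multiplicative F -> affine A} :=
  HB.pack (lin0 \o psi) (monoid.isMultiplicative.Build _ _ (lin0 \o psi) psiM).
(* Both [phi] and the linear part of [psi] are homomorphisms; they agree on [B], hence
   everywhere. *)
have p12 : p1 =1 p2.
  have [theta [_ uniq_th]] := hB phi'.
  have p2B : {in B, p2 =1 phi'} by move=> b Bb; apply: val_inj; rewrite /= lin0E psiB.
  by move=> g; rewrite (uniq_th p1) // (uniq_th p2).
have psi1 g : (val (psi g)).1.1 = phi g.
  by have := congr1 (fun a : affine A => (val a).1.1) (p12 g); rewrite /= lin0E /= => <-.
exists (fun g => affine_tr (psi g)) => [g h|b Bb]; last by rewrite /= psiB.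
by rewrite gmulfM /affine_tr /= psi1.
Qed.

Definition letter_eval (l : F * bool) : F := if l.2 then l.1 else (l.1^-1)%g.
Definition word_eval (w : seq (F * bool)) : F := foldr (fun l g => (letter_eval l * g)%g) 1%g w.

Lemma word_eval_cat w1 w2 : word_eval (w1 ++ w2) = (word_eval w1 * word_eval w2)%g.
Proof. by elim: w1 => [|l w1 IH] /=; rewrite ?mul1g // IH mulgA. Qed.

Definition word_group : {pred F} :=
  fun g => `[< exists2 w, {in w, forall l, l.1 \in B} & g = word_eval w >].

Fact word_group_closed : group_closed word_group.
Proof.
split; first by apply/asboolP; exists [::].
move=> g h /asboolP[w1 w1B ->] /asboolP[w2 w2B ->]; apply/asboolP.
exists (w1 ++ rev [seq (l.1, ~~ l.2) | l <- w2]).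
  move=> l; rewrite mem_cat mem_rev => /orP[/w1B//|/mapP[l' /w2B Bl' ->]//].
rewrite word_eval_cat; congr (_ * _)%g; elim: w2 {w2B} => [|l w2 IH] /=; first by rewrite invg1.
rewrite rev_cons -cats1 word_eval_cat invgM IH /= mulg1; congr (_ * _)%g.
by rewrite /letter_eval /=; case: l.2; rewrite /= ?invgK.
Qed.

Definition word_subgroup : Type := {g : F | word_group g}.
HB.instance Definition _ := SubChoice.on word_subgroup.
HB.instance Definition _ := SubChoice_isSubGroup.Build F word_group word_subgroup word_group_closed.

(** The homomorphism from [F] to the subgroup of words that fixes [B], followed by the inclusion, is
    the identity by uniqueness. *)
Lemma free_group_word g : exists2 w, {in w, forall l, l.1 \in B} & g = word_eval w.
Proof.
apply/asboolP; have Bw b : b \in B -> word_group b.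
  move=> Bb; apply/asboolP; exists [:: (b, true)]; last by rewrite /= mulg1.
  by move=> l; rewrite inE => /eqP ->.
have [phi [phiB _]] := hB (fun b => insubd (1%g : word_subgroup) b).
pose i (x : word_subgroup) : F := val x.
have iM : {morph (i \o phi) : a b / (a * b)%g}.
  by move=> a b; rewrite -[LHS]/(val (phi (a * b)%g)) gmulfM monoid.valM.
pose p : {multiplicative F -> F} := HB.pack (i \o phi) (monoid.isMultiplicative.Build _ _ (i \o phi) iM).
have idM : {morph (@id F) : a b / (a * b)%g} by [].
pose q : {multiplicative F -> F} := HB.pack (@id F) (monoid.isMultiplicative.Build _ _ (@id F) idM).
have [theta [_ uniq_th]] := hB (@id F).
have -> : g = p g.
  rewrite (uniq_th p) => [|b Bb]; first by rewrite -(uniq_th q).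
  by rewrite /= phiB // /i insubdK //; apply: Bw.
exact: (valP (phi g)).
Qed.

End FreeGroup.

Section LinearExtension.
Variables (K : nzRingType) (F : groupType) (A : nzRingType) (kap : {rmorphism K -> A}).
Local Notation R := (group_algebra K F).
Implicit Types (d phi : F -> A) (x y : R).

Definition glin d x : A := \sum_(g <- msupp x) kap x@_g * d g.

Lemma glinw d (X : {fset F}) x : (msupp x `<=` X)%fset ->
  glin d x = \sum_(g <- X) kap x@_g * d g.
Proof.
move=> le; apply: (big_fset_incl _ le) => g _ /mcoeff_outdom ->.
by rewrite rmorph0 mul0r.
Qed.

Lemma glinD d : {morph glin d : x y / x + y}.
Proof.
move=> x y; rewrite (glinw d (msuppD_le x y)).
rewrite (glinw d (fsubsetUl (msupp x) (msupp y))).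
rewrite (glinw d (fsubsetUr (msupp x) (msupp y))) -big_split /=.
by apply: eq_bigr => g _; rewrite mcoeffD rmorphD mulrDl.
Qed.

Lemma glinU d c g : glin d << c *g g >> = kap c * d g.
Proof. by rewrite (glinw d msuppU_le) big_seq_fset1 mcoeffUU. Qed.

Lemma glin0 d : glin d 0 = 0.
Proof. by rewrite /glin msupp0 big_seq_fset0. Qed.

Lemma glin_zmod d : zmod_morphism (glin d).
Proof. by move=> x y; apply: (addIr (glin d y)); rewrite -glinD !subrK. Qed.
HB.instance Definition _ d := GRing.isZmodMorphism.Build R A (glin d) (glin_zmod d).

Hypothesis kapC : forall c a, kap c * a = a * kap c.

Lemma glin_monoid phi : group_hom phi -> monoid_morphism (glin phi).
Proof.
move=> [phi1 phiM]; split; first by rewrite glinU rmorph1 mul1r.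
move=> x y; elim/ga_ind: x => [|x x' hx hx'|a k].
- by rewrite mul0r glin0 mul0r.
- by rewrite mulrDl !glinD mulrDl hx hx'.
elim/ga_ind: y => [|y y' hy hy'|b l].
- by rewrite mulr0 glin0 mulr0.
- by rewrite mulrDr !glinD mulrDr hy hy'.
rewrite [_ * _ in LHS]gamulUU !glinU rmorphM phiM -!mulrA; congr (_ * _).
by rewrite !mulrA -(kapC b).
Qed.

Lemma group_algebra_morphism phi : group_hom phi ->
  exists f : {rmorphism R -> A}, forall c g, f << c *g g >> = kap c * phi g.
Proof.
move=> hphi; pose f : {rmorphism R -> A} := HB.pack (glin phi)
  (GRing.isMonoidMorphism.Build R A (glin phi) (glin_monoid hphi)).
by exists f => c g; rewrite /= glinU.
Qed.

(** This is the product rule of Fox calculus. *)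
Lemma glin_cocycle phi d x y : group_hom phi -> cocycle phi d ->
  glin d (x * y) = glin d x * kap (augmentation y) + glin phi x * glin d y.
Proof.
move=> hphi dM; elim/ga_ind: x => [|x x' hx hx'|a k].
- by rewrite mul0r !glin0 !mul0r addr0.
- by rewrite mulrDl !glinD hx hx' !mulrDl addrACA.
elim/ga_ind: y => [|y y' hy hy'|b l].
- by rewrite mulr0 augmentation0 rmorph0 !glin0 !mulr0 addr0.
- by rewrite mulrDr augmentationD rmorphD !glinD hy hy' !mulrDr addrACA.
rewrite [_ * _ in LHS]gamulUU augmentationU !glinU rmorphM dM mulrDr -!mulrA; congr (_ * _ + _ * _).
  by rewrite kapC.
by rewrite !mulrA -(kapC b).
Qed.

End LinearExtension.

Section GroupAlgebraUnits.
Variables (K : nzRingType) (F : groupType).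
Definition gconst (c : K) : group_algebra K F := << c *g 1%g >>.
Fact gconst_zmod : zmod_morphism gconst.
Proof. by move=> x y; rewrite /gconst monalgUB. Qed.
Fact gconst_monoid : monoid_morphism gconst.
Proof. by split=> // x y; rewrite /gconst [RHS]gamulUU mulg1. Qed.
HB.instance Definition _ := GRing.isZmodMorphism.Build K (group_algebra K F) gconst gconst_zmod.
HB.instance Definition _ := GRing.isMonoidMorphism.Build K (group_algebra K F) gconst gconst_monoid.

Definition gelt (g : F) : group_algebra K F := << 1 *g g >>.
Lemma gelt_hom : group_hom gelt.
Proof. by split=> // g h; rewrite /gelt [RHS]gamulUU mulr1. Qed.
Lemma gelt_const c g : gconst c * gelt g = << c *g g >>.
Proof. by rewrite [LHS]gamulUU mulr1 mul1g. Qed.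
End GroupAlgebraUnits.

Lemma F2_cases (c : 'F_2) : c = 0 \/ c = 1.
Proof. by case: c => [[|[|c]] hc] //; [left|right]; apply: val_inj. Qed.

(** A homomorphism from the group algebra prescribed on [B] requires the scalars to be central in
    the target; for F_2 this holds in every ring. *)
Lemma F2_central (A : nzRingType) (kap : {rmorphism 'F_2 -> A}) c a : kap c * a = a * kap c.
Proof.
by case: (F2_cases c) => ->; rewrite ?rmorph0 ?rmorph1 ?mul0r ?mulr0 ?mul1r ?mulr1.
Qed.

Lemma eq_pev (K : fieldType) n (A : nzRingType) (kap kap' : {rmorphism K -> A})
    (X X' : 'I_n -> A) k N (Q : pencil K n k N) :
  kap =1 kap' -> X =1 X' -> pev kap X Q = pev kap' X' Q.
Proof.
move=> e1 e2; rewrite /pev /plin; congr (_ + _); first exact: eq_map_mx.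
by apply: eq_bigr => i _; rewrite e2; congr (_ *: _); apply: eq_map_mx.
Qed.

(** As [F] is free, nonzero values at the [b i] extend to a ring homomorphism from the group algebra
    to [E]; on the other basis elements it is taken to be the embedding through [D]. The pencil
    evaluated at the group elements [b i] is one matrix over the group algebra, whose images in [E]
    and [D] are compared. *)
Lemma universal_maximal_point (F : groupType) (B : {pred F}) (hB : free_basis B)
    (D : unitRingType) (iota : {rmorphism group_algebra 'F_2 F -> D})
    (hD : universal_division_ring_of_fractions iota) n (b : 'I_n -> F) :
  injective b -> (forall i, b i \in B) ->
  maximal_point (iota \o @gconst 'F_2 F) (fun i => iota (gelt 'F_2 (b i))).
Proof.
move=> bI bB E j X hE X0 k N Q kerQ.
pose v g := if [pick i | b i == g] is Some i then X i else j (iota (gelt 'F_2 g)).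
have vinv : {in B, forall g, exists w, v g * w = 1 /\ w * v g = 1}.
  move=> g _; exists (v g)^-1; suff uv : v g \is a GRing.unit by rewrite mulrV ?mulVr.
  rewrite /v; case: pickP => [i _|_]; first exact: hE.
  apply/unitrP; exists (j (iota (gelt 'F_2 g^-1%g))).
  have [h1 h2] := group_homV g (gelt_hom 'F_2 F).
  by rewrite -!rmorphM h1 h2 !rmorph1.
have [phi hphi phiB] := free_hom hB vinv.
have [f fE] := group_algebra_morphism (F2_central (j \o (iota \o @gconst 'F_2 F))) hphi.
have vb i : v (b i) = X i.
  rewrite /v; case: pickP => [i' /eqP/bI -> //|/(_ i)].
  by rewrite eqxx.
pose QR := pev (@gconst 'F_2 F) (fun i => gelt 'F_2 (b i)) Q.
have := @universal_trivial_kernel _ _ _ hD _ _ QR E f hE.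
rewrite !map_pev; apply.
rewrite (@eq_pev _ _ _ _ (j \o (iota \o @gconst 'F_2 F)) _ X) // => [c|i] /=.
  by rewrite fE hphi.1 mulr1.
by rewrite fE rmorph1 mul1r phiB // vb.
Qed.

(** * The pencil of cocycle equations on a finite set *)

Section TreePencil.
Variables (K : fieldType) (F : groupType) (bs S hs : seq F).
Local Notation n := (size bs).
Local Notation N := (size S).
Local Notation b := (fun i : 'I_n => nth 1%g bs i).
Local Notation s := (fun k : 'I_N => nth 1%g S k).

(* The rows of the pencil are the equations v(c) = v(b) + b v(g) for c = b g and
   v(g) = 0 for g in 1 :: hs, in the unknowns v(g), g in S. *)
Definition tree_row : finType := ('I_n * 'I_N * 'I_N * 'I_N + 'I_N)%type.
Definition valid_edge i kb kg kc := (s kb == b i) && (s kc == (b i * s kg)%g).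
Definition valid_zero k := s k \in 1%g :: hs.

(** All quadruples of positions index rows; one that is not an edge gives the zero row. *)
Definition tree_pc (t : tree_row) : 'rV[K]_N :=
  match t with
  | inl (i, kb, kg, kc) => if valid_edge i kb kg kc then delta_mx 0 kc - delta_mx 0 kb else 0
  | inr k => if valid_zero k then delta_mx 0 k else 0
  end.
Definition tree_pl i' (t : tree_row) : 'rV[K]_N :=
  match t with
  | inl (i, kb, kg, kc) => if valid_edge i kb kg kc && (i == i') then - delta_mx 0 kg else 0
  | inr k => 0
  end.
Definition tree_pencil : pencil K n #|tree_row| N :=
  Pencil (\matrix_r tree_pc (enum_val r)) (fun i => \matrix_r tree_pl i (enum_val r)).

Variables (A : nzRingType) (kap : {rmorphism K -> A}).

Definition tree_val0 (v : 'cV[A]_N) (t : tree_row) : A :=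
  match t with
  | inl (i, kb, kg, kc) => if valid_edge i kb kg kc then v kc 0 - v kb 0 else 0
  | inr k => if valid_zero k then v k 0 else 0
  end.
Definition tree_vall i' (v : 'cV[A]_N) (t : tree_row) : A :=
  match t with
  | inl (i, kb, kg, kc) => if valid_edge i kb kg kc && (i == i') then - v kg 0 else 0
  | inr k => 0
  end.

Let mul_delta k (v : 'cV[A]_N) : (map_mx kap (delta_mx 0 k) *m v) = (v k 0)%:M.
Proof. by rewrite map_delta_mx -rowE; apply/matrixP=> i j; rewrite !mxE !ord1. Qed.

Lemma tree_pcE v r : (map_mx kap (pc tree_pencil) *m v) r 0 = tree_val0 v (enum_val r).
Proof.
transitivity ((map_mx kap (tree_pc (enum_val r)) *m v) 0 0).
  by rewrite !mxE; apply: eq_bigr => k _; rewrite !mxE.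
case: (enum_val r) => [[[[i kb] kg] kc]|k] /=.
  case: ifP => _; last by rewrite map_mx0 mul0mx mxE.
  by rewrite map_mxB mulmxBl !mul_delta !mxE.
case: ifP => _; last by rewrite map_mx0 mul0mx mxE.
by rewrite mul_delta mxE.
Qed.

Lemma tree_plE i v r : (map_mx kap (pl tree_pencil i) *m v) r 0 = tree_vall i v (enum_val r).
Proof.
transitivity ((map_mx kap (tree_pl i (enum_val r)) *m v) 0 0).
  by rewrite !mxE; apply: eq_bigr => k _; rewrite !mxE.
case: (enum_val r) => [[[[i' kb] kg] kc]|k] /=; last by rewrite map_mx0 mul0mx mxE.
case: ifP => _; last by rewrite map_mx0 mul0mx mxE.
by rewrite map_mxN mulNmx mul_delta !mxE.
Qed.

Lemma tree_evalE (X : 'I_n -> A) (v : 'cV[A]_N) r :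
  (pev kap X tree_pencil *m v) r 0 =
  match enum_val r with
  | inl (i, kb, kg, kc) => if valid_edge i kb kg kc then v kc 0 - (v kb 0 + X i * v kg 0) else 0
  | inr k => if valid_zero k then v k 0 else 0
  end.
Proof.
have -> : (pev kap X tree_pencil *m v) r 0 =
    tree_val0 v (enum_val r) + \sum_i X i * tree_vall i v (enum_val r).
  rewrite /pev mulmxDl mxE tree_pcE; congr (_ + _); rewrite mulmx_suml summxE.
  by apply: eq_bigr => i _; rewrite -scalemxAl mxE tree_plE.
case: (enum_val r) => [[[[i kb] kg] kc]|k] /=; last first.
  by rewrite big1 ?addr0 // => i _; rewrite mulr0.
case: (boolP (valid_edge i kb kg kc)) => [vi|_]; last first.
  by rewrite big1 ?addr0 // => i' _; rewrite mulr0.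
rewrite (bigD1 i) //= eqxx mulrN big1 ?addr0 ?opprD ?addrA // => i' i'i.
by rewrite eq_sym (negbTE i'i) mulr0.
Qed.

Lemma tree_solP (X : 'I_n -> A) (v : 'cV[A]_N) :
  pev kap X tree_pencil *m v = 0 <->
  (forall i kb kg kc, valid_edge i kb kg kc -> v kc 0 = v kb 0 + X i * v kg 0) /\
  (forall k, valid_zero k -> v k 0 = 0).
Proof.
split=> [Av|[he hz]].
  split=> [i kb kg kc vi|k vk].
    have := tree_evalE X v (enum_rank (inl (i, kb, kg, kc) : tree_row)).
    by rewrite Av enum_rankK mxE vi => /esym/eqP; rewrite subr_eq0 => /eqP.
  have := tree_evalE X v (enum_rank (inr k : tree_row)).
  by rewrite Av enum_rankK mxE vk.
apply/colP=> r; rewrite tree_evalE mxE; case: (enum_val r) => [[[[i kb] kg] kc]|k].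
  by case: ifP => // /he ->; rewrite subrr.
by case: ifP => // /hz.
Qed.

End TreePencil.

(** * The unipotent deformation *)

Section UnipotentDeformation.
Variables (F : groupType) (B : {pred F}) (hB : free_basis B).
Variables (D : unitRingType) (hD : division_ring D) (bt : F -> D).
Local Notation idm := (idfun : {rmorphism D -> D}).
Local Notation PS := (spow idm).
Local Notation z := (spX idm).

Definition unipotent (c : D) : PS := 1 + spC idm (c - 1) * z.

Lemma unipotentM c (f : PS) k :
  (unipotent c * f) k = f k + (if k is k'.+1 then (c - 1) * f k' else 0).
Proof.
rewrite mulrDl mul1r spD -mulrA spCM spXM; case: k => [|k] //.
by rewrite mulr0.
Qed.

Lemma unipotent_hom : exists2 fs : F -> PS, group_hom fs & {in B, forall b, fs b = unipotent (bt b)}.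
Proof.
apply: (free_hom hB) => b _; apply: spow_unit => //.
by rewrite /unipotent spD spM0 mulr0 addr0 sp1 oner_neq0.
Qed.

Variables (fs : F -> PS) (hfs : group_hom fs) (fsB : {in B, forall b, fs b = unipotent (bt b)}).
Variable H : {pred F}.

Definition unipotent_cocycle (d : F -> PS) := cocycle fs d /\ {in H, forall h, d h = 0}.

Lemma unipotent_cocycle_shift d b g k : unipotent_cocycle d -> b \in B ->
  d (b * g)%g k = d b k + d g k + (if k is k'.+1 then (bt b - 1) * d g k' else 0).
Proof. by case=> dM _ Bb; rewrite dM fsB // spD unipotentM addrA. Qed.

(* Polynomials in the coefficients of unipotent cocycles, graded so that the
   difference operators P(b _) - P lower the weight. *)
Inductive cocycle_poly : nat -> (F -> D) -> Prop :=
| CPconst N c : cocycle_poly N (fun=> c)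
| CPadd N P Q : cocycle_poly N P -> cocycle_poly N Q -> cocycle_poly N (fun g => P g + Q g)
| CPscale N a P : cocycle_poly N P -> cocycle_poly N (fun g => a * P g)
| CPmul N d j P : unipotent_cocycle d -> cocycle_poly N P ->
    cocycle_poly (N + j).+1 (fun g => d g j * P g).

Lemma cocycle_polyW N N' P : (N <= N')%N -> cocycle_poly N P -> cocycle_poly N' P.
Proof.
move=> NN' h; elim: h N' NN' => {N P} [N c|N P Q _ IH1 _ IH2|N a P _ IH|N d j P hd _ IH] N' NN'.
- exact: CPconst.
- by apply: CPadd; [apply: IH1|apply: IH2].
- by apply: CPscale; apply: IH.
have -> : N' = ((N' - j.+1) + j).+1 by rewrite -addnS subnK // (leq_trans _ NN') // ltnS leq_addl.
by apply: CPmul => //; apply: IH; rewrite leq_subRL ?addSn 1?addnC // (leq_trans _ NN') // ltnS leq_addl.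
Qed.

(** The coefficient d_j counts for weight j + 1, and translation by [b] changes it by a constant and
    a multiple of d_(j-1), of weight j. In weight 0 there are only constants and the difference is
    0, which membership in weight [N.-1] does not express; hence the extra condition on [Q]. *)
Lemma cocycle_poly_shift N P b : cocycle_poly N P -> b \in B ->
  exists2 Q, cocycle_poly N.-1 Q /\ (N = 0%N -> forall g, Q g = 0) &
    forall g, P (b * g)%g = P g + Q g.
Proof.
move=> h Bb; elim: h => {N P} [N c|N P P' _ [Q [hQ Q0] QE] _ [Q' [hQ' Q0'] QE']|
    N a P _ [Q [hQ Q0] QE]|N d j P hd hP [Q [hQ Q0] QE]].
- exists (fun=> 0) => [|g]; last by rewrite addr0.
  by split=> //; apply: CPconst.
- exists (fun g => Q g + Q' g) => [|g]; last by rewrite QE QE' addrACA.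
  split; first exact: CPadd.
  by move=> N0 g; rewrite Q0 // Q0' // addr0.
- exists (fun g => a * Q g) => [|g]; last by rewrite QE mulrDr.
  split; first exact: CPscale.
  by move=> N0 g; rewrite Q0 // mulr0.
have hPQ : cocycle_poly N (fun g => P g + Q g).
  by apply: CPadd => //; apply: cocycle_polyW hQ; apply: leq_pred.
exists (fun g => d b j * (P g + Q g) +
   (if j is j'.+1 then (bt b - 1) * (d g j' * (P g + Q g)) else 0) + d g j * Q g); last first.
  move=> g; rewrite (unipotent_cocycle_shift _ _ hd Bb) QE !mulrDl.
  have -> : (if j is j'.+1 then (bt b - 1) * d g j' else 0) * (P g + Q g) =
      if j is j'.+1 then (bt b - 1) * (d g j' * (P g + Q g)) else 0.
    by case: j => [|j]; rewrite ?mul0r ?mulrA.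
  rewrite [d g j * (P g + Q g)]mulrDr addrCA -!addrA; congr (_ + (_ + _)).
  by rewrite addrC.
split=> //=; apply: CPadd; first apply: CPadd.
- by apply: CPscale; apply: cocycle_polyW hPQ; apply: leq_addr.
- case: j => [|j]; first exact: CPconst.
  by rewrite addnS; apply: CPscale; apply: CPmul.
case: N {hP hPQ} hQ Q0 => [|N] hQ Q0.
  have -> : (fun g => d g j * Q g) = (fun=> 0) by apply/funext=> g; rewrite Q0 // mulr0.
  exact: CPconst.
by rewrite addSn; apply: CPmul.
Qed.

Variables (K : fieldType) (kap : {rmorphism K -> D}).
Hypothesis kapC : forall c x, kap c * x = x * kap c.
Variables (bs S hs : seq F).
Hypothesis bsB : {subset bs <= B}.
Hypothesis hsH : {subset hs <= H}.
Local Notation n := (size bs).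
Local Notation N := (size S).
Local Notation b := (fun i : 'I_n => nth 1%g bs i).
Local Notation s := (fun k : 'I_N => nth 1%g S k).
Local Notation beta := (fun i : 'I_n => bt (b i)).
Local Notation J := (tree_pencil K bs S hs).

Definition tree_vec (P : F -> D) : 'cV[D]_N := \col_k P (s k).

Section Saturated.
Variable U : 'cV[D]_N -> Prop.
Hypothesis UD : forall u v, U u -> U v -> U (u + v).
Hypothesis UM : forall u (c : 'M[D]_1), U u -> U (u *m c).
Hypothesis UZ : forall (a : D) u, U u -> U (a *: u).
Hypothesis Uker : forall v, pev kap beta J *m v = 0 -> U v.
Hypothesis Upl : forall i u, U u -> exists2 u', U u' &
  map_mx kap (pl J i) *m u = pev kap beta J *m u'.

Let good P := U (tree_vec P).
Let goodE P Q : P =1 Q -> good P -> good Q.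
Proof. by move=> PQ; rewrite (funext PQ). Qed.
Let goodD P Q : good P -> good Q -> good (fun g => P g + Q g).
Proof.
move=> hP hQ; have := UD hP hQ; rewrite /good; congr U.
by apply/colP=> k; rewrite !mxE.
Qed.
Let goodZ a P : good P -> good (fun g => a * P g).
Proof.
move=> hP; have := UZ a hP; rewrite /good; congr U.
by apply/colP=> k; rewrite !mxE.
Qed.
Let good0 : good (fun=> 0).
Proof. by apply: Uker; rewrite (_ : tree_vec _ = 0) ?mulmx0 //; apply/colP=> k; rewrite !mxE. Qed.

Let W (x : 'cV[D]_#|tree_row bs S|) := exists2 u, U u & x = pev kap beta J *m u.

Let Wsum (psi : 'I_n -> 'cV[D]_N) : (forall i, U (psi i)) ->
  W (\sum_i map_mx kap (pl J i) *m psi i).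
Proof.
move=> hpsi; apply: (big_ind W) => [|_ _ [u Uu ->] [v Uv ->]|i _]; last exact: Upl.
  by exists 0; [apply: Uker|]; rewrite mulmx0.
by exists (u + v); [exact: UD|rewrite mulmxDr].
Qed.

(** The tree pencil at the point 1 + (beta - 1) z is [const_part] plus z times [lin_part]. *)
Let lin_part : 'M[D]_(_, N) := plin kap (fun i => beta i - 1) J.
Let const_part : 'M[D]_(_, N) := map_mx kap (pc J) + plin kap (fun=> 1) J.

Let partsE : const_part + lin_part = pev kap beta J.
Proof.
rewrite -addrA; congr (_ + _); rewrite /lin_part /plin -big_split; apply: eq_bigr => i _ /=.
by rewrite -scalerDl addrC subrK.
Qed.

Let Ulin u : U u -> exists2 u', U u' & lin_part *m u = (const_part + lin_part) *m u'.
Proof.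
move=> Uu; rewrite partsE /lin_part mulmx_suml.
have -> : \sum_i (beta i - 1) *: map_mx kap (pl J i) *m u =
    \sum_i map_mx kap (pl J i) *m ((beta i - 1) *: u).
  by apply: eq_bigr => i _; rewrite map_scalar_mul.
by apply: Wsum => i; apply: UZ.
Qed.

Let val_sum (psi : 'I_n -> 'cV[D]_N) r :
  (\sum_i map_mx kap (pl J i) *m psi i) r 0 = \sum_i tree_vall i (psi i) (enum_val r).
Proof. by rewrite summxE; apply: eq_bigr => i _; rewrite tree_plE. Qed.

Let good_diff M P : (forall M' P', (M' < M)%N -> cocycle_poly M' P' ->
    forall d j, unipotent_cocycle d -> good (fun g => d g j * P' g)) ->
  cocycle_poly M P -> good (fun g => P g - P 1%g).
Proof.
move=> IH hP; elim: hP IH => {M P} [M c|M P Q _ IH1 _ IH2|M a P _ IH1|M d j P hd hP _] IH.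
- by apply: goodE good0 => g; rewrite subrr.
- by apply: goodE (goodD (IH1 IH) (IH2 IH)) => g; rewrite opprD addrACA.
- by apply: goodE (goodZ a (IH1 IH)) => g; rewrite mulrBr.
have lt : (M < (M + j).+1)%N by rewrite ltnS leq_addr.
apply: goodE (IH M P lt hP d j hd) => g.
by rewrite (cocycle1 hfs hd.1) sp0 mul0r subr0.
Qed.

(* The coefficient vectors of d P satisfy, up to terms of lower weight, the same
   recursion as those of d, so that [shift_seqP] applies. *)
Lemma good_poly M P : cocycle_poly M P ->
  good (fun g => P g - P 1%g) /\
  forall d j, unipotent_cocycle d -> good (fun g => d g j * P g).
Proof.
elim/ltn_ind: M P => M IH P hP.
have IH2 M' P' : (M' < M)%N -> cocycle_poly M' P' ->
    forall d j, unipotent_cocycle d -> good (fun g => d g j * P' g).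
  by move=> lt /(IH _ lt) [].
split=> [|d j hd]; first exact: good_diff IH2 hP.
have /choice [Q hQ] : forall i, exists Q, [/\ cocycle_poly M.-1 Q, (M = 0%N -> forall g, Q g = 0) &
    forall g, P (b i * g)%g = P g + Q g].
  move=> i; have [|Q [h1 h2] h3] := cocycle_poly_shift hP (b := b i).
    exact/bsB/mem_nth.
  by exists Q.
have goodQ i d' j' : unipotent_cocycle d' -> good (fun g => d' g j' * Q i g).
  move=> hd'; case: (hQ i) => h1 h2 _; case: (posnP M) => [M0|M0].
    by apply: goodE good0 => g; rewrite h2 // mulr0.
  by apply: IH2 h1 _ _ hd'; rewrite ltn_predL.
(* [R i k g] is the defect of q_k(g) = d(g)_k P(g) in the cocycle recursion: q_k(b g) - q_k(b) -
   q_k(g) - (beta - 1) q_(k-1)(g). Each of its terms is good, either by lower weight or as a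
   difference P' - P'(1). *)
pose R i k g := d (b i) k * (P (b i * g)%g - P (b i * 1)%g) + d g k * Q i g +
   (if k is k'.+1 then (beta i - 1) * (d g k' * Q i g) else 0).
have goodR i k : good (R i k).
  apply: goodD; first apply: goodD.
  - apply: goodZ; case: (hQ i) => h1 _ h3.
    have hPb : cocycle_poly M (fun g => P g + Q i g).
      by apply: CPadd => //; apply: cocycle_polyW h1; apply: leq_pred.
    by apply: goodE (good_diff IH2 hPb) => g; rewrite !h3.
  - exact: goodQ.
  by case: k => [|k]; [exact: good0|apply/goodZ/goodQ].
pose q k := tree_vec (fun g => d g k * P g).
have Wrow k : W (const_part *m q k + (if k is k'.+1 then lin_part *m q k' else 0)).
  suff -> : const_part *m q k + (if k is k'.+1 then lin_part *m q k' else 0) =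
      \sum_i map_mx kap (pl J i) *m tree_vec (fun g => - R i k g).
    by apply: Wsum => i; apply: goodE (goodZ (-1) (goodR i k)) => g; rewrite mulN1r.
  apply/colP=> r; rewrite val_sum.
  have -> : (const_part *m q k + (if k is k'.+1 then lin_part *m q k' else 0)) r 0 =
      tree_val0 hs (q k) (enum_val r) + \sum_i (tree_vall i (q k) (enum_val r) +
        (if k is k'.+1 then (beta i - 1) * tree_vall i (q k') (enum_val r) else 0)).
    rewrite big_split addrA /= mxE; congr (_ + _).
      rewrite mulmxDl mxE tree_pcE mulmx_suml summxE; congr (_ + _).
      by apply: eq_bigr => i _; rewrite scale1r tree_plE.
    case: k => [|k]; first by rewrite mxE big1.
    rewrite mulmx_suml summxE; apply: eq_bigr => i _.
    by rewrite -scalemxAl mxE tree_plE.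
  case: (enum_val r) => [[[[i kb] kg] kc]|k0] /=; last first.
    rewrite !big1 ?addr0; first last.
    - by move=> i _; case: k => [|k]; rewrite ?mulr0 addr0.
    - by [].
    case: ifP => //; rewrite /valid_zero inE mxE => /orP[/eqP ->|/hsH h].
      by rewrite (cocycle1 hfs hd.1) mul0r.
    by rewrite hd.2 // mul0r.
  case: (boolP (valid_edge i kb kg kc)) => /=; last first.
    move=> _; rewrite !big1 ?addr0 // => i' _.
    by case: k => [|k]; rewrite ?mulr0 addr0.
  move=> /andP[/eqP sb /eqP sc]; rewrite (bigD1 i) //= [in RHS](bigD1 i) //= !eqxx.
  rewrite !big1; first last.
  - by move=> i' i'i; rewrite eq_sym (negbTE i'i); case: k => [|k]; rewrite ?mulr0 addr0.
  - by move=> i' i'i; rewrite eq_sym (negbTE i'i).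
  rewrite !addr0 !mxE sb sc opprK /R mulg1.
  case: (hQ i) => _ _ h3.
  rewrite (unipotent_cocycle_shift _ _ hd) ?bsB ?mem_nth // h3.
  set X := (if k is k'.+1 then (bt (b i) - 1) * d (s kg) k' else 0).
  have -> : (if k is k'.+1 then (bt (b i) - 1) * - q k' kg 0 else 0) = - (X * P (s kg)).
    by rewrite /X; case: (k) => [|k']; rewrite ?mul0r ?oppr0 // mulrN mxE mulrA.
  have -> : (if k is k'.+1 then (bt (b i) - 1) * (d (s kg) k' * Q i (s kg)) else 0) =
      X * Q i (s kg).
    by rewrite /X; case: (k) => [|k']; rewrite ?mul0r // mulrA.
  move: X (d (b i) k) (d (s kg) k) (P (s kg)) (Q i (s kg)) (P (b i)) => X x y p w e.
  rewrite !mulrDl (mulrDr y) (mulrDr X) mulrBr.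
  move: (x * (p + w)) (x * e) (y * p) (y * w) (X * p) (X * w) => t1 t2 t3 t4 t5 t6.
  rewrite -opprD -(addrA t1) addrACA addrCA -(addrA (t3 + t5)) [t3 + t5 + _]addrC addrK.
  by rewrite addrAC addrA.
have sh : shift_seq const_part lin_part U q.
  split=> [|k]; rewrite partsE.
    by have := Wrow 0%N; rewrite addr0.
  exact: Wrow k.+1.
have Uker' v : (const_part + lin_part) *m v = 0 -> U v by rewrite partsE; apply: Uker.
exact: (shift_seqP hD UD UM Uker' Ulin j sh).
Qed.

End Saturated.
End UnipotentDeformation.

Definition suffix_closed (F : groupType) (bs S : seq F) := forall g, g \in S ->
  exists w, [/\ {in w, forall l, l.1 \in bs}, g = word_eval w &
                forall i, word_eval (drop i w) \in S].

(** * Solutions of the pencil as restrictions of cocycles *)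

Section Trees.
Variables (F : groupType) (B : {pred F}) (hB : free_basis B).

Lemma tree_exists (X : seq F) : exists bs S,
  [/\ uniq bs, {subset bs <= B} , uniq S, {subset X <= S} &
      {subset bs <= S} /\ suffix_closed bs S].
Proof.
have /choice [wd wdP] : forall g, exists w, {in w, forall l, l.1 \in B} /\ g = word_eval w.
  by move=> g; have [w] := free_group_word hB g; exists w.
pose bs := undup (flatten [seq [seq l.1 | l <- wd x] | x <- X]).
pose ws := [seq wd x | x <- X] ++ [seq [:: (b, true)] | b <- bs].
pose S := undup (flatten [seq [seq word_eval (drop i w) | i <- iota 0 (size w).+1] | w <- ws]).
have memS w i : w \in ws -> word_eval (drop i w) \in S.
  move=> ww; rewrite mem_undup; apply/flatten_mapP; exists w => //.
  have [iw|wi] := leqP i (size w).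
    by apply/mapP; exists i; rewrite // mem_iota.
  apply/mapP; exists (size w); first by rewrite mem_iota leqnn.
  by rewrite drop_size drop_oversize // ltnW.
exists bs, S; split; rewrite ?undup_uniq //.
- move=> b; rewrite mem_undup => /flatten_mapP[x Xx /mapP[l lw ->]].
  by case: (wdP x) => /(_ l lw).
- move=> x Xx; rewrite (wdP x).2 -[wd x]drop0; apply: memS.
  by rewrite mem_cat map_f.
split=> [b bb|g].
  have := memS [:: (b, true)] 0%N; rewrite /= mulg1; apply.
  by rewrite mem_cat map_f ?orbT.
rewrite mem_undup => /flatten_mapP[w ww /mapP[i _ ->]]; exists (drop i w); split=> //.
  move=> l /mem_drop lw; move: ww; rewrite mem_cat => /orP[/mapP[x Xx wE]|/mapP[b bb wE]].
    rewrite mem_undup; apply/flatten_mapP; exists x => //.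
    by apply/mapP; exists l; rewrite -?wE.
  by move: lw; rewrite wE inE => /eqP ->.
by move=> j; rewrite drop_drop; apply: memS.
Qed.

Section Solutions.
Variables (H : groupClosed F) (hs : seq F).
Hypothesis hsgen : forall L : groupClosed F, {subset hs <= L} -> {subset H <= L}.

Lemma cocycle_vanishes (A : nzRingType) (phi d : F -> A) : group_hom phi -> cocycle phi d ->
  {in hs, forall h, d h = 0} -> {in H, forall h, d h = 0}.
Proof.
move=> hphi dM dhs.
pose L : {pred F} := fun g => `[< d g = 0 >].
have LP g : reflect (d g = 0) (g \in L) by apply: asboolP.
have L1 : 1%g \in L by apply/LP/(cocycle1 hphi dM).
have LM : mulg_closed L by move=> g h /LP g0 /LP h0; apply/LP; rewrite dM g0 h0 mulr0 addr0.
have LV : invg_closed L.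
  by move=> g /LP g0; apply/LP; rewrite (cocycleV g hphi dM) g0 mulr0 oppr0.
pose LL : groupClosed F := HB.pack L (isInvClosed.Build F L LV)
  (isMul1Closed.Build F L L1) (monoid.isMulClosed.Build F L LM).
have hL : {subset hs <= LL} by move=> h /dhs h0; apply/LP.
by move=> h /(hsgen hL)/LP.
Qed.

Variables (bs S : seq F).
Hypothesis Su : uniq S.
Hypothesis bsB : {subset bs <= B}.
Hypothesis hsS : {subset hs <= S}.
Hypothesis bsS : {subset bs <= S}.
Hypothesis Sclosed : suffix_closed bs S.
Local Notation n := (size bs).
Local Notation N := (size S).
Local Notation b := (fun i : 'I_n => nth 1%g bs i).
Local Notation s := (fun k : 'I_N => nth 1%g S k).

Lemma index_in (T : eqType) (x0 x : T) (l : seq T) : x \in l ->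
  exists k : 'I_(size l), nth x0 l k = x.
Proof.
move=> xl; have lt : (index x l < size l)%N by rewrite index_mem.
by exists (Ordinal lt); rewrite /= nth_index.
Qed.

(** As [F] is free, the values of [v] at the letters extend to a cocycle. The edge equations
    determine [v] from suffix to suffix, so the two agree on [S], and vanishing on [hs] spreads to
    [H]. *)
Lemma sol_cocycle (K : fieldType) (A : nzRingType) (kap : {rmorphism K -> A}) (phi : F -> A)
    (v : 'cV[A]_N) : group_hom phi ->
  pev kap (fun i : 'I_n => phi (b i)) (tree_pencil K bs S hs) *m v = 0 ->
  exists d, [/\ cocycle phi d, {in H, forall h, d h = 0} & forall k, v k 0 = d (s k)].
Proof.
move=> hphi /tree_solP[vedge vzero].
have /choice [c cE] : forall g, exists y, forall k : 'I_N, s k = g -> v k 0 = y.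
  move=> g; have [gS|gS] := boolP (g \in S); last first.
    by exists 0 => k kg; move: gS; rewrite -kg mem_nth.
  have [k0 k0g] := index_in 1%g gS; exists (v k0 0) => k kg; congr (v _ 0).
  by apply: val_inj; apply/eqP; rewrite /= -(nth_uniq 1%g (ltn_ord k) (ltn_ord k0) Su) kg k0g.
have [d dM dB] := free_cocycle hB c hphi.
have vword w : {in w, forall l, l.1 \in bs} -> (forall i, word_eval (drop i w) \in S) ->
    forall k, s k = word_eval w -> v k 0 = d (s k).
  elim: w => [|[g sg] w IH] wbs wS k kw.
    by rewrite vzero ?kw ?(cocycle1 hphi dM) // /valid_zero kw inE eqxx.
  have gbs : g \in bs by apply: (wbs (g, sg)); rewrite mem_head.
  have [i ig] := index_in 1%g gbs.
  have [kb kbg] := index_in 1%g (bsS gbs).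
  have [k' k'w] : exists k' : 'I_N, s k' = word_eval w.
    by apply: index_in; have := wS 1%N; rewrite /= drop0.
  have vkb : v kb 0 = d g by rewrite (cE g kb) // dB //; apply: bsB.
  have vk' : v k' 0 = d (s k').
    apply: IH k'w => [l lw|j]; first by apply: wbs; rewrite inE lw orbT.
    by have := wS j.+1.
  case: sg wbs wS kw => _ _ kw.
    have ve : valid_edge i kb k' k by rewrite /valid_edge ig kbg kw k'w !eqxx.
    by rewrite (vedge _ _ _ _ ve) vkb vk' kw k'w ig -dM.
  (* For an inverse letter the edge runs from the longer word to its suffix, and [phi g] is
     cancelled. *)
  have ve : valid_edge i kb k k'.
    by rewrite /valid_edge ig kbg kw k'w /letter_eval /= mulgA mulgV mul1g !eqxx.
  have [_ phiV] := group_homV g hphi.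
  have := vedge _ _ _ _ ve; rewrite vkb vk' ig k'w.
  have -> : word_eval w = (g * s k)%g by rewrite kw /letter_eval /= mulgA mulgV mul1g.
  rewrite dM => /addrI/(congr1 (fun y => phi g^-1%g * y)).
  by rewrite !mulrA phiV !mul1r => ->.
have vd k : v k 0 = d (s k).
  have [w [wbs kw wS]] := Sclosed (mem_nth 1%g (ltn_ord k)).
  exact: vword wbs wS k kw.
exists d; split=> //; apply: (cocycle_vanishes hphi dM) => h hh.
have [k kh] := index_in 1%g (hsS hh).
by rewrite -kh -vd vzero // /valid_zero kh inE hh orbT.
Qed.

End Solutions.
End Trees.

(** * Comparison of a maximal point with its unipotent deformation *)

Section UnipotentPoint.
Variables (D : unitRingType) (hD : division_ring D).
Local Notation idm := (idfun : {rmorphism D -> D}).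
Local Notation PS := (spow idm).
Local Notation z := (spX idm).
Local Notation emb := (lemb hD (sg := idm)).

Lemma laurent_trivial_kernel k N (M : 'M[PS]_(k, N)) :
  trivial_kernel M -> trivial_kernel (map_mx emb M).
Proof.
move=> tM v Mv; have [l [x vx]] := common_denominator v.
have zC (f : PS) : f * z ^+ l = z ^+ l * f.
  rewrite spXn_comm; congr (_ * _); apply/spE=> q.
  by rewrite sps_iter; elim: l {vx}.
suff x0 : x = 0.
  move/(congr1 (fun w => (emb (z ^+ l))^-1 *: w)): vx.
  by rewrite x0 map_mx0 scaler0 scalerA mulVr ?lembX_unit // scale1r.
apply: tM; apply: (map_mx_injective (@lemb_inj _ hD idm)).
rewrite map_mxM /= -vx map_mx0 -[RHS](scaler0 _ (emb (z ^+ l))) -Mv.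
apply/colP=> r; rewrite !mxE mulr_sumr; apply: eq_bigr => c _; rewrite !mxE.
by rewrite !mulrA -!rmorphM zC.
Qed.

Variables (K : fieldType) (kap : {rmorphism K -> D}) (n : nat) (beta : 'I_n -> D).
Local Notation ubeta := (fun i => unipotent (beta i)).

Lemma pev_unipotent k N (Q : pencil K n k N) :
  pev (lconst hD idm \o kap) (fun i => emb (unipotent (beta i))) Q =
  map_mx emb (pev (spC idm \o kap) ubeta Q).
Proof. by rewrite map_pev; apply: eq_pev. Qed.

(** The constant term of the pencil here is its value at the point 1, which may be singular, so
    coefficients cannot be eliminated one by one. Injectivity at z = 1 is used instead, through
    [shift_seqP] with [U] reduced to 0. *)
Lemma unipotent_trivial_kernel k N (Q : pencil K n k N) :
  trivial_kernel (pev kap beta Q) ->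
  trivial_kernel (pev (spC idm \o kap) ubeta Q).
Proof.
move=> tQ x Qx.
pose U i := beta i - 1.
have uE : pev (spC idm \o kap) ubeta Q =
    pev (jpow idm idm \o kap) (perturb idm idm (fun=> 1) U) Q.
  by apply: eq_pev => // i; rewrite /perturb /unipotent rmorph1.
have idC (d : D) : idm (idm d) = idm d by [].
have sum_parts : pev kap (fun=> 1) Q + plin kap U Q = pev kap beta Q.
  rewrite /pev -addrA /plin -big_split; congr (_ + _); apply: eq_bigr => i _ /=.
  by rewrite -scalerDl addrC subrK.
rewrite uE in Qx.
have map_idm a b (M : 'M[D]_(a, b)) : map_mx idm M = M by apply/matrixP=> i j; rewrite mxE.
have plin_idm : plin (idm \o kap) U Q = plin kap U Q by rewrite -map_plin map_idm.
have sh : shift_seq (pev kap (fun=> 1) Q) (plin kap U Q) (eq^~ 0) (fun q => cf q x).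
  split=> [|q]; exists 0 => //; rewrite mulmx0.
    by move/(congr1 (cf 0)): Qx; rewrite cf_perturb0 // cf0 map_idm.
  by move/(congr1 (cf q.+1)): Qx; rewrite cf_perturbS // cf0 !map_idm plin_idm.
apply: cfP => q; rewrite cf0.
apply: (shift_seqP hD (U := eq^~ 0) _ _ _ _ q sh) => [u v -> ->|u c ->|v|u ->].
- by rewrite addr0.
- by rewrite mul0mx.
- by rewrite sum_parts; apply: tQ.
- by exists 0; rewrite // !mulmx0.
Qed.

Lemma pev_pivot_kernel m N (A : nzRingType) (h : {rmorphism K -> A}) (X : 'I_n -> A)
    (Q : pencil K n m N) sel (v : 'cV_N) :
  pev h X Q *m v = 0 -> (forall k, sel k = None -> v k 0 = 0) ->
  pev h X (pstack (pivot_row Q sel)) *m v = 0.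
Proof.
move=> Qv v0; apply/row_matrixP=> k; rewrite row_mul row_pev_stack row0 /pivot_row.
case sk: (sel k) => [i|]; first by rewrite -row_pev -row_mul Qv row0.
by rewrite pev_const map_delta_mx -rowE; apply/rowP=> j; rewrite ord1 !mxE v0.
Qed.

(* The pencil Q extended by the rows e_k, for k outside the pivots of (Q; y), is
   nonsingular at the unipotent point, hence at beta; but a solution v of Q at
   beta with y v <> 0 can be corrected so as to vanish at these k. *)
Lemma maximal_point_row m N (Q : pencil K n m N) (y : 'rV[K]_N) : maximal_point kap beta ->
  (forall x, pev (spC idm \o kap) ubeta Q *m x = 0 -> map_mx (spC idm \o kap) y *m x = 0 :> 'cV_1) ->
  forall v, pev kap beta Q *m v = 0 -> map_mx kap y *m v = 0 :> 'cV_1.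
Proof.
move=> hmax hy v0 Qv0; pose Qy := pcol Q (pconst n y).
have [sel [G [h1 h2 h3]]] := gauss hD (pev kap beta Qy).
have tpiv : trivial_kernel (pev kap beta (pstack (pivot_row Qy sel))).
  by move=> v; rewrite pev_pivot => /(congr1 (mulmx G)); rewrite mulmxA h2 mul1mx mulmx0.
pose E : 'M[K]_N := \matrix_k (if sel k is None then delta_mx 0 k else 0).
have EP (A : nzRingType) (h : {rmorphism K -> A}) (v : 'cV_N) :
    map_mx h E *m v = 0 <-> forall k, sel k = None -> v k 0 = 0.
  have rowEv k : row k (map_mx h E *m v) = if sel k is None then row k v else 0.
    rewrite row_mul -map_row rowK; case: (sel k) => [i|].
      by rewrite map_mx0 mul0mx.
    by rewrite map_delta_mx -rowE.
  split=> [Ev k sk|v0k].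
    by have := rowEv k; rewrite Ev sk row0 => /rowP/(_ 0); rewrite !mxE.
  apply/row_matrixP=> k; rewrite rowEv row0; case sk: (sel k) => //.
  by apply/rowP=> j; rewrite ord1 !mxE v0k.
have tQE : trivial_kernel (pev kap beta (pcol Q (pconst n E))).
  apply: (hmax _ (lconst hD idm) (fun i => emb (unipotent (beta i)))) => [|i|].
  - exact: laurent_division.
  - apply/eqP; rewrite -[RHS](rmorph0 emb) => /lemb_inj/(congr1 (fun f => f 0%N)).
    by rewrite /unipotent spD spM0 mulr0 addr0 sp1 => /eqP; rewrite oner_eq0.
  rewrite pev_unipotent; apply: laurent_trivial_kernel => x.
  rewrite pev_col pev_const mul_col_mx => /eqP; rewrite col_mx_eq0 => /andP[/eqP Qx /eqP/EP Ex].
  apply: (unipotent_trivial_kernel tpiv).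
  apply: pev_pivot_kernel Ex; rewrite pev_col pev_const mul_col_mx Qx hy //.
  exact: col_mx0.
(* [G *m w] is the kernel vector of [Qy] that has the same entries as [v0] at the unselected [k]. *)
pose w : 'cV[D]_N := \col_k (if sel k is None then v0 k 0 else 0).
have : pev kap beta Qy *m (G *m w) = 0.
  apply/colP=> i; rewrite mulmxA [LHS]mxE [RHS]mxE big1 // => k _; rewrite [w k 0]mxE.
  by case sk: (sel k) => [j|]; rewrite ?mulr0 // h3 // mul0r.
rewrite pev_col pev_const mul_col_mx => /eqP; rewrite col_mx_eq0 => /andP[/eqP QGw /eqP yGw].
suff /subr0_eq -> : v0 - G *m w = 0 by [].
apply: tQE; rewrite pev_col pev_const mul_col_mx mulmxBr Qv0 QGw subrr.
rewrite (proj2 (EP _ kap _)) ?col_mx0 // => k sk.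
have : row k (pivot_mx (pev kap beta Qy) sel *m (G *m w)) = row k w.
  by rewrite mulmxA h1 mul1mx.
rewrite row_mul rowK sk -rowE => /rowP/(_ 0).
rewrite [LHS]mxE [RHS]mxE [RHS]mxE sk => e.
by rewrite [LHS]mxE [X in _ + X]mxE e subrr.
Qed.

End UnipotentPoint.

Lemma glin_col (K : nzRingType) (F : groupType) (A : nzRingType) (kap : {rmorphism K -> A})
    (S : seq F) (x : group_algebra K F) (d : F -> A) : uniq S -> {subset msupp x <= S} ->
  map_mx kap (\row_(k < size S) x@_(nth 1%g S k)) *m (\col_(k < size S) d (nth 1%g S k)) =
  (glin kap d x)%:M :> 'M_1.
Proof.
move=> Su xS; apply/matrixP=> i j; rewrite {i}ord1 {j}ord1 [RHS]mxE eqxx mulr1n.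
have le : (msupp x `<=` [fset g in S])%fset.
  by apply/fsubsetP=> g /xS; rewrite inE.
rewrite (glinw _ _ le) [RHS](perm_big S) /=; last first.
  by apply: uniq_perm; rewrite ?fset_uniq // => g; rewrite inE.
rewrite mxE (big_nth 1%g) big_mkord; apply: eq_bigr => k _.
by rewrite !mxE.
Qed.

(** * The hull of H and the separation of its cosets *)

Section RigidHull.
Variables (F : groupType) (B : {pred F}) (hB : free_basis B).
Variables (D : unitRingType) (hD : division_ring D).
Variables (K : fieldType) (kap : {rmorphism K -> D}).
Hypothesis kapC : forall c x, kap c * x = x * kap c.
Variables (bt : F -> D) (hbt : group_hom bt).
Hypothesis hmax : forall n (b : 'I_n -> F), injective b -> (forall i, b i \in B) ->
  maximal_point kap (fun i => bt (b i)).
Local Notation idm := (idfun : {rmorphism D -> D}).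
Local Notation PS := (spow idm).
Variables (fs : F -> PS) (hfs : group_hom fs).
Hypothesis fsB : {in B, forall b, fs b = unipotent (bt b)}.
Variables (H : groupClosed F) (hs : seq F).
Hypothesis hsH : {subset hs <= H}.
Hypothesis hsgen : forall L : groupClosed F, {subset hs <= L} -> {subset H <= L}.

Let bt_neq0 g : bt g != 0.
Proof.
apply/eqP=> bg; have [] := group_homV g hbt.
by rewrite bg mul0r => /esym/eqP; rewrite oner_eq0.
Qed.

(** The coefficients of [x] form a relation over [K] that holds on the solutions at [bt], hence on
    [U], which contains P - P(1). The constant P(1) contributes a multiple of the augmentation. *)
Lemma glin_cocycle_poly (x : group_algebra K F) : augmentation x = 0 ->
  (forall d, cocycle bt d -> {in H, forall h, d h = 0} -> glin kap d x = 0) ->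
  forall M P, cocycle_poly fs H M P -> glin kap P x = 0.
Proof.
move=> x0 xd M P hP.
have [bs [S [bsu bsB Su XS [bsS Scl]]]] := tree_exists hB (msupp x ++ hs).
have xS : {subset msupp x <= S} by move=> g xg; apply: XS; rewrite mem_cat xg.
have hsS : {subset hs <= S} by move=> g hg; apply: XS; rewrite mem_cat hg orbT.
have bI : injective (fun i : 'I_(size bs) => nth 1%g bs i).
  by move=> i j /eqP; rewrite nth_uniq // => /eqP/val_inj.
have bB (i : 'I_(size bs)) : nth 1%g bs i \in B by apply/bsB/mem_nth.
have [U [[UD UM UZ] Uker Upl Ux]] :=
  saturation hD kapC (fun i => bt_neq0 _) (hmax bI bB) (tree_pencil K bs S hs).
have [gP _] := good_poly hD hfs fsB kapC bsB hsH UD UM UZ Uker Upl hP.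
have : map_mx kap (\row_(k < size S) x@_(nth 1%g S k)) *m tree_vec S (fun g => P g - P 1%g) = 0 :> 'M_1.
  apply: Ux gP => v Av.
  have [d [dM dH vd]] := sol_cocycle hB hsgen Su bsB hsS bsS Scl hbt Av.
  rewrite (_ : v = \col_(k < size S) d (nth 1%g S k)); last by apply/colP=> k; rewrite mxE.
  by rewrite glin_col // xd // raddf0.
rewrite glin_col // => /matrixP/(_ 0 0); rewrite !mxE eqxx mulr1n => hx.
have -> : glin kap P x = glin kap (fun g => P g - P 1%g) x + kap (augmentation x) * P 1%g.
  rewrite /augmentation rmorph_sum mulr_suml -big_split; apply: eq_bigr => g _ /=.
  by rewrite -mulrDr subrK.
by rewrite hx x0 rmorph0 mul0r addr0.
Qed.

Lemma rigid_hull_exists : exists Ht : groupClosed F,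
  forall g, g \in Ht <-> forall d, unipotent_cocycle fs H d -> d g = 0.
Proof.
pose L : {pred F} := fun g => `[< forall d, unipotent_cocycle fs H d -> d g = 0 >].
have LP g : reflect (forall d, unipotent_cocycle fs H d -> d g = 0) (g \in L).
  exact: asboolP.
have L1 : 1%g \in L by apply/LP=> d [dM _]; apply: cocycle1 hfs dM.
have LM : mulg_closed L.
  by move=> g h /LP g0 /LP h0; apply/LP=> d hd; rewrite hd.1 g0 ?h0 // mulr0 addr0.
have LV : invg_closed L.
  by move=> g /LP g0; apply/LP=> d hd; rewrite (cocycleV g hfs hd.1) g0 // mulr0 oppr0.
pose LL : groupClosed F := HB.pack L (isInvClosed.Build F L LV)
  (isMul1Closed.Build F L L1) (monoid.isMulClosed.Build F L LM).
by exists LL => g; split=> /LP.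
Qed.

Section Hull.
Variable Ht : groupClosed F.
Hypothesis HtP : forall g, g \in Ht <-> forall d, unipotent_cocycle fs H d -> d g = 0.
Local Notation sim g g' := ((g^-1 * g')%g \in Ht).

(** Cocycles vanishing on [Ht] are constant on left cosets. For each [t] outside the coset of [g1],
    one of them takes different values at [t] and [g1], and the factor d_j - d(t)_j for a
    coefficient where they differ is multiplied in. *)
Lemma hull_separation (T : seq F) g1 : exists M P, [/\ cocycle_poly fs H M P,
   forall g h, h \in Ht -> P (g * h)%g = P g, P g1 != 0 &
   {in T, forall t, ~~ sim g1 t -> P t = 0}].
Proof.
elim: T => [|t T [M [P [hP PHt P1 PT]]]].
  by exists 0%N, (fun=> 1); split=> //; [exact: CPconst|exact: oner_neq0].
have [g1t|g1t] := boolP (sim g1 t).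
  exists M, P; split=> // t'; rewrite inE => /predU1P[->|]; last exact: PT.
  by rewrite g1t.
have [d hd dt] : exists2 d, unipotent_cocycle fs H d & d (g1^-1 * t)%g <> 0.
  apply: contraNP g1t => /forall2NP h; apply/HtP=> d hd.
  by case: (h d) => // /contrapT.
have [j dj] : exists j, d g1 j - d t j != 0.
  apply: contra_notP dt => /forallNP h; have [_ fV] := group_homV g1 hfs.
  have dg1 : d t = d g1.
    by apply/spE=> j; apply/esym/eqP; rewrite -subr_eq0; apply: contraT => /h.
  have := hd.1 g1 (g1^-1 * t)%g; rewrite mulgA mulgV mul1g dg1.
  rewrite -{1}[d g1]addr0 => /addrI/(congr1 (fun y => fs g1^-1%g * y)).
  by rewrite mulr0 mulrA fV mul1r.
exists (M + j).+1, (fun g => d g j * P g + - d t j * P g); split.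
- apply: CPadd; first exact: CPmul.
  by apply/CPscale/(cocycle_polyW _ hP); rewrite ltnW // ltnS leq_addr.
- move=> g h hh; rewrite PHt // hd.1.
  by rewrite (proj1 (HtP h) hh d hd) mulr0 addr0.
- rewrite -mulrDl; apply/eqP=> /(congr1 (fun y => (d g1 j - d t j)^-1 * y)).
  by rewrite mulr0 mulKr ?hD // => /eqP; apply/negP.
move=> t' t'T nt'; rewrite -mulrDl.
move: t'T; rewrite inE => /predU1P[->|t'T]; first by rewrite subrr mul0r.
by rewrite PT ?mulr0.
Qed.

(** Against the separating function only the coset of [g1] contributes, and there the function is a
    nonzero constant. *)
Lemma hull_class_sum (x : group_algebra K F) :
  (forall M P, cocycle_poly fs H M P -> glin kap P x = 0) ->
  forall g1, \sum_(g <- msupp x | sim g1 g) x@_g = 0.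
Proof.
move=> xP g1; have [M [P [hP PHt P1 PT]]] := hull_separation (msupp x) g1.
apply: (fmorph_inj kap); rewrite rmorph0; apply: contraTeq P1 => nz.
have := xP M P hP; rewrite /glin (bigID (fun g => sim g1 g)) /=.
rewrite [X in _ + X]big_seq_cond [X in _ + X]big1 ?addr0; last first.
  by move=> g /andP[gx ng]; rewrite PT ?mulr0.
rewrite (eq_bigr (fun g => kap x@_g * P g1)); last first.
  by move=> g sg; rewrite -(PHt g1 _ sg) mulgA mulgV mul1g.
rewrite -mulr_suml -rmorph_sum => /(congr1 (fun y => (kap (\sum_(g <- msupp x | sim g1 g) x@_g))^-1 * y)).
by rewrite mulr0 mulKr ?hD // => ->; rewrite eqxx.
Qed.

End Hull.
End RigidHull.

(** Cosets are split off one at a time. The part of [x] on the coset of [g1] is [g1] times an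
    element supported in [L], whose augmentation is the class sum. *)
Lemma class_sum_induced (K : nzRingType) (F : groupType) (L : groupClosed F)
    (x : group_algebra K F) :
  (forall g1, \sum_(g <- msupp x | (g1^-1 * g)%g \in L) x@_g = 0) ->
  (x : (group_algebra K F)^o) \in induced_aug_ideal K L.
Proof.
pose sim g g' := (g^-1 * g')%g \in L.
have simV g g' : sim g g' = sim g' g by rewrite /sim -[RHS]gpredV invgM invgK.
have simT g g' g'' : sim g g' -> sim g' g'' = sim g g''.
  by move=> h; rewrite /sim -(gpredMl _ h) mulgA mulgK.
suff key (c : F -> K) (s : seq F) : (forall g1, \sum_(g <- s | sim g1 g) c g = 0) ->
    (\sum_(g <- s) << c g *g g >> : (group_algebra K F)^o) \in induced_aug_ideal K L.
  by move=> hx; rewrite [x]monalgE; apply: key.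
move: {2}(size s) (leqnn (size s)) => m; elim: m s => [|m IH] [|g1 s] //= sm hc;
  rewrite ?big_nil ?rpred0 //.
rewrite (bigID (sim g1)) /=; apply: rpredD; last first.
  rewrite -big_filter; apply: IH => [|g2].
    rewrite /= /sim mulVg gpred1 /= size_filter.
    by apply: leq_trans (count_size _ _) _.
  have [h12|h12] := boolP (sim g1 g2).
    rewrite big_filter_cond big1 // => g /andP[/negP n1 h2]; case: n1.
    by rewrite -(simT _ g2).
  rewrite big_filter_cond -[RHS](hc g2); apply: eq_bigl => g.
  case h2: (sim g2 g); rewrite ?andbF // andbT.
  by apply: contraNT h12; rewrite negbK => h1; rewrite -(simT _ g) // simV.
pose y : group_algebra K F := \sum_(g <- g1 :: s | sim g1 g) << c g *g (g1^-1 * g)%g >>.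
have -> : \sum_(g <- g1 :: s | sim g1 g) << c g *g g >> = (gelt K g1 : group_algebra K F) * y.
  rewrite mulr_sumr; apply: eq_bigr => g _.
  by rewrite [RHS]gamulUU mul1r mulgA mulgV mul1g.
apply: (@rpredZ _ _ (induced_aug_ideal K L) (gelt K g1) y).
apply: mem_span; split.
  move=> g; rewrite -mcoeff_neq0; apply: contraNT => ng.
  rewrite raddf_sum big1 // => g' h /=; rewrite mcoeffU; case: eqP => // gg.
  by move: ng; rewrite -gg => /negP; case.
rewrite unfold_in; apply/eqP; rewrite raddf_sum -[RHS](hc g1).
by apply: eq_bigr => g _; apply: augmentationU.
Qed.

(** * Torsion *)

Section UnitTensor.
Variables (R D : nzRingType) (f : {rmorphism R -> D}) (M : lmodType R).

Definition unit_tensor (m : M) : tensor f M := pure_tensor f 1 m.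

Fact unit_tensor_zmod : zmod_morphism unit_tensor.
Proof.
have [_ bD _] := @pure_tensor_balanced _ _ f M.
by move=> m m'; apply: (addIr (unit_tensor m')); rewrite subrK -bD subrK.
Qed.
HB.instance Definition _ :=
  GRing.isZmodMorphism.Build M (tensor f M) unit_tensor unit_tensor_zmod.

Lemma unit_tensorZ r m : unit_tensor (r *: m) = f r *: unit_tensor m.
Proof.
have [_ _ bZ] := @pure_tensor_balanced _ _ f M.
by rewrite /unit_tensor -bZ pure_tensorZ mul1r mulr1.
Qed.

End UnitTensor.

Lemma unit_tensor_projP (R D : nzRingType) (f : {rmorphism R -> D}) (M : lmodType R)
    (N : submodClosed M) a (y y' : M) :
  unit_tensor f (proj N (a *: y + y')) =
  f a *: unit_tensor f (proj N y) + unit_tensor f (proj N y').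
Proof. by rewrite linearP raddfD /= unit_tensorZ. Qed.

Lemma unit_tensor_relation (R D : nzRingType) (f : {rmorphism R -> D}) (M : lmodType R)
    (N : submodClosed M) n (c : 'I_n -> R) (y : 'I_n -> M) :
  \sum_i c i *: y i \in N -> \sum_i f (c i) *: unit_tensor f (proj N (y i)) = 0.
Proof.
rewrite -proj_eq0 => /eqP e; rewrite -[RHS](raddf0 (@unit_tensor R D f (quot_module N))) -e.
rewrite linear_sum raddf_sum; apply: eq_bigr => i _.
by rewrite -unit_tensorZ linearZ.
Qed.

Section Rigidity.
Variables (F : groupType) (B : {pred F}) (hB : free_basis B).
Variables (D : unitRingType) (iota : {rmorphism group_algebra 'F_2 F -> D}).
Hypothesis hD : universal_division_ring_of_fractions iota.
Local Notation R := (group_algebra 'F_2 F).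
Local Notation I := (aug_ideal 'F_2 F).
Local Notation kap := (iota \o @gconst 'F_2 F : {rmorphism 'F_2 -> D}).
Local Notation bt := (fun g => iota (gelt 'F_2 g)).
Let hdiv : division_ring D. Proof. by case: hD. Qed.
Let kapC c x : kap c * x = x * kap c. Proof. exact: F2_central. Qed.
Let hbt : group_hom bt.
Proof.
by have [h1 hM] := gelt_hom 'F_2 F; split=> [|g h]; rewrite ?h1 ?hM ?rmorph1 ?rmorphM.
Qed.
Local Notation idm := (idfun : {rmorphism D -> D}).
Local Notation PS := (spow idm).
Variables (fs : F -> PS) (hfs : group_hom fs).
Hypothesis fsB : {in B, forall b, fs b = unipotent (bt b)}.
Variables (H : groupClosed F) (hs : seq F).
Hypothesis hsH : {subset hs <= H}.
Hypothesis hsgen : forall L : groupClosed F, {subset hs <= L} -> {subset H <= L}.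
Variable Ht : groupClosed F.
Hypothesis HtP : forall g, g \in Ht <-> forall d, unipotent_cocycle fs H d -> d g = 0.
Local Notation JH := (submod_in I (induced_aug_ideal 'F_2 H)).

Let glin_iota x : glin kap bt x = iota x.
Proof.
rewrite {2}[x]monalgE rmorph_sum; apply: eq_bigr => g _.
by rewrite /= -rmorphM gelt_const.
Qed.

Let glin_induced d y : cocycle bt d -> {in H, forall h, d h = 0} ->
  y \in induced_aug_ideal 'F_2 H -> glin kap d y = 0.
Proof.
move=> dM dH hy.
(* The augmentation is part of [N] because the product rule for a u contains d(a) times the
   augmentation of u. *)
pose N : {pred R^o} := fun y => (augmentation y == 0) && (glin kap d y == 0).
suff /andP[_ /eqP //] : y \in N.
move/spanP: hy; apply; first split.
- by apply/andP; rewrite augmentation0 glin0 !eqxx.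
- move=> a u v /andP[/eqP u0 /eqP du] /andP[/eqP v0 /eqP dv]; apply/andP.
  rewrite raddfD /= [a *: u]/(a * u) rmorphM /= glinD (glin_cocycle kapC a u hbt dM) u0 v0 du dv.
  by rewrite rmorph0 !mulr0 !addr0 !eqxx.
move=> u [uH /eqP u0]; apply/andP; split; apply/eqP => //.
by rewrite /glin big_seq big1 // => g /uH/dH ->; rewrite mulr0.
Qed.

(** On the augmentation ideal the product rule reduces to d(r y) = r d(y), so [d] is a linear map
    from the quotient to [D]. It factors through the tensor product, where a torsion element becomes
    0. *)
Lemma glin_tor (x : submod I) d : proj JH x \in tor iota (quot_module JH) ->
  cocycle bt d -> {in H, forall h, d h = 0} -> glin kap d (val x) = 0.
Proof.
rewrite mem_tor => /eqP tx dM dH.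
have [psi psiE] : exists psi : quot_module JH -> D,
    forall y, psi (proj JH y) = (glin kap d \o val) y.
  apply: quot_lift => y; rewrite mem_submod_in => hy.
  exact: glin_induced hy.
have psiD : {morph psi : m m' / m + m'}.
  move=> m m'; have [y <-] := proj_surj m; have [y' <-] := proj_surj m'.
  by rewrite -projD !psiE /= raddfD.
have regularZ (r : R) (u : R^o) : r *: u = r * (u : R) by [].
have psiZ r m : psi (r *: m) = iota r * psi m.
  have [y <-] := proj_surj m; rewrite -linearZ !psiE /= regularZ.
  rewrite (glin_cocycle kapC _ _ hbt dM) (eqP (valP y)) rmorph0 mulr0 add0r.
  by rewrite glin_iota.
have bal : balanced iota (fun a m => a * psi m).
  by split=> [a a' m|a m m'|a r m]; rewrite ?mulrDl ?psiD ?mulrDr ?psiZ ?mulrA.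
have [g gE _] := tensor_universal bal.
by rewrite -[LHS]psiE -[LHS]mul1r -gE tx raddf0.
Qed.

Lemma tor_sub_hull (x : submod I) : proj JH x \in tor iota (quot_module JH) ->
  val x \in induced_aug_ideal 'F_2 Ht.
Proof.
move=> tx; apply: class_sum_induced; apply: (hull_class_sum hdiv (kap := kap) hfs HtP).
apply: (glin_cocycle_poly hB hdiv kapC hbt _ hfs fsB hsH hsgen).
- by move=> n b bI bB; exact: (universal_maximal_point hB hD bI bB).
- exact/eqP/(valP x).
- by move=> d dM dH; apply: glin_tor tx dM dH.
Qed.

Fact gelt_sub1_subproof g : ((gelt 'F_2 g - 1 : R) : R^o) \in I.
Proof. by rewrite unfold_in raddfB /= rmorph1 augmentationU subrr. Qed.
Definition gelt_sub1 g : submod I := Sub (gelt 'F_2 g - 1 : R^o) (gelt_sub1_subproof g).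
Let t g : tensor iota (quot_module JH) := unit_tensor iota (proj JH (gelt_sub1 g)).

(** The family [t] itself satisfies the equations of the tree pencil, inside the tensor product.
    Writing the coordinate row at [g] as a combination of the rows of the pencil and applying it to
    [t] gives 0. *)
Lemma hull_tensor0 g : g \in Ht -> t g = 0.
Proof.
move=> gHt.
have [bs [S [bsu bsB Su XS [bsS Scl]]]] := tree_exists hB (g :: hs).
have hsS : {subset hs <= S} by move=> h hh; apply: XS; rewrite inE hh orbT.
have [k0 k0g] := index_in 1%g (XS g (mem_head _ _)).
pose b (i : 'I_(size bs)) := nth 1%g bs i.
have bI : injective b by move=> i j /eqP; rewrite nth_uniq // => /eqP/val_inj.
have bB i : b i \in B by apply/bsB/mem_nth.
pose PR := pev (@gconst 'F_2 F) (fun i => gelt 'F_2 (b i)) (tree_pencil _ bs S hs).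
have [w wE] : exists w, map_mx kap (delta_mx 0 k0 : 'rV_(size S)) = w *m map_mx iota PR.
  apply: row_of_kernel => // v; rewrite map_pev => Av.
  apply: (maximal_point_row hdiv (universal_maximal_point hB hD bI bB)) Av => x Ax.
  have [d [dM dH xd]] : exists d, [/\ cocycle fs d, {in H, forall h, d h = 0} &
      forall k : 'I_(size S), x k 0 = d (nth 1%g S k)].
    apply: (sol_cocycle hB hsgen Su bsB hsS bsS Scl (kap := spC idm \o kap) hfs).
    move: Ax; rewrite (eq_pev _ (kap' := spC idm \o kap) (X' := fun i => fs (b i))) // => i.
    by rewrite fsB.
  rewrite map_delta_mx -rowE; apply/rowP=> j; rewrite ord1 !mxE xd k0g.
  exact: (proj1 (HtP g)).
have rel r : \sum_k iota (PR r k) *: t (nth 1%g S k) = 0.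
  apply: unit_tensor_relation; rewrite mem_submod_in raddf_sum.
  pose v : 'cV[R]_(size S) := \col_k (gelt 'F_2 (nth 1%g S k) - 1).
  have -> : \sum_k val (PR r k *: gelt_sub1 (nth 1%g S k)) = (PR *m v) r 0 :> R^o.
    by rewrite [RHS]mxE; apply: eq_bigr => k _; rewrite [v k 0]mxE.
  rewrite tree_evalE; case: (enum_val r) => [[[[i kb] kg] kc]|k]; case: ifP => [|_];
    rewrite ?rpred0 //.
    (* The edge equation is b g - 1 = (b - 1) + b (g - 1). *)
    move=> /andP[/eqP sb /eqP sc]; rewrite !mxE sb sc (gelt_hom _ _).2 mulrBr mulr1.
    by rewrite [gelt _ _ - 1 + (_ - _)]addrC subrKA subrr rpred0.
  rewrite /valid_zero inE mxE => /orP[/eqP ->|/hsH h].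
    by rewrite (gelt_hom _ _).1 subrr rpred0.
  apply: mem_span; split; last exact: gelt_sub1_subproof.
  move=> g'; rewrite -mcoeff_neq0 mcoeffB !mcoeffU.
  case: (_ =P g') => [<- //|_]; case: (_ =P g') => [<- _|_].
    exact: gpred1.
  by rewrite !mulr0n subrr eqxx.
transitivity (\sum_k map_mx kap (delta_mx 0 k0 : 'rV_(size S)) 0 k *: t (nth 1%g S k)).
  rewrite map_delta_mx (bigD1 k0) //= mxE !eqxx scale1r k0g big1 ?addr0 // => k kk0.
  by rewrite mxE (negbTE kk0) scale0r.
rewrite wE; under eq_bigr do rewrite mxE scaler_suml.
rewrite exchange_big big1 // => r _ /=.
under eq_bigr do rewrite mxE -scalerA.
by rewrite -scaler_sumr rel scaler0.
Qed.

Lemma hull_sub_tor (x : submod I) : val x \in induced_aug_ideal 'F_2 Ht ->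
  proj JH x \in tor iota (quot_module JH).
Proof.
pose N : {pred R^o} := fun u => `[< exists2 y : submod I, val y = u &
  unit_tensor iota (proj JH y) = 0 >].
have Ncl : submod_closed N.
  split=> [|a u v /asboolP[y <- y0] /asboolP[y' <- y'0]]; apply/asboolP.
    by exists 0; rewrite // !raddf0.
  exists (a *: y + y'); first exact: linearP.
  by rewrite unit_tensor_projP y0 y'0 scaler0 addr0.
pose NN : submodClosed R^o := HB.pack N (GRing.isSubmodClosed.Build R R^o N Ncl).
move=> /spanP/(_ NN Ncl) xN; rewrite mem_tor.
have /asboolP[y /val_inj <- /eqP //] : val x \in NN.
apply: xN => u [uH /eqP u0].
(* Since its coefficients add up to 0, [u] is the combination of the elements g - 1 with the same
   coefficients. *)
have -> : u = \sum_(g <- msupp u) gconst F u@_g *: val (gelt_sub1 g).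
  rewrite {1}[u]monalgE; under [RHS]eq_bigr do rewrite scalerBr.
  rewrite sumrB [X in _ - X](_ : _ = 0) ?subr0.
    by apply: eq_bigr => g _; rewrite [RHS]gelt_const.
  transitivity (gconst F (augmentation u)); last by rewrite u0 raddf0.
  by rewrite raddf_sum; apply: eq_bigr => g _; apply: mulr1.
rewrite big_seq; apply: rpred_sum => g gu; apply: rpredZ; apply/asboolP.
by exists (gelt_sub1 g) => //; apply/hull_tensor0/uH.
Qed.

End Rigidity.

Theorem theorem3p5 (F : groupType) (hF : free_group F) (D : unitRingType)
    (iota : {rmorphism group_algebra 'F_2 F -> D})
    (hD : universal_division_ring_of_fractions iota) :
  subgroup_rigid iota.
Proof.
have [B hB] := hF; move=> H [hs [hsH hsgen]].
have hdiv : division_ring D by case: hD.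
have [fs hfs fsB] := unipotent_hom hB hdiv (fun g => iota (gelt 'F_2 g)).
have [Ht HtP] := rigid_hull_exists hfs H.
exists Ht => [h hH|JH JHt q]; first by apply/HtP=> d [_ ->].
have [x <-] := proj_surj q.
apply/idP/idP=> [tx|/sub_quotP[y hy <-]]; last exact: (hull_sub_tor hB hD hfs fsB hsH hsgen HtP).
apply/sub_quotP; exists x => //.
exact: (tor_sub_hull hB hD hfs fsB hsH hsgen HtP tx).
Qed.
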